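(* Let $p\in(1,\infty)$. Let $X$ be any three-dimensional smooth and strictly convex normed space over $\mathbb{K}$ which is not an inner-product space (i.e. its norm is not induced by an inner product). Then there exists a one-dimensional subspace $Y\subseteq X$ such that, with $W:=X/Y$ denoting the quotient space, the space $$\Big(W\oplus_p W\oplus_p\cdots\Big)\oplus_p\Big(X\oplus_p X\oplus_p\cdots\Big)$$ does not have the property (SL).
   Context: $\mathbb{K}$ is $\mathbb{R}$ or $\mathbb{C}$. A normed space is smooth if each nonzero vector $x$ has a unique supporting functional $\varphi_x$, i.e. a linear functional with $\|\varphi_x\|=1$ and $\varphi_x(x)=\|x\|$. A semi-inner product on a normed space $Z$ over $\mathbb{K}$ (in the sense of Lumer–Giles, generating the norm) is a map $[\cdot|\cdot]:Z\times Z\to\mathbb{K}$ such that for all $x,y,z\in Z$ and $\alpha,\beta,\lambda\in\mathbb{K}$: $[\alpha x+\beta y|z]=\alpha[x|z]+\beta[y|z]$; $[x|\lambda y]=\overline{\lambda}[x|y]$; $|[x|y]|\le\|x\|\,\|y\|$; $[x|x]=\|x\|^2$. On a smooth space it exists and is unique, and is given by $[x|y]=\|y\|\varphi_y(x)$, where $\varphi_0:=0$. A smooth normed space $Z$ has the property (SL) if every mapping $f:Z\to Z$ (not assumed linear, continuous or surjective) satisfying $[f(x)|f(y)]=[x|y]$ for all $x,y\in Z$ is linear. For a sequence of Banach spaces $(X_i,\|\cdot\|_i)$, the $\ell_p$-sum $X_1\oplus_p X_2\oplus_p\cdots$ is the space of sequences $(x_i)_{i\ge1}$ with $x_i\in X_i$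 and $(\|x_i\|_i)_{i\ge 1}\in\ell_p$, with norm $\big(\sum_i\|x_i\|_i^p\big)^{1/p}$. Thus the space in the claim consists of pairs $((w_k)_{k\ge1},(x_j)_{j\ge1})$ with $w_k\in W$, $x_j\in X$, of finite norm $\big(\sum_k\|w_k\|_W^p+\sum_j\|x_j\|_X^p\big)^{1/p}$; it is smooth, so the property (SL) makes sense for it. *)

(* Defs.v *)
From HB Require Import structures.
From mathcomp Require Import all_boot all_order all_algebra.
From mathcomp Require Import sesquilinear ring_quotient generic_quotient.
From mathcomp Require Import complex ring.
From mathcomp Require Import all_classical all_reals all_analysis.
Import Order.TTheory GRing.Theory Num.Theory.
Import numFieldNormedType.Exports.

Set Implicit Arguments.
Unset Strict Implicit.
Unset Printing Implicit Defensive.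

Local Open Scope classical_set_scope.
Local Open Scope ring_scope.

Variant RorC (R : realType) : numFieldType -> Type :=
| RealScalars : RorC R R
| ComplexScalars : RorC R R[i].

Definition realpart (R : realType) (K : numFieldType) (s : RorC R K) : K -> R :=
  match s in RorC _ K' return K' -> R with
  | RealScalars => fun k => k
  | ComplexScalars => fun k => complex.Re k
  end.

Definition ofreal (R : realType) (K : numFieldType) (s : RorC R K) : R -> K :=
  match s in RorC _ K' return R -> K' with
  | RealScalars => fun r => r
  | ComplexScalars => fun r => r%:C%C
  end.

Definition conjK (R : realType) (K : numFieldType) (s : RorC R K) : K -> K :=
  match s in RorC _ K' return K' -> K' with
  | RealScalars => fun k => k
  | ComplexScalars => fun k => conjc k
  end.

(* MathComp norms on a module over K take values in K; this is the same norm
   read in R. *)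
Definition rnorm (R : realType) (K : numFieldType) (s : RorC R K)
  (V : normedModType K) (v : V) : R := realpart s `|v|.

Section Scalars.
Variables (R : realType) (K : numFieldType) (s : RorC R K).

Lemma ofrealK (r : R) : realpart s (ofreal s r) = r.
Proof. by case: K / s. Qed.

Lemma ofrealD (x y : R) : ofreal s (x + y) = ofreal s x + ofreal s y.
Proof. by case: K / s => //=; rewrite rmorphD. Qed.

Lemma ofrealM (x y : R) : ofreal s (x * y) = ofreal s x * ofreal s y.
Proof. by case: K / s => //=; rewrite rmorphM. Qed.

Lemma ofreal0 : ofreal s 0 = 0.
Proof. by case: K / s. Qed.

Lemma ofreal_le (x y : R) : (ofreal s x <= ofreal s y) = (x <= y).
Proof. by case: K / s => //=; rewrite lecR. Qed.

Lemma ofreal_lt (x y : R) : (ofreal s x < ofreal s y) = (x < y).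
Proof. by case: K / s => //=; rewrite ltcR. Qed.

Lemma ofreal_realpart (k : K) : 0 <= k -> ofreal s (realpart s k) = k.
Proof.
case: K / s k => //= -[a b]; rewrite lecE /= => /andP[/eqP b0 _].
by rewrite /real_complex_def b0.
Qed.

Lemma ofreal_rnorm (V : normedModType K) (v : V) :
  ofreal s (rnorm s v) = `|v|.
Proof. exact: ofreal_realpart. Qed.

Lemma rnorm_ge0 (V : normedModType K) (v : V) : 0 <= rnorm s v.
Proof. by rewrite -ofreal_le ofreal0 ofreal_rnorm. Qed.

Lemma rnormD (V : normedModType K) (u v : V) :
  rnorm s (u + v) <= rnorm s u + rnorm s v.
Proof. by rewrite -ofreal_le ofrealD !ofreal_rnorm ler_normD. Qed.

Lemma rnormZ (V : normedModType K) (k : K) (v : V) :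
  rnorm s (k *: v) = realpart s `|k| * rnorm s v.
Proof.
rewrite -[LHS]ofrealK -[RHS]ofrealK; congr realpart.
by rewrite ofrealM !ofreal_realpart// normrZ.
Qed.

Lemma rabs_ge0 (k : K) : 0 <= realpart s `|k|.
Proof. by rewrite -ofreal_le ofreal0 ofreal_realpart. Qed.

Lemma rnorm_eq0 (V : normedModType K) (v : V) : rnorm s v = 0 -> v = 0.
Proof. by move=> v0; apply: normr0_eq0; rewrite -ofreal_rnorm v0 ofreal0. Qed.

Lemma rnorm0 (V : normedModType K) : rnorm s (0 : V) = 0.
Proof. by rewrite -[LHS]ofrealK ofreal_rnorm normr0 -ofreal0 ofrealK. Qed.

Lemma rabs0 : realpart s `|0 : K| = 0.
Proof. by rewrite normr0 -ofreal0 ofrealK. Qed.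

End Scalars.

Definition has_dim (K : numFieldType) (V : lmodType K) (n : nat) (S : set V) :=
  exists e : 'I_n -> V,
    (forall c : 'I_n -> K, \sum_i c i *: e i = 0 -> forall i, c i = 0) /\
    S = [set v | exists c : 'I_n -> K, v = \sum_i c i *: e i].

Section Geometry.
Variables (R : realType) (K : numFieldType) (s : RorC R K).

(* [sup] is 0 on sets without a supremum, so [opnorm phi = 1] forces [phi] to
   be bounded. *)
Definition opnorm (V : normedModType K) (phi : V -> K) : R :=
  sup [set realpart s `|phi z| | z in [set z : V | rnorm s z <= 1]].

Definition supporting (V : normedModType K) (x : V) (phi : V -> K) :=
  [/\ scalar phi, opnorm phi = 1 & phi x = `|x|].

Definition smooth (V : normedModType K) :=
  forall x : V, x != 0 -> exists! phi : V -> K, supporting x phi.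

Definition strictly_convex (V : normedModType K) :=
  forall x y : V, `|x| = 1 -> `|y| = 1 -> x != y -> `|2^-1 *: (x + y)| < 1.

Definition inner_product_space (V : normedModType K) :=
  exists ip : {dot V for conjK s}, forall x : V, `|x| ^+ 2 = ip x x.

Definition semi_inner_product (V : normedModType K) (sip : V -> V -> K) :=
  [/\ forall (x y z : V) (a b : K),
        sip (a *: x + b *: y) z = a * sip x z + b * sip y z,
      forall (x y : V) (l : K), sip x (l *: y) = conjK s l * sip x y,
      forall x y : V, `|sip x y| <= `|x| * `|y|
    & forall x : V, sip x x = `|x| ^+ 2].

(* Meant for smooth spaces, where the semi-inner product exists and is unique,
   so that quantifying over [sip] amounts to naming it. *)
Definition SL (V : normedModType K) :=
  forall sip : V -> V -> K, semi_inner_product sip ->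
  forall f : V -> V, (forall x y, sip (f x) (f y) = sip x y) -> linear f.

End Geometry.

(* Closedness makes the quotient seminorm a norm; finite-dimensional subspaces
   are always closed. *)
Record closedSubspace (K : numFieldType) (V : normedModType K) :=
  ClosedSubspace {
    subspace_pred :> {pred V};
    subspace_submod : submod_closed subspace_pred;
    subspace_closed : closed [set` subspace_pred]
  }.

HB.instance Definition _ (K : numFieldType) (V : normedModType K)
  (Y : closedSubspace V) :=
  GRing.isSubmodClosed.Build K V (subspace_pred Y)
    (subspace_submod Y).

Definition quotient_space (R : realType) (K : numFieldType) (s : RorC R K)
  (V : normedModType K) (Y : closedSubspace V) := Quotient.quot Y.

Section Quotient.
Variables (R : realType) (K : numFieldType) (s : RorC R K).
Variables (V : normedModType K) (Y : closedSubspace V).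
Local Open Scope quotient_scope.

Local Notation Q := (quotient_space s Y).

HB.instance Definition _ := GRing.Zmodule.copy Q (Quotient.quot Y).

Definition quotient_pi (x : V) : Q := \pi_(Quotient.quot Y) x.
Local Notation pi := quotient_pi.

Lemma quotient_piP (x y : V) : pi x = pi y <-> x - y \in Y.
Proof.
by rewrite (Quotient.idealrBE Y); split => [e|/eqP//]; apply/eqP.
Qed.

Lemma quotient_pi_surj (w : Q) : exists x, pi x = w.
Proof. by exists (repr (w : (Quotient.quot Y))); exact: reprK. Qed.

Lemma quotient_piD (x y : V) : pi (x + y) = pi x + pi y.
Proof. exact: (raddfD \pi_(Quotient.quot Y)). Qed.

Lemma quotient_pi0 : pi 0 = 0.
Proof. exact: (raddf0 \pi_(Quotient.quot Y)). Qed.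

Definition quotient_scale (k : K) (w : Q) : Q := pi (k *: repr (w : (Quotient.quot Y))).

Lemma quotient_scale_pi (k : K) (x : V) : quotient_scale k (pi x) = pi (k *: x).
Proof.
apply/quotient_piP; rewrite -scalerBr rpredZ//.
by apply/quotient_piP; exact: reprK.
Qed.

Lemma quotient_scaleA (a b : K) (w : Q) :
  quotient_scale a (quotient_scale b w) = quotient_scale (a * b) w.
Proof.
by have [x <-] := quotient_pi_surj w; rewrite !quotient_scale_pi scalerA.
Qed.

Lemma quotient_scale1 : left_id 1 quotient_scale.
Proof.
by move=> w; have [x <-] := quotient_pi_surj w; rewrite quotient_scale_pi scale1r.
Qed.

Lemma quotient_scaleDr : right_distributive quotient_scale +%R.
Proof.
move=> k v w; have [x <-] := quotient_pi_surj v; have [y <-] := quotient_pi_surj w.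
by rewrite -quotient_piD !quotient_scale_pi scalerDr quotient_piD.
Qed.

Lemma quotient_scaleDl (w : Q) :
  {morph quotient_scale^~ w : a b / a + b}.
Proof.
move=> a b; have [x <-] := quotient_pi_surj w.
by rewrite !quotient_scale_pi scalerDl quotient_piD.
Qed.

HB.instance Definition _ := GRing.Zmodule_isLmodule.Build K Q
  quotient_scaleA quotient_scale1 quotient_scaleDr quotient_scaleDl.

Definition quotient_norm (w : Q) : R :=
  inf [set rnorm s x | x in [set x : V | pi x = w]].

Let nset (w : Q) := [set rnorm s x | x in [set x : V | pi x = w]].

Let nset_lb w : has_lbound (nset w).
Proof. by exists 0 => _ [x _ <-]; exact: rnorm_ge0. Qed.

Let nset_inf w : has_inf (nset w).
Proof.
by split; last exact: nset_lb; have [x e] := quotient_pi_surj w; exists (rnorm s x), x.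
Qed.

Lemma quotient_norm_le (x : V) : quotient_norm (pi x) <= rnorm s x.
Proof. by apply: ge_inf; [exact: nset_lb | exists x]. Qed.

Lemma quotient_norm_adherent (w : Q) (e : R) : 0 < e ->
  exists2 x : V, pi x = w & rnorm s x < quotient_norm w + e.
Proof.
by move=> e0; have [_ [x <- <-] lt] := inf_adherent e0 (nset_inf w); exists x.
Qed.

Lemma quotient_norm_ge0 (w : Q) : 0 <= quotient_norm w.
Proof.
apply: lb_le_inf; first exact: (nset_inf w).1.
by move=> _ [x _ <-]; exact: rnorm_ge0.
Qed.

Lemma quotient_normD (v w : Q) :
  quotient_norm (v + w) <= quotient_norm v + quotient_norm w.
Proof.
apply/ler_addgt0Pr => e e0; have e2 : 0 < e / 2 by rewrite divr_gt0.
have [x <- hx] := quotient_norm_adherent v e2.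
have [y <- hy] := quotient_norm_adherent w e2.
rewrite -quotient_piD; apply: le_trans (quotient_norm_le _) _.
apply: le_trans (rnormD _ _ _) _.
by rewrite [e]splitr addrACA lerD// ltW.
Qed.

Let quotient_normZ_le (k : K) (w : Q) :
  quotient_norm (k *: w) <= realpart s `|k| * quotient_norm w.
Proof.
apply/ler_addgt0Pr => e e0.
have d0 : 0 < e / (realpart s `|k| + 1).
  by rewrite divr_gt0// ltr_wpDl// rabs_ge0.
have [x <- hx] := quotient_norm_adherent w d0.
have -> : k *: (pi x : Q) = pi (k *: x) by exact: quotient_scale_pi.
apply: le_trans (quotient_norm_le _) _; rewrite rnormZ.
apply: le_trans (ler_wpM2l (rabs_ge0 _ _) (ltW hx)) _.
rewrite mulrDr lerD2l mulrA ler_pdivrMr ?ltr_wpDl ?rabs_ge0//.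
by rewrite mulrC ler_wpM2l ?(ltW e0)// lerDl.
Qed.

Lemma quotient_norm0 : quotient_norm 0 = 0.
Proof.
apply/le_anti; rewrite quotient_norm_ge0 andbT -quotient_pi0.
by rewrite (le_trans (quotient_norm_le _))// rnorm0.
Qed.

Lemma quotient_normZ (k : K) (w : Q) :
  quotient_norm (k *: w) = realpart s `|k| * quotient_norm w.
Proof.
apply/le_anti; rewrite quotient_normZ_le /=.
have [->|k0] := eqVneq k 0; first by rewrite rabs0 mul0r quotient_norm_ge0.
have := quotient_normZ_le k^-1 (k *: w).
rewrite scalerA mulVf// scale1r => h.
have := ler_wpM2l (rabs_ge0 s k) h; rewrite mulrA.
suff -> : realpart s `|k| * realpart s `|k^-1| = 1 by rewrite mul1r.
rewrite -[LHS](ofrealK s) ofrealM !ofreal_realpart// normfV divff ?normr_eq0//.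
by clear; case: K / s.
Qed.

Lemma quotient_norm_eq0 (w : Q) : quotient_norm w = 0 -> w = 0.
Proof.
have [x <-] := quotient_pi_surj w => x0.
rewrite -quotient_pi0; apply/quotient_piP; rewrite subr0.
suff : closure [set` Y] x by move=> /subspace_closed.
move=> B /nbhs_ballP[e /= e0 eB].
have e0' : 0 < realpart s e.
  by rewrite -(ofreal_lt s) ofreal0 ofreal_realpart// ltW.
have [z zx] := quotient_norm_adherent (pi x) e0'.
rewrite x0 add0r => ze; exists (x - z); split.
  by apply/quotient_piP; rewrite zx.
apply: eB; rewrite -ball_normE /= opprB addrCA subrr addr0.
by rewrite -(ofreal_rnorm s) -[e](ofreal_realpart s) ?ltW// ofreal_lt.
Qed.

Let qnorm (w : Q) : K := ofreal s (quotient_norm w).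

Let qnormD (v w : Q) : qnorm (v + w) <= qnorm v + qnorm w.
Proof. by rewrite /qnorm -ofrealD ofreal_le quotient_normD. Qed.

Let qnormZ (k : K) (w : Q) : qnorm (k *: w) = `|k| * qnorm w.
Proof. by rewrite /qnorm quotient_normZ ofrealM ofreal_realpart. Qed.

Let qnorm_eq0 (w : Q) : qnorm w = 0 -> w = 0.
Proof.
by move=> /(congr1 (realpart s)); rewrite -(ofreal0 s) !ofrealK => /quotient_norm_eq0.
Qed.

HB.instance Definition _ := @Lmodule_isNormed.Build K Q qnorm qnormD qnormZ qnorm_eq0.

Lemma rnorm_quotient (w : Q) : rnorm s w = quotient_norm w.
Proof. exact: ofrealK. Qed.

End Quotient.

Section PowerMinkowski.
Variables (R : realType) (p : R).
Hypothesis hp : 1 < p.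

Let p_gt0 : 0 < p. Proof. exact: lt_trans hp. Qed.
Let p_ge0 : 0 <= p. Proof. exact: ltW. Qed.
Let p_neq0 : p != 0. Proof. by rewrite gt_eqF. Qed.

Lemma powRK (a : R) : 0 <= a -> (a `^ p) `^ p^-1 = a.
Proof. by move=> a0; rewrite -powRrM divff// powRr1. Qed.

Lemma powRVK (a : R) : 0 <= a -> (a `^ p^-1) `^ p = a.
Proof. by move=> a0; rewrite -powRrM mulVf// powRr1. Qed.

Lemma powR_add_le (a b S T : R) : 0 <= a -> 0 <= b -> 0 < S -> 0 < T ->
  (a + b) `^ p <=
  (S + T) `^ p * (S / (S + T) / S `^ p) * a `^ p +
  (S + T) `^ p * (T / (S + T) / T `^ p) * b `^ p.
Proof.
move=> a0 b0 S0 T0; have ST0 : 0 < S + T by exact: addr_gt0.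
have t0 : 0 <= S / (S + T) by rewrite divr_ge0 ?ltW.
have t1 : S / (S + T) <= 1 by rewrite ler_pdivrMr// mul1r lerDl ltW.
have /= := @convex_powR R p (ltW hp) (Itv01 t0 t1) (a / S) (b / T).
rewrite !inE/= !in_itv/= !andbT => /(_ (divr_ge0 a0 (ltW S0))).
move=> /(_ (divr_ge0 b0 (ltW T0))).
move=> h; rewrite convRE [X in X `^ _ <= _]convRE  /= /unstable.onem in h; move: h.
have -> : 1 - S / (S + T) = T / (S + T).
  by rewrite -{1}(divff (lt0r_neq0 ST0)) -mulrBl addrAC subrr add0r.
have -> : S / (S + T) * (a / S) + T / (S + T) * (b / T) = (a + b) / (S + T).
  by field; apply/and3P; split; exact: lt0r_neq0.
move=> h.
have ab0 : 0 <= (a + b) / (S + T) by apply: divr_ge0; [exact: addr_ge0 | exact: ltW].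
have -> : (a + b) `^ p = (S + T) `^ p * ((a + b) / (S + T)) `^ p.
  by rewrite -powRM ?(ltW ST0)// mulrC divfK ?gt_eqF.
apply: le_trans (ler_wpM2l (powR_ge0 _ _) h) _.
have E (x y : R) : 0 <= x -> 0 < y -> (x / y) `^ p = x `^ p / y `^ p.
  move=> x0 y0; apply: (canRL (mulfK _)).
    by rewrite gt_eqF// powR_gt0.
  by rewrite -powRM ?divr_ge0 ?(ltW y0)// divfK ?gt_eqF.
rewrite !E// mulrDr.
have F (x y z w : R) : x * (y * (z / w)) = x * (y / w) * z.
  by rewrite -!mulrA [w^-1 * z]mulrC.
by rewrite !F.
Qed.

Lemma powR_add_total (S T : R) : 0 < S -> 0 < T ->
  (S + T) `^ p * (S / (S + T) / S `^ p) * S `^ p +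
  (S + T) `^ p * (T / (S + T) / T `^ p) * T `^ p = (S + T) `^ p.
Proof.
move=> S0 T0; have ST0 : S + T != 0 by rewrite gt_eqF ?addr_gt0.
have Sp : S `^ p != 0 by rewrite gt_eqF ?powR_gt0.
have Tp : T `^ p != 0 by rewrite gt_eqF ?powR_gt0.
have F (x y z : R) : z != 0 -> x * (y / z) * z = x * y by move=> z0; rewrite -mulrA divfK.
by rewrite !F// -mulrDr -mulrDl divff ?mulr1.
Qed.

Definition lp_sum_norm (u : nat -> R) : R :=
  limn (series (fun i => u i `^ p)) `^ p^-1.

Definition lp_summable (u : nat -> R) := cvgn (series (fun i => u i `^ p)).

Let term_le (u : nat -> R) n : lp_summable u ->
  u n `^ p <= limn (series (fun i => u i `^ p)).
Proof.
move=> cu; apply: (@le_trans _ _ (series (fun i => u i `^ p) n.+1)).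
  by rewrite /series /= big_nat_recr //= lerDr sumr_ge0// => i _; exact: powR_ge0.
apply: nondecreasing_cvgn_le => //.
by apply: nondecreasing_series => i _ _; exact: powR_ge0.
Qed.

Let lim_ge0 (u : nat -> R) : lp_summable u ->
  0 <= limn (series (fun i => u i `^ p)).
Proof. by move=> cu; apply: le_trans (term_le 0 cu); exact: powR_ge0. Qed.

Lemma lp_sum_normX (u : nat -> R) : lp_summable u ->
  lp_sum_norm u `^ p = limn (series (fun i => u i `^ p)).
Proof. by move=> cu; rewrite powRVK// lim_ge0. Qed.

Lemma lp_sum_norm_ge0 (u : nat -> R) : 0 <= lp_sum_norm u.
Proof. exact: powR_ge0. Qed.

Lemma lp_sum_norm_term (u : nat -> R) n : 0 <= u n -> lp_summable u ->
  u n <= lp_sum_norm u.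
Proof.
move=> u0 cu; rewrite -[leLHS]powRK//.
by apply: ge0_ler_powR; rewrite ?nnegrE ?invr_ge0 ?powR_ge0 ?lim_ge0// term_le.
Qed.

Lemma lp_summableZ (c : R) (u : nat -> R) : 0 <= c -> (forall i, 0 <= u i) ->
  lp_summable u -> lp_summable (fun i => c * u i).
Proof.
move=> c0 u0 cu; rewrite /lp_summable.
under eq_fun do rewrite powRM//.
exact: (@is_cvg_seriesZ R (fun i => u i `^ p) (c `^ p)).
Qed.

Lemma lp_sum_normZ (c : R) (u : nat -> R) : 0 <= c -> (forall i, 0 <= u i) ->
  lp_summable u -> lp_sum_norm (fun i => c * u i) = c * lp_sum_norm u.
Proof.
move=> c0 u0 cu; rewrite /lp_sum_norm.
under eq_fun do rewrite powRM//.
have := @lim_seriesZ R (fun i => u i `^ p) (c `^ p) cu.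
rewrite -[RHS]/(c `^ p * _) => ->.
by rewrite powRM ?powR_ge0 ?lim_ge0// powRK.
Qed.

Let cvg_lin (u v : nat -> R) (A B : R) : lp_summable u -> lp_summable v ->
  series (fun i => A * u i `^ p + B * v i `^ p) n @[n --> \oo] -->
  A * limn (series (fun i => u i `^ p)) + B * limn (series (fun i => v i `^ p)).
Proof.
move=> cu cv.
have -> : series (fun i => A * u i `^ p + B * v i `^ p) =
  (fun n => A * series (fun i => u i `^ p) n + B * series (fun i => v i `^ p) n).
  by apply/funext => n; rewrite /series /= big_split /= -!mulr_sumr.
by apply: cvgD; apply: cvgM; (exact: cvg_cst || assumption).
Qed.

Lemma lp_summableD (u v w : nat -> R) :
  (forall i, 0 <= u i) -> (forall i, 0 <= v i) ->
  (forall i, 0 <= w i <= u i + v i) ->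
  lp_summable u -> lp_summable v -> lp_summable w.
Proof.
move=> u0 v0 w0 cu cv.
have cw := cvgP _ (cvg_lin (A := (1 + 1) `^ p * (1 / (1 + 1) / 1 `^ p))
  (B := (1 + 1) `^ p * (1 / (1 + 1) / 1 `^ p)) cu cv).
apply: (series_le_cvg _ _ _ cw) => i; first exact: powR_ge0.
  by rewrite addr_ge0 ?mulr_ge0 ?divr_ge0 ?powR_ge0.
apply: le_trans (powR_add_le (u0 i) (v0 i) ltr01 ltr01).
by have /andP[? ?] := w0 i; apply: ge0_ler_powR; rewrite ?nnegrE ?addr_ge0.
Qed.

Lemma lp_sum_norm_eq0 (u : nat -> R) : (forall i, 0 <= u i) -> lp_summable u ->
  lp_sum_norm u = 0 -> forall i, u i = 0.
Proof.
move=> u0 cu z i; apply/le_anti; rewrite u0 andbT -z.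
exact: lp_sum_norm_term.
Qed.

Lemma lp_sum_norm_le (u v : nat -> R) :
  (forall i, 0 <= u i <= v i) -> lp_summable u -> lp_summable v ->
  lp_sum_norm u <= lp_sum_norm v.
Proof.
move=> uv cu cv; apply: ge0_ler_powR; rewrite ?nnegrE ?invr_ge0 ?lim_ge0//.
apply: lim_series_le => // i; have /andP[u0 uvi] := uv i.
by apply: ge0_ler_powR; rewrite ?nnegrE// (le_trans u0).
Qed.

Lemma lp_sum_normD (u v w : nat -> R) :
  (forall i, 0 <= u i) -> (forall i, 0 <= v i) ->
  (forall i, 0 <= w i <= u i + v i) ->
  lp_summable u -> lp_summable v ->
  lp_sum_norm w <= lp_sum_norm u + lp_sum_norm v.
Proof.
move=> u0 v0 w0 cu cv; have cw := lp_summableD u0 v0 w0 cu cv.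
have := lp_sum_norm_ge0 u; rewrite le_eqVlt => /predU1P[/esym uz|S0].
  rewrite uz add0r; apply: lp_sum_norm_le => // i.
  by have := w0 i; rewrite (lp_sum_norm_eq0 u0 cu uz) add0r.
have := lp_sum_norm_ge0 v; rewrite le_eqVlt => /predU1P[/esym vz|T0].
  rewrite vz addr0; apply: lp_sum_norm_le => // i.
  by have := w0 i; rewrite (lp_sum_norm_eq0 v0 cv vz) addr0.
have SX := lp_sum_normX cu; have TX := lp_sum_normX cv.
move: (lp_sum_norm u) (lp_sum_norm v) S0 T0 SX TX => S T S0 T0 SX TX.
rewrite -[leRHS]powRK ?(ltW (addr_gt0 S0 T0))//.
apply: ge0_ler_powR; [by rewrite invr_ge0|by rewrite nnegrE lim_ge0|by rewrite nnegrE powR_ge0|].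
have cl := cvg_lin (A := (S + T) `^ p * (S / (S + T) / S `^ p))
  (B := (S + T) `^ p * (T / (S + T) / T `^ p)) cu cv.
rewrite -(powR_add_total S0 T0) [X in _ * X + _]SX [X in _ + _ * X]TX.
rewrite -(cvg_lim _ cl)//; apply: lim_series_le => //; first exact: cvgP cl.
move=> i; apply: le_trans (powR_add_le (u0 i) (v0 i) S0 T0).
by have /andP[? ?] := w0 i; apply: ge0_ler_powR; rewrite ?nnegrE ?addr_ge0.
Qed.

Lemma lp_pair_le (a b a' b' : R) : 0 <= a <= a' -> 0 <= b <= b' ->
  (a `^ p + b `^ p) `^ p^-1 <= (a' `^ p + b' `^ p) `^ p^-1.
Proof.
move=> /andP[a0 aa] /andP[b0 bb].
apply: ge0_ler_powR; rewrite ?nnegrE ?invr_ge0 ?addr_ge0 ?powR_ge0//.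
by apply: lerD; apply: ge0_ler_powR; rewrite ?nnegrE// (le_trans _ aa, le_trans _ bb).
Qed.

Lemma lp_pair_eq0 (a b : R) : 0 <= a -> 0 <= b ->
  (a `^ p + b `^ p) `^ p^-1 = 0 -> a = 0 /\ b = 0.
Proof.
move=> a0 b0 /powR_eq0_eq0/eqP; rewrite paddr_eq0 ?powR_ge0//.
by move=> /andP[/eqP/powR_eq0_eq0 -> /eqP/powR_eq0_eq0 ->].
Qed.

Lemma lp_pairD (a b c d e f : R) :
  0 <= a -> 0 <= b -> 0 <= c -> 0 <= d ->
  0 <= e <= a + c -> 0 <= f <= b + d ->
  (e `^ p + f `^ p) `^ p^-1 <=
  (a `^ p + b `^ p) `^ p^-1 + (c `^ p + d `^ p) `^ p^-1.
Proof.
move=> a0 b0 c0 d0 ef ff.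
set S := (a `^ p + b `^ p) `^ p^-1; set T := (c `^ p + d `^ p) `^ p^-1.
have SX : S `^ p = a `^ p + b `^ p by rewrite powRVK// addr_ge0 ?powR_ge0.
have TX : T `^ p = c `^ p + d `^ p by rewrite powRVK// addr_ge0 ?powR_ge0.
have := powR_ge0 (a `^ p + b `^ p) p^-1; rewrite -/S le_eqVlt.
move=> /predU1P[/esym z|S0].
  have [az bz] := lp_pair_eq0 a0 b0 z.
  by rewrite z add0r; apply: lp_pair_le; rewrite ?az ?bz ?add0r in ef ff.
have := powR_ge0 (c `^ p + d `^ p) p^-1; rewrite -/T le_eqVlt.
move=> /predU1P[/esym z|T0].
  have [cz dz] := lp_pair_eq0 c0 d0 z.
  by rewrite z addr0; apply: lp_pair_le; rewrite ?cz ?dz ?addr0 in ef ff.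
clearbody S T; rewrite -[leRHS]powRK ?(ltW (addr_gt0 S0 T0))//.
apply: ge0_ler_powR; first by rewrite invr_ge0.
- by rewrite nnegrE addr_ge0 ?powR_ge0.
- by rewrite nnegrE powR_ge0.
rewrite -(powR_add_total S0 T0) [X in _ * X + _]SX [X in _ + _ * X]TX.
rewrite !mulrDr addrACA; apply: lerD.
  apply: le_trans (powR_add_le a0 c0 S0 T0).
  by have /andP[? ?] := ef; apply: ge0_ler_powR; rewrite ?nnegrE ?addr_ge0.
apply: le_trans (powR_add_le b0 d0 S0 T0).
by have /andP[? ?] := ff; apply: ge0_ler_powR; rewrite ?nnegrE ?addr_ge0.
Qed.

End PowerMinkowski.

Definition lp_finite (R : realType) (K : numFieldType) (s : RorC R K) (p : R)
    (V : normedModType K) : {pred nat -> V} :=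
  fun x => `[< lp_summable p (fun i => rnorm s (x i)) >].

Arguments lp_finite {R K} s p V.

Record lp_seq (R : realType) (K : numFieldType) (s : RorC R K) (p : R)
    (p_gt1 : 1 < p) (V : normedModType K) := LpSeq {
  lp_val :> nat -> V;
  lp_valP : lp_val \in lp_finite s p V
}.

Section LpSeq.
Variables (R : realType) (K : numFieldType) (s : RorC R K).
Variables (p : R) (hp : 1 < p) (V : normedModType K).

Let lp_finite_submod : submod_closed (lp_finite s p V).
Proof.
split=> [|k x y /asboolP cx /asboolP cy]; apply/asboolP.
  rewrite /lp_summable; under eq_fun do rewrite rnorm0 powR0 ?gt_eqF ?(lt_trans _ hp)//.
  have -> : series (fun=> 0 : R) = cst 0.
    by apply/funext => n; rewrite /series /= big1.
  exact: is_cvg_cst.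
have ckx : lp_summable p (fun i => rnorm s (k *: x i)).
  rewrite (_ : (fun _ => _) = fun i => realpart s `|k| * rnorm s (x i)).
    by apply: lp_summableZ => // [|i]; [exact: rabs_ge0 | exact: rnorm_ge0].
  by apply/funext => i; rewrite rnormZ.
apply: (lp_summableD hp _ _ _ ckx cy) => i; rewrite ?rnorm_ge0//=.
exact: rnormD.
Qed.

HB.instance Definition _ :=
  GRing.isSubmodClosed.Build K (nat -> V) (lp_finite s p V) lp_finite_submod.

Local Notation L := (lp_seq s hp V).

HB.instance Definition _ := [isSub for @lp_val R K s p hp V].
HB.instance Definition _ := [Choice of L by <:].
HB.instance Definition _ := [SubChoice_isSubLmodule of L by <:].

Definition lp_seq_norm (x : L) : R := lp_sum_norm p (fun i => rnorm s (x i)).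

Lemma lp_seq_summable (x : L) : lp_summable p (fun i => rnorm s (x i)).
Proof. by have /asboolP := lp_valP x. Qed.

Let N (x : L) : K := ofreal s (lp_seq_norm x).

Let ND (x y : L) : N (x + y) <= N x + N y.
Proof.
rewrite /N -ofrealD ofreal_le; apply: lp_sum_normD => // [i|i|i||].
- exact: rnorm_ge0.
- exact: rnorm_ge0.
- by rewrite rnorm_ge0 /=; exact: rnormD.
- exact: lp_seq_summable.
- exact: lp_seq_summable.
Qed.

Let NZ (k : K) (x : L) : N (k *: x) = `|k| * N x.
Proof.
rewrite /N -[X in X * _](ofreal_realpart s)// -ofrealM; congr ofreal.
have -> : lp_seq_norm (k *: x) =
    lp_sum_norm p (fun i => realpart s `|k| * rnorm s (x i)).
  by rewrite /lp_seq_norm; congr lp_sum_norm; apply/funext => i; rewrite -rnormZ.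
apply: (lp_sum_normZ hp); first exact: rabs_ge0.
  by move=> i; exact: rnorm_ge0.
exact: lp_seq_summable.
Qed.

Let N_eq0 (x : L) : N x = 0 -> x = 0.
Proof.
move=> /(congr1 (realpart s)); rewrite -(ofreal0 s) !ofrealK => z.
apply/val_inj/funext => i; apply: (rnorm_eq0 (s := s)).
apply: (lp_sum_norm_eq0 hp _ _ z) => [j|]; first exact: rnorm_ge0.
exact: lp_seq_summable.
Qed.

HB.instance Definition _ := @Lmodule_isNormed.Build K L N ND NZ N_eq0.

Lemma rnorm_lp_seq (x : L) : rnorm s x = lp_seq_norm x.
Proof. exact: ofrealK. Qed.

End LpSeq.

(* [U * V] itself already carries the max norm. *)
Definition lp_pair (R : realType) (K : numFieldType) (s : RorC R K) (p : R)
  (p_gt1 : 1 < p) (U V : normedModType K) := (U * V)%type.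

Section LpPair.
Variables (R : realType) (K : numFieldType) (s : RorC R K).
Variables (p : R) (hp : 1 < p) (U V : normedModType K).

Local Notation L := (lp_pair s hp U V).

HB.instance Definition _ := GRing.Lmodule.copy L (U * V)%type.

Definition lp_pair_norm (z : L) : R :=
  (rnorm s z.1 `^ p + rnorm s z.2 `^ p) `^ p^-1.

Let N (z : L) : K := ofreal s (lp_pair_norm z).

Let ND (x y : L) : N (x + y) <= N x + N y.
Proof.
rewrite /N -ofrealD ofreal_le.
by apply: lp_pairD; rewrite ?rnorm_ge0 //=; exact: rnormD.
Qed.

Let NZ (k : K) (x : L) : N (k *: x) = `|k| * N x.
Proof.
rewrite /N -[X in X * _](ofreal_realpart s)// -ofrealM; congr ofreal.
rewrite /lp_pair_norm /= !rnormZ !powRM ?rabs_ge0 ?rnorm_ge0//.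
by rewrite -mulrDr powRM ?addr_ge0 ?powR_ge0// powRK ?rabs_ge0.
Qed.

Let N_eq0 (x : L) : N x = 0 -> x = 0.
Proof.
move=> /(congr1 (realpart s)); rewrite -(ofreal0 s) !ofrealK.
move=> /(lp_pair_eq0 (rnorm_ge0 _ _) (rnorm_ge0 _ _))[].
by case: x => a b /= /rnorm_eq0 -> /rnorm_eq0 ->.
Qed.

HB.instance Definition _ := @Lmodule_isNormed.Build K L N ND NZ N_eq0.

Lemma rnorm_lp_pair (z : L) : rnorm s z = lp_pair_norm z.
Proof. exact: ofrealK. Qed.

End LpPair.

(* Main.v *)
From HB Require Import structures.
Require Import Defs.
From mathcomp Require Import all_boot all_order all_algebra.
From mathcomp Require Import sesquilinear complex ring lra.
From mathcomp Require Import all_classical all_reals all_analysis.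

(** Let [pi : X -> W = X / Y] be the quotient map and let [sigma] assign to each
    coset its shortest element, which is unique by strict convexity. On the sum
    of the statement consider the map
      f (w_1, w_2, ...; x_1, x_2, ...) = (w_2, w_3, ...; sigma w_1, x_1, x_2, ...).
    It preserves the norm, and the linear contraction
      r (w_1, w_2, ...; x_1, x_2, ...) = (pi x_1, w_1, w_2, ...; x_2, x_3, ...)
    is a left inverse of it. Hence, if [phi] is the supporting functional of [z],
    then [phi \o r] supports [f z], and by uniqueness the semi-inner product
    satisfies [f x | f z] = [x | z]; no formula for it in terms of the components
    is needed ([not_SL_of_section]). So property (SL) fails as soon as [sigma] is
    not linear.

    A line [Y] for which [sigma] is not linear is provided by a characterisation
    of inner product spaces in the spirit of Blaschke, Kakutani and James
    ([inner_product_of_linear_nearest]). Suppose that [sigma] is linear for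
    every [Y]. Writing [J h] for the supporting functional of [h], this means that
    for each [y] the vectors [h] with [J h y = 0] form a plane, so that [J] maps
    points of the projective plane to lines and collinear points to concurrent
    lines. Choose a basis of unit vectors of maximal determinant; each of its
    coordinate functionals supports the corresponding vector
    ([auerbach_of_basis]). By the fundamental theorem of projective geometry,
    [J (a, b, c)] is then proportional to [(t a, b2 * t b, b3 * t c)] for a field
    endomorphism [t] ([correlation_coordinates]). The inequality between [J h g]
    and the norms of [h] and [g] rules out wild endomorphisms: [t] is the
    conjugation, and [b2], [b3] are positive ([planar_conj]). So [J h] is
    proportional to [B _ h] for an inner product [B], which means that
    [B]-orthogonal projections onto lines are contractions for the norm. Walking
    along the unit sphere of [B] in many small steps, the norm is constant there
    ([norm_of_projection_le]), so [X] is an inner product space.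

    Smoothness of the sum is inherited from [X]. In the quotient, [phi |-> phi \o pi]
    identifies the functionals supporting [w] and [sigma w]
    ([norm_smooth_quotient]); that the functional supporting [sigma w] vanishes on
    [Y] is Birkhoff's description of orthogonality, obtained here from a
    compactness argument ([birkhoff_orthogonal]). In an l_p sum, a supporting
    functional is determined on each summand by the one of the component
    ([coordinate_form_uniq]), and it exists by the equality case of Hoelder's
    inequality ([norm_smooth_lp_pair], [norm_smooth_lp_seq]). *)

Import Order.TTheory GRing.Theory Num.Theory.
Import numFieldNormedType.Exports.

Set Implicit Arguments.
Unset Strict Implicit.
Unset Printing Implicit Defensive.

Local Open Scope classical_set_scope.
Local Open Scope ring_scope.

(** * Real and complex scalars, uniformly *)

Lemma norm_complexE (R : realType) (z : (R[i] : numFieldType)) :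
  `|z| = (Num.sqrt (complex.Re z ^+ 2 + complex.Im z ^+ 2))%:C%C.
Proof. exact: normc_def. Qed.

Lemma additive_zero (U V : zmodType) (f : U -> V) :
  (forall x y, f (x + y) = f x + f y) -> f 0 = 0.
Proof. by move=> fD; apply: (addrI (f 0)); rewrite -fD !addr0. Qed.

Section Scalars.
Variables (R : realType) (K : numFieldType) (s : RorC R K).

Definition rabs (k : K) : R := realpart s `|k|.

Lemma ofreal_rabs k : ofreal s (rabs k) = `|k|.
Proof. exact: ofreal_realpart. Qed.

Lemma rabsM k l : rabs (k * l) = rabs k * rabs l.
Proof.
by rewrite -[LHS](ofrealK s) -[RHS](ofrealK s) ofrealM !ofreal_rabs normrM.
Qed.

Lemma ofreal1 : ofreal s 1 = 1.
Proof. by case: K / s. Qed.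

Lemma realpart1 : realpart s 1 = 1.
Proof. by rewrite -{1}ofreal1 ofrealK. Qed.

Lemma rabs1 : rabs 1 = 1.
Proof. by rewrite /rabs normr1 realpart1. Qed.

Lemma rabs_zero : rabs 0 = 0.
Proof. exact: rabs0. Qed.

Lemma realpart0 : realpart s 0 = 0.
Proof. by rewrite -{1}(ofreal0 s) ofrealK. Qed.

Lemma realpartD k l : realpart s (k + l) = realpart s k + realpart s l.
Proof. by case: K / s k l => // -[a b] [c d]. Qed.

Lemma realpartN k : realpart s (- k) = - realpart s k.
Proof. by case: K / s k => // -[a b]. Qed.

Lemma realpartZ r k : realpart s (ofreal s r * k) = r * realpart s k.
Proof. by case: K / s k => //= -[a b] /=; rewrite mul0r subr0. Qed.

Lemma ofrealN r : ofreal s (- r) = - ofreal s r.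
Proof. by case: K / s => //=; rewrite rmorphN. Qed.

Lemma ofrealV r : ofreal s r^-1 = (ofreal s r)^-1.
Proof. by case: K / s => //=; rewrite fmorphV. Qed.

Lemma ofreal_inj : injective (ofreal s).
Proof. exact: can_inj (@ofrealK _ _ s). Qed.

Lemma norm_ofreal r : `|ofreal s r| = ofreal s `|r|.
Proof.
case: K / s => //=. by rewrite norm_complexE /= expr0n /= addr0 sqrtr_sqr.
Qed.

Lemma rabs_ofreal r : rabs (ofreal s r) = `|r|.
Proof. by rewrite /rabs norm_ofreal ofrealK. Qed.

Lemma realpart_le_rabs k : realpart s k <= rabs k.
Proof.
rewrite /rabs; case: K / s k => [k|z]; first exact: ler_norm.
rewrite norm_complexE; case: z => a b /=; apply: le_trans (ler_norm _) _.
by rewrite -sqrtr_sqr ler_wsqrtr// lerDl sqr_ge0.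
Qed.

Lemma normrabs_realpart k : `|realpart s k| <= rabs k.
Proof.
rewrite ler_norml realpart_le_rabs andbT lerNl -realpartN.
by apply: le_trans (realpart_le_rabs _) _; rewrite /rabs normrN.
Qed.

Lemma rabsN k : rabs (- k) = rabs k.
Proof. by rewrite /rabs normrN. Qed.

Lemma rabsD k l : rabs (k + l) <= rabs k + rabs l.
Proof. by rewrite -(ofreal_le s) ofrealD !ofreal_rabs ler_normD. Qed.

Lemma rabs_eq0 k : (rabs k == 0) = (k == 0).
Proof. by rewrite -(normr_eq0 k) -ofreal_rabs -(ofreal0 s) (inj_eq ofreal_inj). Qed.

Lemma rabs_gt0 k : (0 < rabs k) = (k != 0).
Proof. by rewrite lt0r rabs_eq0 rabs_ge0 andbT. Qed.

Lemma rabsV k : rabs k^-1 = (rabs k)^-1.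
Proof. by rewrite -[LHS](ofrealK s) ofreal_rabs normfV -ofreal_rabs -ofrealV ofrealK. Qed.

(** The equality case that turns estimates of real parts into identities of
    scalars. *)
Lemma realpart_eq_rabs k : rabs k <= realpart s k -> k = `|k|.
Proof.
move=> h; have {h} e : realpart s k = rabs k by apply/le_anti; rewrite realpart_le_rabs.
move: e; rewrite /rabs; case: K / s k => [k //|z].
rewrite norm_complexE; case: z => a b /= e; have b0 : b = 0.
  apply/eqP; rewrite -sqrf_eq0; apply/eqP.
  have := congr1 (fun x => x ^+ 2) e; rewrite sqr_sqrtr ?addr_ge0 ?sqr_ge0//.
  by move=> /eqP; rewrite -subr_eq0 opprD addNKr oppr_eq0 => /eqP.
by rewrite -e b0.
Qed.

Lemma rotate_to_norm k : exists2 u : K, `|u| = 1 & u * k = `|k|.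
Proof.
have [->|k0] := eqVneq k 0; first by exists 1; [exact: normr1|rewrite mulr0 normr0].
exists (`|k| / k); last by rewrite divfK.
by rewrite normrM normfV normr_id divff ?normr_eq0.
Qed.

Lemma conjKM : {morph conjK s : k l / k * l}.
Proof. by case: K / s => //=; exact: rmorphM. Qed.

Lemma conjKD : {morph conjK s : k l / k + l}.
Proof. by case: K / s => //=; exact: rmorphD. Qed.

Lemma conjKK : involutive (conjK s).
Proof. by case: K / s => //=; exact: conjcK. Qed.

Lemma conjK0 : conjK s 0 = 0.
Proof. by case: K / s => //=; exact: conjc0. Qed.

Lemma conjK1 : conjK s 1 = 1.
Proof. by case: K / s => //=; exact: conjc1. Qed.

Lemma conjK_ofreal r : conjK s (ofreal s r) = ofreal s r.
Proof. by case: K / s => //=; rewrite oppr0. Qed.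

Lemma mulr_conjK k : k * conjK s k = `|k| ^+ 2.
Proof.
case: K / s k => [k|k] /=; first by rewrite real_normK// num_real.
by exact/esym/sqr_normc.
Qed.

Lemma norm_conjK k : `|conjK s k| = `|k|.
Proof. by case: K / s k => //= -[a b]; rewrite !norm_complexE /= sqrrN. Qed.

Lemma realpart_conjK k : realpart s (conjK s k) = realpart s k.
Proof. by case: K / s k => //= -[a b]. Qed.

End Scalars.

(** * Norming functionals and smoothness *)

Section ScalarForms.
Variables (K : numFieldType) (V : lmodType K) (phi : V -> K).
Hypothesis hphi : scalar phi.

Lemma scalar_formD u v : phi (u + v) = phi u + phi v.
Proof. by have := hphi 1 u v; rewrite scale1r mul1r. Qed.

Lemma scalar_form0 : phi 0 = 0.
Proof. exact: additive_zero scalar_formD. Qed.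

Lemma scalar_formZ k u : phi (k *: u) = k * phi u.
Proof. by have := hphi k u 0; rewrite scalar_form0 !addr0. Qed.

Lemma scalar_formN u : phi (- u) = - phi u.
Proof. by rewrite -scaleN1r scalar_formZ mulN1r. Qed.

Lemma scalar_formB u v : phi (u - v) = phi u - phi v.
Proof. by rewrite scalar_formD scalar_formN. Qed.

Lemma scalar_form_sum I (r : seq I) (P : pred I) (F : I -> V) :
  phi (\sum_(i <- r | P i) F i) = \sum_(i <- r | P i) phi (F i).
Proof. exact: (big_morph phi scalar_formD scalar_form0). Qed.

End ScalarForms.

Section Norming.
Variables (R : realType) (K : numFieldType) (s : RorC R K).
Variables (V : normedModType K).
Implicit Types (x y z v : V) (phi : V -> K).

(** The same as a supporting functional, but with the condition on the
    operator norm replaced by the pointwise bound in which it is used. *)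
Definition norming x phi :=
  [/\ scalar phi, forall v, `|phi v| <= `|v| & phi x = `|x|].

Lemma rnorm_gt0 x : (0 < rnorm s x) = (x != 0).
Proof. by rewrite -(ofreal_lt s) ofreal0 ofreal_rnorm normr_gt0. Qed.

Lemma rnorm_unit x : x != 0 -> rnorm s (ofreal s (rnorm s x)^-1 *: x) = 1.
Proof.
rewrite -rnorm_gt0 => x0; rewrite rnormZ -/(rabs s _) rabs_ofreal.
by rewrite ger0_norm ?invr_ge0 ?ltW// mulVf// gt_eqF.
Qed.

Lemma rnormN x : rnorm s (- x) = rnorm s x.
Proof. by rewrite /rnorm normrN. Qed.

Lemma rnorm_le x y : (rnorm s x <= rnorm s y) = (`|x| <= `|y|).
Proof. by rewrite -(ofreal_le s) !ofreal_rnorm. Qed.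

Lemma rnorm_real r x : rnorm s (ofreal s r *: x) = `|r| * rnorm s x.
Proof. by rewrite rnormZ -/(rabs s _) rabs_ofreal. Qed.

Lemma rabs_rnorm k x : (rabs s k <= rnorm s x) = (`|k| <= `|x|).
Proof. by rewrite -(ofreal_le s) ofreal_rabs ofreal_rnorm. Qed.

Lemma supportingP x phi : x != 0 -> supporting s x phi <-> norming x phi.
Proof.
move=> x0; rewrite /supporting /norming /opnorm; set S := [set _ | _ in _].
split=> -[lin h hx]; split=> //.
  have supS : has_sup S.
    by apply: contrapT => /sup_out S0; move: h; rewrite S0 => /eqP; rewrite eq_sym oner_eq0.
  move=> v; have [->|v0] := eqVneq v 0; first by rewrite scalar_form0// normr0.
  have /(sup_upper_bound supS) : S (rabs s (phi (ofreal s (rnorm s v)^-1 *: v))).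
    by exists (ofreal s (rnorm s v)^-1 *: v) => //=; rewrite rnorm_unit.
  rewrite h scalar_formZ// rabsM rabs_ofreal ger0_norm ?invr_ge0 ?rnorm_ge0//.
  by rewrite mulrC ler_pdivrMr ?rnorm_gt0// mul1r rabs_rnorm.
have ubS : ubound S 1.
  by move=> _ [z /= z1 <-]; apply: le_trans z1; rewrite -/(rabs s _) rabs_rnorm.
have S1 : S 1.
  exists (ofreal s (rnorm s x)^-1 *: x); first by rewrite /= rnorm_unit.
  rewrite scalar_formZ// -/(rabs s _) rabsM.
  have := rnorm_unit x0; rewrite rnormZ -/(rabs s _) => <-; congr (_ * _).
  by apply: (@ofreal_inj _ _ s); rewrite ofreal_rabs ofreal_rnorm hx normr_id.
apply/le_anti; rewrite ge_sup//=; last by exists 1.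
by rewrite sup_upper_bound//; split; exists 1.
Qed.

(** Smoothness in terms of [norming]; as a definition over the bare normed
    space it can be transported without mentioning the field case [s]. *)
Definition norm_smooth := forall x, x != 0 -> exists phi,
  norming x phi /\ forall psi, norming x psi -> psi = phi.

Lemma smoothP : smooth s V <-> norm_smooth.
Proof.
split=> sm x x0; have [phi [nphi uphi]] := sm x x0.
  exists phi; split; first exact/(supportingP _ x0).
  by move=> psi /(supportingP _ x0) /uphi ->.
exists phi; split; first exact/(supportingP _ x0).
by move=> psi /(supportingP _ x0) /uphi ->.
Qed.

(** Only the real part of a form has to be estimated: multiplying the argument
    by a unimodular scalar rotates any value onto the positive axis. *)
Lemma norming_of_realpart x phi : scalar phi ->
  (forall v, realpart s (phi v) <= rnorm s v) ->
  rnorm s x <= realpart s (phi x) -> norming x phi.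
Proof.
move=> lin h hx; have b v : `|phi v| <= `|v|.
  have [u u1 e] := rotate_to_norm (phi v).
  have := h (u *: v); rewrite scalar_formZ// e -/(rabs s _) rnormZ u1 realpart1 mul1r.
  by rewrite rabs_rnorm.
split=> //; have e : rabs s (phi x) <= realpart s (phi x).
  by apply: le_trans hx; rewrite rabs_rnorm.
rewrite (realpart_eq_rabs e); apply: le_anti; rewrite b /= -(ofreal_rnorm s) -(ofreal_rabs s).
by rewrite ofreal_le (le_trans hx)// realpart_le_rabs.
Qed.

Lemma norming_realpart x phi : norming x phi ->
  (forall v, realpart s (phi v) <= rnorm s v) /\ realpart s (phi x) = rnorm s x.
Proof.
move=> [_ h ->]; split=> // v; apply: le_trans (realpart_le_rabs _ _) _.
by rewrite rabs_rnorm.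
Qed.

(** A real-linear form is the real part of exactly one scalar form; over the
    complex numbers it is [v |-> f v - i f (i v)]. *)
Lemma scalar_form_of_realpart (f : V -> R) :
  (forall u v, f (u + v) = f u + f v) ->
  (forall r v, f (ofreal s r *: v) = r * f v) ->
  exists2 phi : V -> K, scalar phi & forall v, realpart s (phi v) = f v.
Proof.
case: K / s V f => [U f fD fZ|U f fD fZ].
  by exists f => // k u v; rewrite fD fZ.
have f0 : f 0 = 0 by rewrite -(scale0r 0) -(rmorph0 (real_complex R)) fZ mul0r.
have fN (v : U) : f (- v) = - f v by apply/eqP; rewrite -addr_eq0 -fD addNr f0.
exists (fun v : U => (f v -i* f ('i%C *: v))%C) => // -[a b] u v.
have E (w : U) : (a +i* b)%C *: w = a%:C%C *: w + b%:C%C *: ('i%C *: w).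
  by rewrite scalerA -scalerDl; congr (_ *: w); simpc.
have ii (w : U) : 'i%C *: ('i%C *: w) = - w.
  by rewrite scalerA -expr2 sqr_i scaleN1r.
have Ei (w : U) : 'i%C *: ((a +i* b)%C *: w) = a%:C%C *: ('i%C *: w) - b%:C%C *: w.
  by rewrite E scalerDr !scalerA mulrC [_ * b%:C%C]mulrC -!scalerA ii scalerN.
rewrite scalerDr Ei E !fD fN !fZ; simpc; congr Complex; ring.
Qed.

Lemma norming_exists_of_real_form x :
  (exists f : V -> R, [/\ forall u v, f (u + v) = f u + f v,
     forall r v, f (ofreal s r *: v) = r * f v, forall v, f v <= rnorm s v
     & f x = rnorm s x]) -> exists phi, norming x phi.
Proof.
move=> [f [fD fZ fle fx]]; have [phi lin e] := scalar_form_of_realpart fD fZ.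
by exists phi; apply: norming_of_realpart => // [v|]; rewrite e ?fx.
Qed.

Lemma normingZ x phi k : k != 0 -> norming x phi ->
  norming (k *: x) (fun v => conjK s k / `|k| * phi v).
Proof.
move=> k0 [lin h hx]; have nk : `|k| != 0 by rewrite normr_eq0.
split=> [a u v|v|].
- by rewrite lin mulrDr mulrCA.
- by rewrite normrM normrM normfV normr_id norm_conjK divff// mul1r.
rewrite scalar_formZ// hx normrZ mulrA; congr (_ * _).
by rewrite mulrC mulrA mulr_conjK expr2 mulfK.
Qed.

Lemma norming0 : norming 0 (fun=> 0).
Proof. by split=> [a u v|v|]; rewrite ?mulr0 ?addr0 ?normr0. Qed.

Lemma norm_smooth_dual : norm_smooth -> exists J : V -> V -> K,
  (forall x, norming x (J x)) /\
  (forall x phi, x != 0 -> norming x phi -> phi = J x) /\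
  (forall v, J 0 v = 0).
Proof.
move=> sm; have ex x : exists phi, [/\ norming x phi,
    (x != 0 -> forall psi, norming x psi -> psi = phi) & (x = 0 -> phi = fun=> 0)].
  have [->|x0] := eqVneq x 0; first by exists (fun=> 0); split=> //; exact: norming0.
  have [phi [? ?]] := sm x x0; exists phi; split=> // e.
  by rewrite e eqxx in x0.
exists (fun x => sval (cid (ex x))); split; [|split].
- by move=> x; case: (cid _) => ? [].
- by move=> x phi x0 nphi; case: (cid _) => psi /= [_ /(_ x0) h _]; exact: h.
- by move=> v; case: (cid _) => psi /= [_ _ ->].
Qed.

(** The semi-inner product is [|y|] times the functional norming [y]. *)
Lemma norm_smooth_sip : norm_smooth -> exists2 sip : V -> V -> K,
  semi_inner_product s sip &
  forall y phi, y != 0 -> norming y phi -> forall x, sip x y = `|y| * phi x.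
Proof.
move=> /norm_smooth_dual[J [nJ [uJ _]]]; exists (fun x y => `|y| * J y x).
  split=> [x y z a b|x y l|x y|x].
  - have [lin _ _] := nJ z.
    by rewrite (scalar_formD lin) !(scalar_formZ lin) mulrDr (mulrCA a) (mulrCA b).
  - have [->|l0] := eqVneq l 0; first by rewrite scale0r normr0 conjK0 !mul0r.
    have [->|y0] := eqVneq y 0; first by rewrite scaler0 normr0 !mul0r mulr0.
    rewrite -(uJ _ _ _ (normingZ l0 (nJ y))) ?scaler_eq0 ?negb_or ?l0//.
    rewrite normrZ mulrA [_ * (_ / _)]mulrC mulrA divfK ?normr_eq0//.
    by rewrite !mulrA.
  - have [_ h _] := nJ y.
    by rewrite normrM normr_id mulrC ler_wpM2r.
  - by have [_ _ ->] := nJ x; rewrite expr2.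
by move=> y phi y0 /(uJ _ _ y0) ->.
Qed.

Lemma rnorm_dist x y : `|rnorm s x - rnorm s y| <= rnorm s (x - y).
Proof.
have h (u v : V) : rnorm s u - rnorm s v <= rnorm s (u - v).
  by rewrite lerBlDr -{1}(subrK v u) rnormD.
by rewrite ler_norml h andbT lerNl opprB -[rnorm s (x - y)]rnormN opprB h.
Qed.

Lemma continuous_of_dist (f : V -> R) :
  (forall x y, `|f x - f y| <= rnorm s (x - y)) -> continuous f.
Proof.
move=> hf x; apply/cvgrPdist_lt => e e0; near=> y.
have : `|x - y| < ofreal s e.
  near: y; have /cvgrPdist_lt := @cvg_id _ (nbhs x).
  by apply; rewrite -(ofreal0 s) ofreal_lt.
by rewrite -(ofreal_rnorm s) ofreal_lt; apply: le_lt_trans.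
Unshelve. all: by end_near.
Qed.

Lemma rnorm_continuous : continuous (@rnorm R K s V).
Proof. exact: continuous_of_dist rnorm_dist. Qed.

End Norming.

(** * Compactness of discs of scalars *)

Section CompactScalars.
Variables (R : realType) (K : numFieldType) (s : RorC R K).

Lemma ofreal_continuous : continuous (ofreal s : R -> K).
Proof.
move=> x; apply/cvgrPdist_lt => e e0; near=> y.
rewrite -ofrealN -ofrealD norm_ofreal -[e](ofreal_realpart s) ?ltW// ofreal_lt.
near: y; have /cvgrPdist_lt := @cvg_id _ (nbhs x).
by apply; rewrite -(ofreal_lt s) ofreal0 ofreal_realpart// ltW.
Unshelve. all: by end_near.
Qed.

Lemma realpart_continuous : continuous (realpart s : K -> R).
Proof.
apply: (@continuous_of_dist R K s K) => x y.
by rewrite -realpartN -realpartD normrabs_realpart.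
Qed.

End CompactScalars.

Lemma rabs_continuous (R : realType) (K : numFieldType) (s : RorC R K) :
  continuous (rabs s : K -> R).
Proof. exact: (@rnorm_continuous R K s K). Qed.

Lemma normrabs_impart (R : realType) (z : (R[i] : numFieldType)) :
  `|complex.Im z| <= rabs (ComplexScalars R) z.
Proof.
rewrite /rabs norm_complexE; case: z => a b /=.
by rewrite -sqrtr_sqr ler_wsqrtr// lerDr sqr_ge0.
Qed.

Lemma compact_disc (R : realType) (K : numFieldType) (s : RorC R K) (r : R) :
  compact [set k : K | rabs s k <= r].
Proof.
have cl : closed [set k : K | rabs s k <= r].
  apply: (@closed_comp K R (rabs s) [set x | x <= r]); last exact: closed_le.
  by move=> x _; exact: rabs_continuous.
case: K / s cl => [|] cl.
  apply: subclosed_compact cl (@segment_compact R (- r) r) _ => k /=.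
  by rewrite in_itv /= -ler_norml.
pose g (z : R * R) : (R[i] : numFieldType) :=
  ofreal (ComplexScalars R) z.1 + 'i%C * ofreal (ComplexScalars R) z.2.
have cg : continuous g.
  move=> z; apply: cvgD.
    by apply: continuous_comp; [exact: cvg_fst|exact: ofreal_continuous].
  apply: cvgMr; apply: continuous_comp; [exact: cvg_snd|exact: ofreal_continuous].
have cpt := compact_setX (@segment_compact R (- r) r) (@segment_compact R (- r) r).
apply: (subclosed_compact cl (continuous_compact (continuous_subspaceT cg) cpt)).
move=> [a b] /= ab; exists (a, b); last by rewrite /g /=; simpc.
split; rewrite /= in_itv /= -ler_norml; apply: le_trans ab.
  exact: (normrabs_realpart (ComplexScalars R) (a +i* b)%C).
exact: (normrabs_impart (a +i* b)%C).
Qed.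

(** * Auerbach bases *)

Section Auerbach.
Variables (R : realType) (K : numFieldType) (s : RorC R K).
Variables (X : normedModType K).

Let i0 : 'I_3 := ord0.
Let i1 : 'I_3 := lift ord0 ord0.
Let i2 : 'I_3 := lift ord0 (lift ord0 ord0).

(** The determinant with rows [u], [v], [w], expanded so that trilinearity and
    Cramer's rule are ring identities. *)
Let vol (u v w : 'rV[K]_3) : K :=
  u 0 i0 * (v 0 i1 * w 0 i2 - v 0 i2 * w 0 i1)
  - u 0 i1 * (v 0 i0 * w 0 i2 - v 0 i2 * w 0 i0)
  + u 0 i2 * (v 0 i0 * w 0 i1 - v 0 i1 * w 0 i0).

Let size1 (u : 'rV[K]_3) : R := rabs s (u 0 i0) + rabs s (u 0 i1) + rabs s (u 0 i2).

Let rV3_eq (u v : 'rV[K]_3) :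
  u 0 i0 = v 0 i0 -> u 0 i1 = v 0 i1 -> u 0 i2 = v 0 i2 -> u = v.
Proof.
move=> h0 h1 h2; apply/rowP => -[[|[|[|//]]] hj].
- by rewrite (_ : Ordinal hj = i0) //; apply/val_inj.
- by rewrite (_ : Ordinal hj = i1) //; apply/val_inj.
- by rewrite (_ : Ordinal hj = i2) //; apply/val_inj.
Qed.

Let size1_gt0 u : u != 0 -> 0 < size1 u.
Proof.
move=> u0; rewrite lt0r !addr_ge0 ?rabs_ge0// andbT; apply: contra u0.
rewrite /size1 !paddr_eq0 ?addr_ge0 ?rabs_ge0// !rabs_eq0.
by move=> /andP[/andP[/eqP h0 /eqP h1] /eqP h2]; apply/eqP/rV3_eq; rewrite mxE.
Qed.

Let size1Z k u : size1 (k *: u) = rabs s k * size1 u.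
Proof. by rewrite /size1 !mxE !rabsM !mulrDr. Qed.

Let sphere : set 'rV[K]_3 := [set u | size1 u = 1].

Let coord_cts (i : 'I_3) : continuous (fun u : 'rV[K]_3 => u 0 i).
Proof. exact: coord_continuous. Qed.

Let sphere_compact : compact sphere.
Proof.
have cb := @rV_compact K 3 (fun=> [set k | rabs s k <= 1]) (fun=> compact_disc (s := s) (r := 1)).
apply: subclosed_compact cb _.
  apply: (@closed_comp _ R size1 [set 1]); last exact: closed_eq.
  have cr i : continuous (fun u : 'rV[K]_3 => rabs s (u 0 i)).
    move=> u; apply: (@continuous_comp _ _ _ (fun u : 'rV[K]_3 => u 0 i) (rabs s)).
      exact: coord_cts.
    exact: rabs_continuous.
  by move=> u _; exact: (cvgD (cvgD (cr i0 u) (cr i1 u)) (cr i2 u)).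
move=> u; rewrite /sphere /size1 /= => u1 -[[|[|[|//]]] hj].
- rewrite (_ : Ordinal hj = i0); last exact/val_inj.
  by rewrite -u1 -addrA lerDl addr_ge0 ?rabs_ge0.
- rewrite (_ : Ordinal hj = i1); last exact/val_inj.
  by rewrite -u1 addrAC lerDr addr_ge0 ?rabs_ge0.
- rewrite (_ : Ordinal hj = i2); last exact/val_inj.
  by rewrite -u1 lerDr addr_ge0 ?rabs_ge0.
Qed.

Variable b : 'I_3 -> X.
Hypothesis b_free : forall c : 'I_3 -> K, \sum_i c i *: b i = 0 -> forall i, c i = 0.
Hypothesis b_span : forall v, exists c : 'I_3 -> K, v = \sum_i c i *: b i.

Let comb (u : 'rV[K]_3) : X := \sum_i u 0 i *: b i.
Let combE u : comb u = u 0 i0 *: b i0 + (u 0 i1 *: b i1 + (u 0 i2 *: b i2 + 0)).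
Proof. by rewrite /comb !big_ord_recl big_ord0. Qed.

Let N u := rnorm s (comb u).

Let combP a u v : comb (a *: u + v) = a *: comb u + comb v.
Proof.
rewrite /comb scaler_sumr -big_split; apply: eq_bigr => i _ /=.
by rewrite !mxE scalerDl scalerA.
Qed.

Let comb_inj0 u : comb u = 0 -> u = 0.
Proof. by move=> /b_free h; apply/rowP => i; rewrite h mxE. Qed.

Let comb0 : comb 0 = 0.
Proof. by rewrite /comb big1// => i _; rewrite mxE scale0r. Qed.

Let combZ a u : comb (a *: u) = a *: comb u.
Proof. by rewrite -[a *: u]addr0 combP comb0 addr0. Qed.

Let N_gt0 u : u != 0 -> 0 < N u.
Proof.
by move=> u0; rewrite rnorm_gt0; apply: contra u0 => /eqP/comb_inj0 ->.
Qed.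

Let N_cts : continuous N.
Proof.
have c : continuous comb.
  have cz i : continuous (fun u : 'rV[K]_3 => u 0 i *: b i).
    move=> u.
    exact: (@cvgZr_tmp K X _ (nbhs u) _ (fun u : 'rV[K]_3 => u 0 i) _ (b i) (@coord_cts i u)).
  have -> : comb = fun u : 'rV[K]_3 =>
      u 0 i0 *: b i0 + (u 0 i1 *: b i1 + (u 0 i2 *: b i2 + 0)).
    by apply/funext => v; exact: combE.
  by move=> u; exact: (cvgD (@cz i0 u) (cvgD (@cz i1 u) (cvgD (@cz i2 u) (cvg_cst 0)))).
move=> u; apply: (@continuous_comp _ _ _ comb (@rnorm R K s X)).
  exact: c.
exact: rnorm_continuous.
Qed.

Let T := ('rV[K]_3 * 'rV[K]_3 * 'rV[K]_3)%type.

Let volT (t : T) := vol t.1.1 t.1.2 t.2.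

Let vol_cts : continuous volT.
Proof.
have c1 : continuous (fun t : T => t.1.1).
  by move=> t; apply: (@continuous_comp T _ _ fst fst); [exact: cvg_fst|exact: cvg_fst].
have c2 : continuous (fun t : T => t.1.2).
  by move=> t; apply: (@continuous_comp T _ _ fst snd); [exact: cvg_fst|exact: cvg_snd].
have c3 : continuous (fun t : T => t.2) by move=> t; exact: cvg_snd.
have d1 i : continuous (fun t : T => t.1.1 0 i).
  move=> t; apply: (@continuous_comp T _ _ (fun t : T => t.1.1) (fun u : 'rV[K]_3 => u 0 i)).
    exact: c1.
  exact: coord_cts.
have d2 i : continuous (fun t : T => t.1.2 0 i).
  move=> t; apply: (@continuous_comp T _ _ (fun t : T => t.1.2) (fun u : 'rV[K]_3 => u 0 i)).
    exact: c2.
  exact: coord_cts.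
have d3 i : continuous (fun t : T => t.2 0 i).
  move=> t; apply: (@continuous_comp T _ _ (fun t : T => t.2) (fun u : 'rV[K]_3 => u 0 i)).
    exact: c3.
  exact: coord_cts.
have m i j k : continuous (fun t : T => t.1.1 0 i * (t.1.2 0 j * t.2 0 k - t.1.2 0 k * t.2 0 j)).
  by move=> t; exact: (cvgM (@d1 i t) (cvgB (cvgM (@d2 j t) (@d3 k t)) (cvgM (@d2 k t) (@d3 j t)))).
by move=> t; exact: (cvgD (cvgB (@m i0 i1 i2 t) (@m i1 i0 i2 t)) (@m i2 i0 i1 t)).
Qed.

(** Invariant under rescaling each of the three rows, hence it is enough to
    maximise it over a compact set of normalised rows. *)
Let ratio (t : T) : R := rabs s (volT t) / (N t.1.1 * N t.1.2 * N t.2).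

Let S3 : set T := [set t | [/\ sphere t.1.1, sphere t.1.2 & sphere t.2]].

Let sphere_neq0 u : sphere u -> u != 0.
Proof.
apply: contraPneq => ->; rewrite /sphere /size1 /= !mxE rabs_zero !addr0.
by move=> /esym/eqP; rewrite oner_eq0.
Qed.

Let ratio_max : exists2 t, S3 t & forall t', S3 t' -> ratio t' <= ratio t.
Proof.
have e1 : sphere (delta_mx 0 i0).
  by rewrite /sphere /size1 /= !mxE /= rabs_zero !addr0 rabs1.
have S0 : S3 !=set0 by exists (delta_mx 0 i0, delta_mx 0 i0, delta_mx 0 i0).
have cS : compact S3.
  rewrite (_ : S3 = (sphere `*` sphere) `*` sphere).
    exact: compact_setX (compact_setX sphere_compact sphere_compact) sphere_compact.
  by apply/seteqP; split=> -[[u v] w] /=; [case|case=> -[]].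
have cr : {within S3, continuous ratio}.
  apply: continuous_in_subspaceT => t; rewrite inE.
  move=> -[/sphere_neq0 h1 /sphere_neq0 h2 /sphere_neq0 h3].
  have cv : rabs s (volT x) @[x --> t] --> rabs s (volT t).
    by apply: (@continuous_comp T _ _ volT (rabs s)); [exact: vol_cts|exact: rabs_continuous].
  have n1 : N x.1.1 @[x --> t] --> N t.1.1.
    apply: (@continuous_comp T _ _ (fun t : T => t.1.1) N); last exact: N_cts.
    by apply: (@continuous_comp T _ _ fst fst); [exact: cvg_fst|exact: cvg_fst].
  have n2 : N x.1.2 @[x --> t] --> N t.1.2.
    apply: (@continuous_comp T _ _ (fun t : T => t.1.2) N); last exact: N_cts.
    by apply: (@continuous_comp T _ _ fst snd); [exact: cvg_fst|exact: cvg_snd].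
  have n3 : N x.2 @[x --> t] --> N t.2.
    by apply: (@continuous_comp T _ _ (fun t : T => t.2) N); [exact: cvg_snd|exact: N_cts].
  have nz : N t.1.1 * N t.1.2 * N t.2 != 0 by rewrite gt_eqF// !mulr_gt0// N_gt0.
  exact: (cvgM cv (cvgV nz (cvgM (cvgM n1 n2) n3))).
have [t tS tmax] := compact_EVT_max S0 cS cr.
exists t; first by rewrite inE in tS.
by move=> t' St'; apply: tmax; rewrite inE.
Qed.

Let volZ1 k u v w : vol (k *: u) v w = k * vol u v w.
Proof. by rewrite /vol !mxE; ring. Qed.
Let volZ2 k u v w : vol u (k *: v) w = k * vol u v w.
Proof. by rewrite /vol !mxE; ring. Qed.
Let volZ3 k u v w : vol u v (k *: w) = k * vol u v w.
Proof. by rewrite /vol !mxE; ring. Qed.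

Let to_sphere u : u != 0 ->
  exists2 k, 0 < rabs s k & sphere (k *: u) /\ N (k *: u) = rabs s k * N u.
Proof.
move=> u0; have S0 := size1_gt0 u0.
exists (ofreal s (size1 u)^-1).
  by rewrite rabs_ofreal ger0_norm ?invr_ge0 ?ltW// invr_gt0.
split; last by rewrite /N combZ rnormZ.
by rewrite /sphere /= size1Z rabs_ofreal ger0_norm ?invr_ge0 ?ltW// mulVf// gt_eqF.
Qed.

Let cancel_factors (a d k n t v w : R) : 0 < k -> 0 < n -> 0 < t -> 0 < v -> 0 < w ->
  k * a / (k * n * v * w) <= d / (t * v * w) -> a * t <= d * n.
Proof.
move=> k0 n0 t0 v0 w0.
have -> : k * a / (k * n * v * w) = a / n / (v * w) by field; rewrite !gt_eqF.
have -> : d / (t * v * w) = d / t / (v * w) by field; rewrite !gt_eqF.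
rewrite ler_pM2r ?invr_gt0 ?mulr_gt0// ler_pdivrMr// mulrAC ler_pdivlMr//.
Qed.

Let vol_max : exists u v w, [/\ vol u v w != 0, u != 0, v != 0 & w != 0] /\
  [/\ forall x, rabs s (vol x v w) * N u <= rabs s (vol u v w) * N x,
      forall x, rabs s (vol u x w) * N v <= rabs s (vol u v w) * N x
    & forall x, rabs s (vol u v x) * N w <= rabs s (vol u v w) * N x].
Proof.
have [[[u v] w] [/= Su Sv Sw] mx] := ratio_max.
have [[u0 v0] w0] := (sphere_neq0 Su, sphere_neq0 Sv, sphere_neq0 Sw).
have Nu := N_gt0 u0; have Nv := N_gt0 v0; have Nw := N_gt0 w0.
exists u, v, w; split.
  split=> //; have dS i : sphere (delta_mx 0 i).
    rewrite /sphere /size1 /= !mxE /=; case: i => -[|[|[|//]]] hi /=;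
    by rewrite rabs_zero rabs1 ?addr0 ?add0r.
  have := mx (delta_mx 0 i0, delta_mx 0 i1, delta_mx 0 i2) (And3 (dS i0) (dS i1) (dS i2)).
  rewrite -(rabs_gt0 s); apply: contraTT; rewrite -leNgt -ltNge => h.
  rewrite /ratio /volT /=; apply: (@le_lt_trans _ _ 0).
    by rewrite mulr_le0_ge0// invr_ge0 !mulr_ge0// ltW.
  have dn i : delta_mx 0 i != 0 :> 'rV[K]_3 by exact: sphere_neq0.
  rewrite divr_gt0 ?mulr_gt0 ?N_gt0//.
  by rewrite /vol !mxE /= !(mul1r, mul0r, mulr0, subr0, addr0) rabs1.
have N0 : N 0 = 0 by rewrite /N comb0 rnorm0.
split=> x.
- have [->|x0] := eqVneq x 0.
    by rewrite -(scale0r 0) volZ1 mul0r rabs_zero mul0r scale0r N0 mulr0.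
  have [k k0 [Sk Nk]] := to_sphere x0; have Nx := N_gt0 x0.
  have := mx (k *: x, v, w) (And3 Sk Sv Sw); rewrite /ratio /volT /= volZ1 rabsM Nk.
  
  exact: cancel_factors.
- have [->|x0] := eqVneq x 0.
    by rewrite -(scale0r 0) volZ2 mul0r rabs_zero mul0r scale0r N0 mulr0.
  have [k k0 [Sk Nk]] := to_sphere x0; have Nx := N_gt0 x0.
  have := mx (u, k *: x, w) (And3 Su Sk Sw); rewrite /ratio /volT /= volZ2 rabsM Nk.
  rewrite [N u * _]mulrC [N u * N v]mulrC.
  exact: cancel_factors.
- have [->|x0] := eqVneq x 0.
    by rewrite -(scale0r 0) volZ3 mul0r rabs_zero mul0r scale0r N0 mulr0.
  have [k k0 [Sk Nk]] := to_sphere x0; have Nx := N_gt0 x0.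
  have := mx (u, v, k *: x) (And3 Su Sv Sk); rewrite /ratio /volT /= volZ3 rabsM Nk.
  rewrite ![N u * N v * _]mulrC !mulrA.
  exact: cancel_factors.
Qed.

Let vol_cramer u v w x :
  vol u v w *: x = vol x v w *: u + vol u x w *: v + vol u v x *: w.
Proof. by apply: rV3_eq; rewrite !mxE /vol; ring. Qed.

Let vol1P a x y v w : vol (a *: x + y) v w = a * vol x v w + vol y v w.
Proof. by rewrite /vol !mxE; ring. Qed.
Let vol2P a x y u w : vol u (a *: x + y) w = a * vol u x w + vol u y w.
Proof. by rewrite /vol !mxE; ring. Qed.
Let vol3P a x y u v : vol u v (a *: x + y) = a * vol u v x + vol u v y.
Proof. by rewrite /vol !mxE; ring. Qed.

(** At a maximum of the volume spanned by three unit vectors, replacing one of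
    them by [v] cannot increase the volume; by Cramer's rule this bounds the
    corresponding coordinate of [v]. So every coordinate functional norms its
    basis vector, up to a factor. *)
Lemma auerbach_of_basis : exists (e1 e2 e3 : X) (x1 x2 x3 : X -> K),
  [/\ [/\ scalar x1, scalar x2 & scalar x3],
      [/\ e1 != 0, e2 != 0 & e3 != 0],
      forall v, v = x1 v *: e1 + x2 v *: e2 + x3 v *: e3,
      [/\ x1 e1 = 1, x2 e1 = 0 & x3 e1 = 0] /\
      [/\ x1 e2 = 0, x2 e2 = 1 & x3 e2 = 0] /\
      [/\ x1 e3 = 0, x2 e3 = 0 & x3 e3 = 1] &
      [/\ forall v, rabs s (x1 v) * rnorm s e1 <= rnorm s v,
          forall v, rabs s (x2 v) * rnorm s e2 <= rnorm s v &
          forall v, rabs s (x3 v) * rnorm s e3 <= rnorm s v]].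
Proof.
have ex v : exists c : 'rV[K]_3, comb c = v.
  have [c ->] := b_span v; exists (\row_i c i).
  by apply: eq_bigr => i _; rewrite mxE.
pose crd v := sval (cid (ex v)).
have crdK v : comb (crd v) = v by exact: (svalP (cid (ex v))).
have combB c d : comb c = comb d -> c = d.
  move=> e; apply/eqP; rewrite -subr_eq0; apply/eqP/comb_inj0.
  by rewrite addrC -scaleN1r combP e scaleN1r addNr.
have combK c : crd (comb c) = c by apply: combB; rewrite crdK.
have crdP a v w : crd (a *: v + w) = a *: crd v + crd w.
  by apply: combB; rewrite combP !crdK.
have [u [v [w [[D0 u0 v0 w0] [h1 h2 h3]]]]] := vol_max.
have D_gt0 : 0 < rabs s (vol u v w) by rewrite rabs_gt0.
pose x1 z := vol (crd z) v w / vol u v w.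
pose x2 z := vol u (crd z) w / vol u v w.
pose x3 z := vol u v (crd z) / vol u v w.
exists (comb u), (comb v), (comb w), x1, x2, x3.
have comb_neq0 c : c != 0 -> comb c != 0.
  by apply: contra => /eqP/comb_inj0 ->.
split.
- by split=> a y z; rewrite /x1 /x2 /x3 crdP ?vol1P ?vol2P ?vol3P mulrDl -mulrA.
- by split; exact: comb_neq0.
- move=> z; apply: (scalerI D0); rewrite !scalerDr !scalerA /x1 /x2 /x3.
  rewrite !(mulrC (vol u v w)) !divfK//.
  have := congr1 comb (vol_cramer u v w (crd z)); rewrite combZ crdK => ->.
  by rewrite -addrA 2!combP combZ addrA.
- rewrite /x1 /x2 /x3 !combK !divff//.
  have dup1 x y : vol x x y = 0 by rewrite /vol; ring.
  have dup2 x y : vol x y y = 0 by rewrite /vol; ring.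
  have dup3 x y : vol x y x = 0 by rewrite /vol; ring.
  by rewrite !(dup1, dup2, dup3) mul0r.
split=> z; rewrite /x1 /x2 /x3 rabsM rabsV mulrAC ler_pdivrMr// mulrC [leRHS]mulrC.
- by rewrite mulrC -{2}[z]crdK; exact: h1.
- by rewrite mulrC -{2}[z]crdK; exact: h2.
- by rewrite mulrC -{2}[z]crdK; exact: h3.
Qed.

End Auerbach.

(** * Correlations of the projective plane are semilinear *)

(** The map [(a, b, c) |-> (j1, j2, j3)] sends points of the plane to lines, and
    [closedD], [closedZ] say that the points whose line passes through a given
    point [(y1, y2, y3)] form a line. The fundamental theorem of projective
    geometry then makes the map semilinear. When moreover the basis points are
    sent to the opposite sides of the basis triangle, the map is diagonal, and
    the theorem has the short proof below. *)
Section Correlation.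
Variables (K : fieldType) (j1 j2 j3 : K -> K -> K -> K).

Hypothesis closedD : forall y1 y2 y3 a b c a' b' c',
  y1 * j1 a b c + y2 * j2 a b c + y3 * j3 a b c = 0 ->
  y1 * j1 a' b' c' + y2 * j2 a' b' c' + y3 * j3 a' b' c' = 0 ->
  y1 * j1 (a + a') (b + b') (c + c') + y2 * j2 (a + a') (b + b') (c + c')
    + y3 * j3 (a + a') (b + b') (c + c') = 0.
Hypothesis closedZ : forall y1 y2 y3 k a b c,
  y1 * j1 a b c + y2 * j2 a b c + y3 * j3 a b c = 0 ->
  y1 * j1 (k * a) (k * b) (k * c) + y2 * j2 (k * a) (k * b) (k * c)
    + y3 * j3 (k * a) (k * b) (k * c) = 0.
Hypothesis anisotropic : forall a b c,
  a * j1 a b c + b * j2 a b c + c * j3 a b c = 0 -> [/\ a = 0, b = 0 & c = 0].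
Hypotheses (j2_100 : j2 1 0 0 = 0) (j3_100 : j3 1 0 0 = 0)
  (j1_010 : j1 0 1 0 = 0) (j3_010 : j3 0 1 0 = 0)
  (j1_001 : j1 0 0 1 = 0) (j2_001 : j2 0 0 1 = 0).

(* The points whose line passes through the first basis point are those of the
   opposite side. *)
Let zero_coord1 a b c : (j1 a b c = 0) <-> (a = 0).
Proof.
have z b' c' : 1 * j1 0 b' c' + 0 * j2 0 b' c' + 0 * j3 0 b' c' = 0.
  have h2 : 1 * j1 0 1 0 + 0 * j2 0 1 0 + 0 * j3 0 1 0 = 0 by rewrite j1_010; ring.
  have h3 : 1 * j1 0 0 1 + 0 * j2 0 0 1 + 0 * j3 0 0 1 = 0 by rewrite j1_001; ring.
  have := closedD (closedZ b' h2) (closedZ c' h3).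
  by rewrite !(mulr0, mulr1, addr0, add0r).
split=> [ja|->]; last by have := z b c; rewrite ?mul0r ?mul1r ?addr0 ?add0r.
have ha : 1 * j1 a b c + 0 * j2 a b c + 0 * j3 a b c = 0 by rewrite ja; ring.
have := closedD ha (z (- b) (- c)); rewrite !subrr addr0 => e.
have [] // := @anisotropic a 0 0.
by rewrite (_ : _ + _ = a * (1 * j1 a 0 0 + 0 * j2 a 0 0 + 0 * j3 a 0 0)); [rewrite e mulr0|ring].
Qed.

Let zero_coord2 a b c : (j2 a b c = 0) <-> (b = 0).
Proof.
have z a' c' : 0 * j1 a' 0 c' + 1 * j2 a' 0 c' + 0 * j3 a' 0 c' = 0.
  have h1 : 0 * j1 1 0 0 + 1 * j2 1 0 0 + 0 * j3 1 0 0 = 0 by rewrite j2_100; ring.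
  have h3 : 0 * j1 0 0 1 + 1 * j2 0 0 1 + 0 * j3 0 0 1 = 0 by rewrite j2_001; ring.
  have := closedD (closedZ a' h1) (closedZ c' h3).
  by rewrite !(mulr0, mulr1, addr0, add0r).
split=> [jb|->]; last by have := z a c; rewrite ?mul0r ?mul1r ?addr0 ?add0r.
have hb : 0 * j1 a b c + 1 * j2 a b c + 0 * j3 a b c = 0 by rewrite jb; ring.
have := closedD hb (z (- a) (- c)); rewrite !subrr addr0 => e.
have [] // := @anisotropic 0 b 0.
by rewrite (_ : _ + _ = b * (0 * j1 0 b 0 + 1 * j2 0 b 0 + 0 * j3 0 b 0)); [rewrite e mulr0|ring].
Qed.

Let zero_coord3 a b c : (j3 a b c = 0) <-> (c = 0).
Proof.
have z a' b' : 0 * j1 a' b' 0 + 0 * j2 a' b' 0 + 1 * j3 a' b' 0 = 0.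
  have h1 : 0 * j1 1 0 0 + 0 * j2 1 0 0 + 1 * j3 1 0 0 = 0 by rewrite j3_100; ring.
  have h2 : 0 * j1 0 1 0 + 0 * j2 0 1 0 + 1 * j3 0 1 0 = 0 by rewrite j3_010; ring.
  have := closedD (closedZ a' h1) (closedZ b' h2).
  by rewrite !(mulr0, mulr1, addr0, add0r).
split=> [jc|->]; last by have := z a b; rewrite ?mul0r ?mul1r ?addr0 ?add0r.
have hc : 0 * j1 a b c + 0 * j2 a b c + 1 * j3 a b c = 0 by rewrite jc; ring.
have := closedD hc (z (- a) (- b)); rewrite !subrr addr0 => e.
have [] // := @anisotropic 0 0 c.
by rewrite (_ : _ + _ = c * (0 * j1 0 0 c + 0 * j2 0 0 c + 1 * j3 0 0 c)); [rewrite e mulr0|ring].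
Qed.

Let tau2 t := j2 1 t 0 / j1 1 t 0.
Let tau3 t := j3 1 0 t / j1 1 0 t.
Let rho t := j3 0 1 t / j2 0 1 t.

Let j1_neq0 a b c : a != 0 -> j1 a b c != 0.
Proof. by apply: contra => /eqP/zero_coord1 ->. Qed.
Let j2_neq0 a b c : b != 0 -> j2 a b c != 0.
Proof. by apply: contra => /eqP/zero_coord2 ->. Qed.

(* Let y = (j2, - j1, 0) be the values at (a, b, c): the line of (a, b, c) and
   that of the third basis point both pass through y, hence so does the line of
   (1, b / a, 0), which is collinear with them. *)
Let ratio12 a b c : a != 0 -> j2 a b c = tau2 (b / a) * j1 a b c.
Proof.
move=> a0; pose y1 := j2 a b c; pose y2 := - j1 a b c.
have h : y1 * j1 a b c + y2 * j2 a b c + 0 * j3 a b c = 0 by rewrite /y1 /y2; ring.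
have h3 : y1 * j1 0 0 1 + y2 * j2 0 0 1 + 0 * j3 0 0 1 = 0 by rewrite j1_001 j2_001; ring.
have := closedZ a^-1 (closedD h (closedZ (- c) h3)).
rewrite !(mulr0, addr0, mulr1, subrr) mulVf// [_ * b]mulrC /y1 /y2 => e.
rewrite /tau2 mulrAC; apply: (canRL (mulfK (j1_neq0 _ _ (oner_neq0 _)))).
by apply/eqP; rewrite -subr_eq0; apply/eqP; rewrite -[RHS]e; ring.
Qed.

Let ratio13 a b c : a != 0 -> j3 a b c = tau3 (c / a) * j1 a b c.
Proof.
move=> a0; pose y1 := j3 a b c; pose y3 := - j1 a b c.
have h : y1 * j1 a b c + 0 * j2 a b c + y3 * j3 a b c = 0 by rewrite /y1 /y3; ring.
have h2 : y1 * j1 0 1 0 + 0 * j2 0 1 0 + y3 * j3 0 1 0 = 0 by rewrite j1_010 j3_010; ring.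
have := closedZ a^-1 (closedD h (closedZ (- b) h2)).
rewrite !(mulr0, addr0, mulr1, subrr) mulVf// [_ * c]mulrC /y1 /y3 => e.
rewrite /tau3 mulrAC; apply: (canRL (mulfK (j1_neq0 _ _ (oner_neq0 _)))).
by apply/eqP; rewrite -subr_eq0; apply/eqP; rewrite -[RHS]e; ring.
Qed.

Let ratio23 a b c : b != 0 -> j3 a b c = rho (c / b) * j2 a b c.
Proof.
move=> b0; pose y2 := j3 a b c; pose y3 := - j2 a b c.
have h : 0 * j1 a b c + y2 * j2 a b c + y3 * j3 a b c = 0 by rewrite /y2 /y3; ring.
have h1 : 0 * j1 1 0 0 + y2 * j2 1 0 0 + y3 * j3 1 0 0 = 0 by rewrite j2_100 j3_100; ring.
have := closedZ b^-1 (closedD h (closedZ (- a) h1)).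
rewrite !(mulr0, addr0, mulr1, subrr) mulVf// [_ * c]mulrC /y2 /y3 => e.
rewrite /rho mulrAC; apply: (canRL (mulfK (j2_neq0 _ _ (oner_neq0 _)))).
by apply/eqP; rewrite -subr_eq0; apply/eqP; rewrite -[RHS]e; ring.
Qed.

Let tau2_neq0 t : t != 0 -> tau2 t != 0.
Proof. by move=> t0; rewrite mulf_neq0 ?invr_neq0 ?j1_neq0 ?j2_neq0 ?oner_neq0. Qed.

Let tau2_0 : tau2 0 = 0.
Proof. by rewrite /tau2 j2_100 mul0r. Qed.

Let tau3_0 : tau3 0 = 0.
Proof. by rewrite /tau3 j3_100 mul0r. Qed.

Let rho1_neq0 : rho 1 != 0.
Proof.
rewrite mulf_neq0 ?invr_neq0 ?j2_neq0 ?oner_neq0//.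
by apply/eqP => /zero_coord3/eqP; rewrite oner_eq0.
Qed.

Let tau32 t u : t != 0 -> tau3 u = rho (u / t) * tau2 t.
Proof.
move=> t0; have j0 := j1_neq0 t u (oner_neq0 K).
apply: (mulIf j0); have := ratio13 t u (oner_neq0 K); rewrite divr1 => <-.
by rewrite (ratio23 _ _ t0) (ratio12 _ _ (oner_neq0 K)) divr1 mulrA.
Qed.

Let c2 := tau2 1.
Let c3 := rho 1 * c2.
Let tau t := tau2 t / c2.

Let c2_neq0 : c2 != 0. Proof. exact/tau2_neq0/oner_neq0. Qed.

Let tau2E t : tau2 t = c2 * tau t.
Proof. by rewrite /tau mulrC divfK. Qed.

Let tau3E t : tau3 t = c3 * tau t.
Proof.
rewrite /c3 -mulrA -tau2E; have [->|t0] := eqVneq t 0; first by rewrite tau2_0 tau3_0 mulr0.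
by rewrite (tau32 t t0) divff.
Qed.

Let rhoE t : rho t = rho 1 * tau t.
Proof.
have := tau32 t (oner_neq0 K); rewrite divr1 tau3E -/c2 => e.
by apply: (mulIf c2_neq0); rewrite -e /c3; ring.
Qed.

(* Going from the first to the third coordinate directly or through the second
   one gives the same ratio; this yields multiplicativity. *)
Let tauM_div t u : t != 0 -> tau u = tau (u / t) * tau t.
Proof.
move=> t0; have := tau32 u t0; rewrite tau3E rhoE tau2E /c3 => e.
by apply: (mulfI rho1_neq0); apply: (mulfI c2_neq0); rewrite mulrCA mulrA e; ring.
Qed.

Let tau0 : tau 0 = 0. Proof. by rewrite /tau tau2_0 mul0r. Qed.
Let tau1 : tau 1 = 1. Proof. exact: divff. Qed.

Let tauM t u : tau (t * u) = tau t * tau u.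
Proof.
have [->|u0] := eqVneq u 0; first by rewrite mulr0 tau0 mulr0.
by rewrite (tauM_div (t * u) u0) mulfK.
Qed.

(* The points (0, 1, 1), (1, t, 0) and (1, t + 1, 1) are collinear, so their
   lines are concurrent; this yields additivity. *)
Let tau_succ t : tau (t + 1) = tau t + 1.
Proof.
have b0 : j2 0 1 1 != 0 by rewrite j2_neq0 ?oner_neq0.
have ja := ratio23 0 1 (oner_neq0 K); have jb := ratio12 t 0 (oner_neq0 K).
have jc2 := ratio12 (t + 1) 1 (oner_neq0 K); have jc3 := ratio13 (t + 1) 1 (oner_neq0 K).
rewrite !divr1 in ja jb jc2 jc3.
pose y1 := rho 1 * tau2 t.
have ha : y1 * j1 0 1 1 + (- rho 1) * j2 0 1 1 + 1 * j3 0 1 1 = 0.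
  by rewrite ja (zero_coord1 0 1 1).2//; ring.
have hb : y1 * j1 1 t 0 + (- rho 1) * j2 1 t 0 + 1 * j3 1 t 0 = 0.
  by rewrite jb (zero_coord3 1 t 0).2// /y1; ring.
have := closedD ha hb; rewrite add0r addr0 [1 + t]addrC.
rewrite jc2 jc3 /y1 tau3E tau1 !tau2E /c3 => e.
apply: (mulfI rho1_neq0); apply: (mulfI c2_neq0); apply: (mulIf (j1_neq0 (t + 1) 1 (oner_neq0 K))).
by apply/eqP; rewrite -subr_eq0 -oppr_eq0; apply/eqP; rewrite -[RHS]e; ring.
Qed.

Let tauD t u : tau (t + u) = tau t + tau u.
Proof.
have [->|u0] := eqVneq u 0; first by rewrite tau0 !addr0.
have -> : t + u = (t / u + 1) * u by rewrite mulrDl divfK// mul1r.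
by rewrite tauM tau_succ mulrDl -tauM divfK// mul1r.
Qed.

Lemma correlation_coordinates : exists (t : K -> K) (b2 b3 : K),
  [/\ b2 != 0, b3 != 0, (forall x y, t (x + y) = t x + t y),
      (forall x y, t (x * y) = t x * t y) & t 1 = 1] /\
  forall a b c, [/\ t a * j2 a b c = b2 * t b * j1 a b c,
    t a * j3 a b c = b3 * t c * j1 a b c &
    b2 * t b * j3 a b c = b3 * t c * j2 a b c].
Proof.
exists tau, c2, c3; split; first by split=> //; rewrite mulf_neq0.
move=> a b c; split.
- have [->|a0] := eqVneq a 0; first by rewrite (zero_coord1 0 b c).2// tau0 mul0r mulr0.
  by rewrite (ratio12 b c a0) tau2E (tauM_div b a0); ring.
- have [->|a0] := eqVneq a 0; first by rewrite (zero_coord1 0 b c).2// tau0 mul0r mulr0.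
  by rewrite (ratio13 b c a0) tau3E (tauM_div c a0); ring.
have [->|b0] := eqVneq b 0; first by rewrite (zero_coord2 a 0 c).2// tau0 !mulr0 mul0r.
by rewrite (ratio23 a c b0) rhoE (tauM_div c b0) /c3; ring.
Qed.

End Correlation.

(** * The field endomorphism is conjugation *)

Section PositiveConjugation.
Variables (R : realType) (K : numFieldType) (s : RorC R K).

Lemma rabs_1D_sqr k :
  rabs s (1 + k) ^+ 2 = 1 + 2 * realpart s k + rabs s k ^+ 2.
Proof.
have E l : rabs s l ^+ 2 = realpart s (l * conjK s l).
  by rewrite mulr_conjK -(ofreal_rabs s) !expr2 -ofrealM ofrealK.
rewrite !E conjKD conjK1 mulrDl mul1r mulrDr mulr1 !realpartD.
by rewrite realpart1 realpart_conjK; ring.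
Qed.

Lemma realpart_ge0_of_rabs z :
  (forall m : nat, 1 <= rabs s (1 + ofreal s (m.+1%:R ^- 2) * z)) -> 0 <= realpart s z.
Proof.
move=> h; rewrite leNgt; apply/negP => z0.
have [m hm] : exists m : nat, rabs s z ^+ 2 < m.+1%:R * (- realpart s z).
  exists (Num.truncn (rabs s z ^+ 2 / (- realpart s z))).
  by rewrite -ltr_pdivrMr ?oppr_gt0// truncnS_gt.
have := h m; rewrite -(ler_pXn2r (ltn0Sn 1)) ?nnegrE ?rabs_ge0// expr1n rabs_1D_sqr.
rewrite rabsM rabs_ofreal realpartZ ger0_norm ?invr_ge0 ?exprn_ge0//.
set e := _ ^- 2; have e0 : 0 < e by rewrite invr_gt0 exprn_gt0.
have em : e * m.+1%:R <= 1.
  by rewrite /e exprS expr1 invfM -mulrA mulVf// mulr1 invf_le1// ler1n.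
rewrite -addrA lerDl => {}h.
have : 0 <= 2 * realpart s z + e * rabs s z ^+ 2.
  by rewrite -(pmulr_rge0 _ e0) mulrDr; move: h; rewrite exprMn expr2 -!mulrA (mulrCA 2).
apply/negP; rewrite -ltNge.
have : e * rabs s z ^+ 2 < e * m.+1%:R * (- realpart s z) by rewrite -mulrA ltr_pM2l.
nra.
Qed.

Variables (t : K -> K) (c : K).
Hypotheses (c0 : c != 0) (tD : forall x y, t (x + y) = t x + t y)
  (tM : forall x y, t (x * y) = t x * t y) (t1 : t 1 = 1).
Hypothesis t_ge1 : forall d, 1 <= rabs s (1 + c * (d * t d)).

Lemma endo_ratr q : t (ratr q) = ratr q.
Proof.
have t0 : t 0 = 0 := additive_zero tD.
have tN x : t (- x) = - t x by apply/eqP; rewrite -addr_eq0 -tD addNr t0.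
have tB : zmod_morphism t by move=> x y; rewrite tD tN.
have tm : monoid_morphism t by split.
pose T : {rmorphism K -> K} := HB.pack t (GRing.isZmodMorphism.Build _ _ t tB)
  (GRing.isMonoidMorphism.Build _ _ t tm).
exact: (fmorph_rat T).
Qed.

(** [t] fixes the rationals, so [d] may be replaced by [d / (m + 1)]: to first
    order in [1 / (m + 1)^2] the modulus of [1 + z] sees only [Re z]. *)
Lemma endo_form_ge0 d : 0 <= realpart s (c * (d * t d)).
Proof.
apply: realpart_ge0_of_rabs => m.
have -> : ofreal s (m.+1%:R ^- 2) * (c * (d * t d)) =
    c * ((ratr (m.+1%:R^-1) * d) * t (ratr (m.+1%:R^-1) * d)).
  rewrite tM endo_ratr fmorphV /= ratr_nat ofrealV.
  have -> : ofreal s (m.+1%:R ^+ 2) = m.+1%:R ^+ 2.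
    rewrite expr2 ofrealM; suff -> : ofreal s m.+1%:R = m.+1%:R by rewrite expr2.
    elim: m => [|m IHm]; first exact: ofreal1.
    by rewrite -[m.+2%:R]natr1 ofrealD IHm ofreal1 natr1.
  by rewrite expr2 invfM; ring.
exact: t_ge1.
Qed.

End PositiveConjugation.

(** If [t a] and [a] differed, a rational [q] between [- a] and [- t a] would make
    [(a + q) * t (a + q)] negative. *)
Lemma endo_real (R : realType) (t : R -> R) (c : R) : c != 0 ->
  (forall x y, t (x + y) = t x + t y) -> (forall x y, t (x * y) = t x * t y) -> t 1 = 1 ->
  (forall d, 0 <= c * (d * t d)) -> forall a, t a = a.
Proof.
move=> c0 tD tM t1 h a; have cp : 0 < c by rewrite lt0r c0; have := h 1; rewrite t1 !mulr1.
have {}h q : 0 <= (a + ratr q) * (t a + ratr q).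
  by rewrite -(pmulr_rge0 _ cp) -[X in t a + X](endo_ratr tD tM t1) -tD.
apply/eqP; rewrite eq_le; apply/andP; split; rewrite leNgt; apply/negP => lt.
  have : - t a < - a by rewrite ltrN2.
  move=> /rat_in_itvoo[q]; rewrite in_itv /= => /andP[h1 h2]; have := h q; nra.
have : - a < - t a by rewrite ltrN2.
move=> /rat_in_itvoo[q]; rewrite in_itv /= => /andP[h1 h2]; have := h q; nra.
Qed.

(** First [t 'i = - 'i], since [t 'i = 'i] would give a form taking both signs.
    For real [a] the form at [a + q + i q'], with [q] and [q'] rational, is
    quadratic in [u = a + q] and [v = q'] without constant term; nonnegativity
    near the origin kills its linear part, which measures [t a - a]. *)
Lemma endo_complex (R : realType) (t : R[i] -> R[i]) (c : R[i]) : c != 0 ->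
  (forall x y, t (x + y) = t x + t y) -> (forall x y, t (x * y) = t x * t y) -> t 1 = 1 ->
  (forall d, 0 <= complex.Re (c * (d * t d))) -> forall z, t z = conjc z.
Proof.
move=> c0 tD tM t1 h.
have tQ q : t (ratr q)%:C%C = (ratr q)%:C%C.
  rewrite (fmorph_rat (real_complex R)).
  exact: (@endo_ratr (R[i] : numFieldType) t tD tM t1 q).
have t0 : t 0 = 0 by have := tQ 0; rewrite rmorph0.
have tN x : t (- x) = - t x by apply/eqP; rewrite -addr_eq0 -tD addNr t0.
case: c c0 h => c1 c2 c0 h.
have c10 : 0 <= c1 by have := h 1; rewrite t1 !mulr1.
have cn : 0 < c1 ^+ 2 + c2 ^+ 2.
  rewrite lt0r addr_ge0 ?sqr_ge0// andbT paddr_eq0 ?sqr_ge0// !sqrf_eq0.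
  by apply: contra c0 => /andP[/eqP-> /eqP->].
have ti : t 'i%C = - 'i%C.
  have : (t 'i%C - 'i%C) * (t 'i%C + 'i%C) = 0.
    by rewrite -subr_sqr expr2 -tM -expr2 sqr_i tN t1 subrr.
  move=> /eqP; rewrite mulf_eq0 subr_eq0 addr_eq0 => /orP[|/eqP//] /eqP ti.
  have h1 := h (1 + 'i%C); have h2 := h (1 - 'i%C); have h3 := h 'i%C.
  move: h1 h2 h3; rewrite !tD tN t1 ti /=; simpc => h1 h2 h3; exfalso.
  have c1z : c1 = 0 by apply/le_anti; rewrite c10 andbT; lra.
  have c2z : c2 = 0 by lra.
  by move: cn; rewrite c1z c2z expr0n /= addr0 ltxx.
have tR (a : R) : t a%:C%C = a%:C%C.
  case Eta : (t a%:C%C) => [x y].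
  have P q q' : let u := a + ratr q in let v := ratr q' in
     0 <= c1 * (u ^+ 2 + v ^+ 2) + u * (c1 * (x - a) - c2 * y) - v * (c1 * y + c2 * (x - a)).
    have := h (a%:C%C + ((ratr q)%:C%C + 'i%C * (ratr q')%:C%C)).
    rewrite !tD tM !tQ ti Eta /=; simpc => hh /=; apply: le_trans hh _.
    by rewrite le_eqVlt; apply/orP; left; apply/eqP; ring.
  set B := c1 * (x - a) - c2 * y in P; set C := c1 * y + c2 * (x - a) in P.
  have A0 : 0 < c1 + 1 by rewrite ltr_wpDl.
  have near_a l r : l < r -> exists2 q, l < a + ratr q & a + ratr q < r.
    rewrite -(ltrD2r (- a)) => /rat_in_itvoo[q]; rewrite in_itv /= => /andP[h1 h2].
    by exists q; lra.
  have B0 : B = 0.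
    apply/eqP; rewrite eq_le; apply/andP; split; rewrite leNgt; apply/negP => Bp.
      have : - (B / (c1 + 1)) < 0 by rewrite oppr_lt0 divr_gt0.
      move=> /near_a[q]; rewrite ltrNl ltr_pdivlMr// => u1 u2.
      have := P q 0; rewrite rmorph0 /= expr0n /= mul0r subr0 addr0; nra.
    have : 0 < - (B / (c1 + 1)) by rewrite oppr_gt0 pmulr_llt0 ?invr_gt0.
    move=> /near_a[q u1]; rewrite ltrNr ltr_pdivrMr// => u2.
    have := P q 0; rewrite rmorph0 /= expr0n /= mul0r subr0 addr0; nra.
  have C0 : C = 0.
    apply/eqP; rewrite eq_le; apply/andP; split; rewrite leNgt; apply/negP => Cp.
      have : 0 < C / (2 * (c1 + 1)) by rewrite divr_gt0// mulr_gt0.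
      move=> /rat_in_itvoo[q']; rewrite in_itv /= => /andP[v1 v2].
      have [q u1 u2] := near_a _ _ v1.
      have := P q q'; rewrite /= B0 mulr0 addr0.
      set w := ratr q' in v1 v2 u2 *; set u := a + ratr q in u1 u2 *.
      move: v2; rewrite ltr_pdivlMr ?mulr_gt0// => v2.
      have uw : u ^+ 2 <= w ^+ 2 by rewrite ler_pXn2r ?nnegrE ?ltW// (lt_trans u1).
      have := ler_wpM2l c10 uw.
      have : 0 < w * (C - w * (2 * (c1 + 1))) by rewrite mulr_gt0// subr_gt0.
      have : 0 <= w ^+ 2 := sqr_ge0 w.
      nra.
    have : C / (2 * (c1 + 1)) < 0 by rewrite pmulr_llt0 ?invr_gt0 ?mulr_gt0.
    move=> /rat_in_itvoo[q']; rewrite in_itv /= => /andP[v1 v2].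
    have [q u1 u2] := near_a _ _ v2.
    have := P q q'; rewrite /= B0 mulr0 addr0.
    set w := ratr q' in v1 v2 u1 *; set u := a + ratr q in u1 u2 *.
    move: v1; rewrite ltr_pdivrMr ?mulr_gt0// => v1.
    have uw : u ^+ 2 <= w ^+ 2.
      rewrite -[u ^+ 2]sqrrN -[w ^+ 2]sqrrN.
      by rewrite ler_pXn2r ?nnegrE ?oppr_ge0 ?lerN2 ?ltW// (lt_trans u2).
    have := ler_wpM2l c10 uw.
    have : 0 < w * (C - w * (2 * (c1 + 1))) by rewrite nmulr_rgt0// subr_lt0.
    have : 0 <= w ^+ 2 := sqr_ge0 w.
    nra.
  have e1 : (c1 ^+ 2 + c2 ^+ 2) * (x - a) = 0.
    have -> : (c1 ^+ 2 + c2 ^+ 2) * (x - a) = c1 * B + c2 * C by rewrite /B /C; ring.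
    by rewrite B0 C0 !mulr0 addr0.
  have e2 : (c1 ^+ 2 + c2 ^+ 2) * y = 0.
    have -> : (c1 ^+ 2 + c2 ^+ 2) * y = c1 * C - c2 * B by rewrite /B /C; ring.
    by rewrite B0 C0 !mulr0 subr0.
  move/eqP: e1; rewrite mulf_eq0 gt_eqF//= subr_eq0 => /eqP ->.
  by move/eqP: e2; rewrite mulf_eq0 gt_eqF//= => /eqP ->.
move=> [a b]; rewrite [LHS](_ : _ = t (a%:C%C + 'i%C * b%:C%C)); last by congr t; simpc.
by rewrite tD tM !tR ti; simpc.
Qed.

Section PositiveConjugation2.
Variables (R : realType) (K : numFieldType) (s : RorC R K).
Variables (t : K -> K) (c : K).

Lemma endo_conj : c != 0 -> (forall x y, t (x + y) = t x + t y) ->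
  (forall x y, t (x * y) = t x * t y) -> t 1 = 1 ->
  (forall d, 1 <= rabs s (1 + c * (d * t d))) -> t =1 conjK s.
Proof.
move=> c0 tD tM t1 h.
have := endo_form_ge0 tD tM t1 h; case: K / s t c c0 tD tM t1 {h} => t' c' c0 tD tM t1 h.
  exact: endo_real c0 tD tM t1 h.
exact: endo_complex c0 tD tM t1 h.
Qed.

Lemma exprn_bounded_le1 (k M : R) : 0 <= k -> (forall m, k ^+ m <= M) -> k <= 1.
Proof.
move=> k0 h; rewrite leNgt; apply/negP => k1.
have b m : 1 + m%:R * (k - 1) <= k ^+ m.
  elim: m => [|m IHm]; first by rewrite expr0 mul0r addr0.
  rewrite exprS -natr1; apply: le_trans (ler_wpM2l k0 IHm).
  have : 0 <= m%:R * (k - 1) ^+ 2 by rewrite mulr_ge0 ?sqr_ge0.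
  nra.
have k10 : 0 < k - 1 by rewrite subr_gt0.
have := le_trans (b (Num.truncn (M / (k - 1))).+1) (h _).
by apply/negP; rewrite -ltNge ltr_wpDl// -ltr_pdivrMr// truncnS_gt.
Qed.

(** Replacing [v] by [z v] with [|z| = 1] multiplies [n v] by at least
    [|1 + c z| / |1 + c|]. Iterating, this ratio is at most 1 because [n] is
    bounded on the unit circle; so [Re (c z) <= Re c] for all unimodular [z],
    which forces [c] to be positive. *)
Lemma planar_coef_gt0 (n : K -> R) (M : R) : c != 0 -> 0 < n 1 ->
  (forall z, `|z| = 1 -> n z <= M) ->
  (forall u v, rabs s (1 + c * (u * conjK s v)) * n v <=
               rabs s (1 + c * (v * conjK s v)) * n u) ->
  1 <= rabs s (1 + c) -> 0 < c.
Proof.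
move=> c0 n1 nM h c1; have cp : 0 < rabs s (1 + c) by apply: lt_le_trans c1.
have unit_conj v : `|v| = 1 -> v * conjK s v = 1 by move=> v1; rewrite mulr_conjK v1 expr1n.
have step z v : `|z| = 1 -> `|v| = 1 ->
    rabs s (1 + c * z) / rabs s (1 + c) * n v <= n (z * v).
  move=> z1 v1; have hh := h (z * v) v; rewrite -(mulrA z) unit_conj// !mulr1 in hh.
  by rewrite mulrAC ler_pdivrMr// [leRHS]mulrC.
have iter z m : `|z| = 1 -> (rabs s (1 + c * z) / rabs s (1 + c)) ^+ m * n 1 <= n (z ^+ m).
  move=> z1; elim: m => [|m IHm]; first by rewrite !expr0 mul1r.
  rewrite !exprS -mulrA; apply: le_trans (step z _ z1 _); last by rewrite normrX z1 expr1n.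
  by rewrite ler_wpM2l// divr_ge0 ?rabs_ge0.
have le1 z : `|z| = 1 -> rabs s (1 + c * z) <= rabs s (1 + c).
  move=> z1; rewrite -[leRHS]mul1r -ler_pdivrMr//.
  apply: (@exprn_bounded_le1 _ (M / n 1)) => [|m]; first by rewrite divr_ge0 ?rabs_ge0.
  by rewrite ler_pdivlMr//; apply: le_trans (iter z m z1) _; rewrite nM// normrX z1 expr1n.
have [u u1 uc] := rotate_to_norm c.
have := le1 u u1; rewrite -(ler_pXn2r (ltn0Sn 1)) ?nnegrE ?rabs_ge0// !rabs_1D_sqr.
rewrite (mulrC c) uc.
have -> : rabs s `|c| = rabs s c by rewrite /rabs normr_id.
rewrite lerD2r lerD2l ler_pM2l// -/(rabs s c) => hh; clear - hh c0.
by rewrite (realpart_eq_rabs hh) normr_gt0.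
Qed.

End PositiveConjugation2.

(** * Norms for which orthogonal projections are contractions *)

(** [projection_le] says that the [B]-orthogonal projection of [g] onto the line
    of [h] is no longer than [g] in the norm of [X]. Chaining many projections
    between nearby directions loses arbitrarily little length, so the norm is
    constant on the unit sphere of [B]. *)
Section NonexpansiveProjections.
Variables (R : realType) (K : numFieldType) (s : RorC R K) (X : normedModType K).
Variable B : X -> X -> K.
Hypothesis B_linear : forall a u v w, B (a *: u + v) w = a * B u w + B v w.
Hypothesis B_herm : forall u v, B v u = conjK s (B u v).
Hypothesis B_pos : forall u, u != 0 -> 0 < B u u.

Local Notation n := (rnorm s).

Hypothesis projection_le : forall g h, rabs s (B g h) * n h <= realpart s (B h h) * n g.

Let q u := realpart s (B u u).

Let BDl u v w : B (u + v) w = B u w + B v w.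
Proof. by have := B_linear 1 u v w; rewrite scale1r mul1r. Qed.

Let B0l w : B 0 w = 0.
Proof. by apply: (additive_zero (f := B^~ w)) => u v; exact: BDl. Qed.

Let BZl a u w : B (a *: u) w = a * B u w.
Proof. by have := B_linear a u 0 w; rewrite B0l !addr0. Qed.

Let BDr u v w : B w (u + v) = B w u + B w v.
Proof. by rewrite B_herm BDl conjKD -!B_herm. Qed.

Let BZr a u w : B w (a *: u) = conjK s a * B w u.
Proof. by rewrite B_herm BZl conjKM -B_herm. Qed.

Let Bq u : B u u = ofreal s (q u).
Proof.
have [->|u0] := eqVneq u 0; first by rewrite /q B0l realpart0 ofreal0.
by rewrite ofreal_realpart// ltW// B_pos.
Qed.

Let q_gt0 u : u != 0 -> 0 < q u.
Proof. by move=> /B_pos; rewrite Bq -(ofreal0 s) ofreal_lt. Qed.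

Let q_ge0 u : 0 <= q u.
Proof.
have [->|u0] := eqVneq u 0; first by rewrite /q B0l realpart0.
exact/ltW/q_gt0.
Qed.

Let qZ a u : q (a *: u) = rabs s a ^+ 2 * q u.
Proof.
rewrite /q BZl BZr mulrA mulr_conjK -(ofreal_rabs s) Bq.
by rewrite expr2 -!ofrealM ofrealK expr2 -/(q u) ofrealK.
Qed.

(* The point halfway between two unit vectors at angle cosine [r] makes with
   either an angle whose cosine differs from 1 by at most a third of [1 - r]:
   two steps lose only two thirds of what one step loses. *)
Let near_one (k : R) := forall g h r, q g = 1 -> q h = 1 -> B g h = ofreal s r ->
  0 <= r -> (1 - k * (1 - r)) * n h <= n g.

Let cos_le1 g h r : q g = 1 -> q h = 1 -> B g h = ofreal s r -> r <= 1.
Proof.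
move=> g1 h1 gh; have := q_ge0 (g + (-1) *: h).
have -> : q (g + (-1) *: h) = 2 - 2 * r; last by lra.
have cN1 : conjK s (-1) = -1 by rewrite -(ofreal1 s) -ofrealN conjK_ofreal.
apply: (@ofreal_inj _ _ s); rewrite -Bq !(BDl, BDr, BZl, BZr) (B_herm g h) gh conjK_ofreal.
rewrite (Bq g) (Bq h) g1 h1 cN1 ofreal1.
have -> : (2 - 2 * r : R) = 1 + 1 - (r + r) by ring.
by rewrite !(ofrealD, ofrealN) ofreal1; ring.
Qed.

Let near_one_step k : 0 <= k -> k <= 1 -> near_one k -> near_one (2 / 3 * k).
Proof.
move=> k0 k1 nk g h r g1 h1 gh r0; have r1 := cos_le1 g1 h1 gh.
pose m := Num.sqrt (2 + 2 * r).
have m2 : m ^+ 2 = 2 + 2 * r by rewrite sqr_sqrtr//; lra.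
have m0 : 0 < m by rewrite sqrtr_gt0; lra.
pose u := ofreal s m^-1 *: (g + h); pose r' := (1 + r) / m.
have hg : B h g = ofreal s r by rewrite B_herm gh conjK_ofreal.
have u1 : q u = 1.
  rewrite /u qZ rabs_ofreal ger0_norm ?invr_ge0 ?ltW// /q !(BDl, BDr) gh hg (Bq g) (Bq h) g1 h1.
  rewrite -!ofrealD ofrealK exprVn m2.
  have -> : 1 + r + (r + 1) = 2 + 2 * r by ring.
  by rewrite mulVf// gt_eqF//; lra.
have gu : B g u = ofreal s r'.
  by rewrite /u BZr BDr conjK_ofreal (Bq g) g1 gh -ofrealD -ofrealM mulrC.
have uh : B u h = ofreal s r'.
  by rewrite /u BZl BDl (Bq h) h1 gh -ofrealD -ofrealM mulrC addrC.
have r'm : r' * m = 1 + r by rewrite /r' divfK// gt_eqF.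
have r'2 : r' ^+ 2 = (1 + r) / 2.
  have d : 2 + 2 * r != 0 by rewrite gt_eqF//; lra.
  by rewrite /r' expr_div_n m2; field.
have r'0 : 0 <= r' by rewrite divr_ge0 ?ltW//; lra.
have r'1 : r' <= 1 := cos_le1 g1 u1 gu.
have r'h : 1 <= 2 * r'.
  rewrite leNgt; apply/negP => lt; have : r' ^+ 2 < 1 / 4 by nra.
  by rewrite r'2; lra.
have d3 : 3 * (1 - r') <= 1 - r by nra.
have d0 : 0 <= 1 - k * (1 - r') by nra.
apply: le_trans (nk _ _ _ g1 u1 gu r'0).
apply: le_trans (ler_wpM2l d0 (nk _ _ _ u1 h1 uh r'0)).
rewrite mulrA ler_wpM2r ?rnorm_ge0//.
have : 0 <= (k * (1 - r')) ^+ 2 := sqr_ge0 _.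
have : k * (3 * (1 - r')) <= k * (1 - r) by rewrite ler_wpM2l.
lra.
Qed.

Let near_one_pow m : near_one ((2 / 3) ^+ m).
Proof.
elim: m => [|m IHm]; last first.
  by rewrite exprS; apply: near_one_step => //; rewrite ?exprn_ge0 ?exprn_ile1//; lra.
move=> g h r g1 h1 gh r0; rewrite expr0 mul1r opprB addrC subrK.
by have := projection_le g h; rewrite gh rabs_ofreal ger0_norm// -/(q h) h1 mul1r.
Qed.

Let unit_le g h : q g = 1 -> q h = 1 -> n h <= n g.
Proof.
move=> g1 h1; have [u u1 e] := rotate_to_norm (B g h).
have ug1 : q (u *: g) = 1 by rewrite qZ /rabs u1 realpart1 expr1n mul1r.
have ugh : B (u *: g) h = ofreal s (rabs s (B g h)) by rewrite BZl e ofreal_rabs.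
have ng : n (u *: g) = n g by rewrite rnormZ u1 realpart1 mul1r.
have r1 := cos_le1 ug1 h1 ugh; set r := rabs s (B g h) in ugh r1.
have r0 : 0 <= r by exact: rabs_ge0.
have lim : ((1 - (2 / 3) ^+ m * (1 - r)) * n h) @[m --> \oo] --> (1 - 0 * (1 - r)) * n h.
  apply: cvgMl; apply: cvgB; first exact: cvg_cst.
  by apply: cvgMl; apply: cvg_expr; rewrite ger0_norm; lra.
rewrite mul0r subr0 mul1r in lim; rewrite -(cvg_lim _ lim)//.
apply: limr_le; first exact: cvgP lim.
by near=> m; rewrite -ng; apply: near_one_pow.
Unshelve. all: by end_near.
Qed.

Lemma norm_of_projection_le (e : X) : e != 0 ->
  exists2 k, 0 < k & forall x, n x ^+ 2 = k * realpart s (B x x).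
Proof.
rewrite -/q.
pose unit x : X := ofreal s (Num.sqrt (q x))^-1 *: x.
have sq x : x != 0 -> 0 < Num.sqrt (q x) by move=> x0; rewrite sqrtr_gt0 q_gt0.
have unit1 x : x != 0 -> q (unit x) = 1.
  move=> x0; rewrite /unit qZ rabs_ofreal ger0_norm ?invr_ge0 ?ltW ?sq//.
  by rewrite exprVn sqr_sqrtr ?q_ge0// mulVf// gt_eqF// q_gt0.
have nunit x : x != 0 -> n x = Num.sqrt (q x) * n (unit x).
  move=> x0; rewrite /unit rnorm_real ger0_norm ?invr_ge0 ?ltW ?sq//.
  by rewrite mulrA divff ?mul1r// gt_eqF// sq.
move=> e0; exists (n (unit e) ^+ 2).
  rewrite exprn_gt0// rnorm_gt0; apply/eqP => z.
  by have := unit1 e e0; rewrite z /q B0l realpart0 => /eqP; rewrite eq_sym oner_eq0.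
move=> x; have [->|x0] := eqVneq x 0.
  by rewrite rnorm0 /q B0l realpart0 mulr0 expr0n.
rewrite nunit// exprMn sqr_sqrtr ?q_ge0// mulrC; congr (_ ^+ 2 * _).
by apply/le_anti; rewrite !unit_le ?unit1.
Qed.

End NonexpansiveProjections.

(** * Linear nearest-point maps onto lines force an inner product *)

Lemma strict_midpoint (K : numFieldType) (V : normedModType K) (x y : V) :
  strictly_convex V -> `|x| = `|y| -> x != y -> `|x + y| < `|x| + `|x|.
Proof.
move=> sc xy neq; have x0 : x != 0.
  apply: contraNneq neq => x0; rewrite x0 normr0 in xy.
  by rewrite x0 eq_sym -normr_eq0 -xy.
have nx : 0 < `|x| by rewrite normr_gt0.
have unit (v : V) : `|v| = `|x| -> `| `|x|^-1 *: v| = 1.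
  by move=> e; rewrite normrZ normfV normr_id e mulVf// gt_eqF.
have := sc _ _ (unit x erefl) (unit y (esym xy)).
have sI : injective ( *:%R (`|x|^-1) : V -> V) by apply: scalerI; rewrite invr_eq0 gt_eqF.
rewrite (inj_eq sI) => /(_ neq).
rewrite -scalerDr scalerA normrZ normrM !normfV normr_id ger0_norm// -invfM.
rewrite mulrC ltr_pdivrMr ?mulr_gt0// mul1r.
by rewrite (_ : 2 * `|x| = `|x| + `|x|)//; ring.
Qed.

(** [x - psi x *: y] is a shortest vector of its coset modulo [y]: it is no longer
    than [x], and it depends only on the coset, as [psi y = 1]. So [psi] encodes
    a linear nearest-point map onto the line of [y]. *)
Definition linear_nearest (K : numFieldType) (V : normedModType K) (y : V) :=
  exists psi : V -> K, [/\ scalar psi, psi y = 1 & forall x, `|x - psi x *: y| <= `|x|].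

(** The duality map of a smooth, strictly convex space. *)
Section Perp.
Variables (R : realType) (K : numFieldType) (s : RorC R K) (X : normedModType K).
Variable J : X -> X -> K.
Hypotheses (J_norming : forall x, norming x (J x))
  (J_uniq : forall x phi, x != 0 -> norming x phi -> phi = J x)
  (J0 : forall v, J 0 v = 0).
Hypothesis X_sconvex : strictly_convex X.

(** [J h y = 0] says that [h] is Birkhoff orthogonal to [y], and the kernel of
    [psi] consists of the vectors shortest in their coset. If [psi h = 0], then
    composing [J h] with the contraction [x |-> x - psi x *: y] again norms [h],
    so it is [J h]. If [J h y = 0], then [h] and [h - psi h *: y] are both
    shortest in their coset, and strict convexity makes them equal. *)
Lemma perp_linear y : y != 0 -> linear_nearest y ->
  exists2 psi : X -> K, scalar psi & forall h, J h y = 0 <-> psi h = 0.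
Proof.
move=> y0 [psi [lin psiy near]]; exists psi => // h.
have [->|h0] := eqVneq h 0; first by rewrite J0 scalar_form0.
have [Jlin Jle Jh] := J_norming h.
split=> [Jy|psih]; last first.
  have nP : norming h (fun x => J h (x - psi x *: y)).
    split=> [a u v|v|].
    - rewrite lin scalerDl -scalerA -Jlin; congr (J h _).
      by rewrite scalerBr opprD addrACA.
    - exact: le_trans (Jle _) (near _).
    - by rewrite psih scale0r subr0.
  by rewrite -(J_uniq h0 nP) psiy scale1r subrr scalar_form0.
apply/eqP; apply: contraT => psih.
pose h' := h - psi h *: y.
have Jh' : J h h' = `|h| by rewrite (scalar_formB Jlin) (scalar_formZ Jlin) Jy mulr0 subr0.
have e : `|h| = `|h'|.
  apply/le_anti; rewrite near andbT -{1}[`|h|]normr_id -Jh'; exact: Jle.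
have neq : h != h'.
  by rewrite /h' -subr_eq0 opprB addrC subrK scaler_eq0 negb_or psih.
have := strict_midpoint X_sconvex e neq.
have : `|h| + `|h| <= `|h + h'|.
  have <- : J h (h + h') = `|h| + `|h| by rewrite (scalar_formD Jlin) Jh Jh'.
  apply: le_trans (Jle _); apply: real_ler_norm.
  by rewrite (scalar_formD Jlin) Jh Jh' realD// realE normr_ge0.
by move=> /le_lt_trans/[apply]; rewrite ltxx.
Qed.

(** In coordinates [1, u] of the plane of [e] and [f], the form norming
    [e + u f] is proportional to [(1, c * t u)]; comparing its values at
    [e + v f] with the norms [n v] of these vectors gives the inequality
    [|1 + c * (v * t u)| * n u <= |1 + c * (u * t u)| * n v]. *)
Lemma planar_conj (e f : X) (t : K -> K) (c : K) :
  e != 0 -> c != 0 ->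
  (forall x y, t (x + y) = t x + t y) -> (forall x y, t (x * y) = t x * t y) -> t 1 = 1 ->
  (forall u, J (e + u *: f) f = c * t u * J (e + u *: f) e) ->
  t =1 conjK s /\ 0 < c.
Proof.
move=> e0 c0 tD tM t1 h; pose n u := rnorm s (e + u *: f).
have t0 : t 0 = 0 := additive_zero tD.
have ineq v u : rabs s (1 + c * (v * t u)) * n u <= rabs s (1 + c * (u * t u)) * n v.
  have [Jlin Jle Jn] := J_norming (e + u *: f).
  have E w : J (e + u *: f) (e + w *: f) = J (e + u *: f) e * (1 + c * (w * t u)).
    by rewrite (scalar_formD Jlin) (scalar_formZ Jlin) h; ring.
  have nu : rabs s (J (e + u *: f) e) * rabs s (1 + c * (u * t u)) = n u.
    by rewrite -rabsM -E Jn /rabs normr_id.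
  rewrite -nu mulrA [leRHS]mulrC -rabsM.
  apply: ler_wpM2r; first exact: rabs_ge0.
  by rewrite [X in rabs s X]mulrC -E /n -(ofreal_le s) ofreal_rabs ofreal_rnorm.
have n0 : 0 < n 0 by rewrite /n scale0r addr0 rnorm_gt0.
have n0_le u : n 0 <= n u by have := ineq u 0; rewrite t0 !mulr0 addr0 rabs1 !mul1r.
have ge1 d : 1 <= rabs s (1 + c * (d * t d)).
  have := ineq 0 d; rewrite !mul0r mulr0 addr0 rabs1 mul1r => /(le_trans (n0_le d)).
  by rewrite -{1}[n 0]mul1r ler_pM2r.
have tc := endo_conj c0 tD tM t1 ge1; split=> //.
apply: (@planar_coef_gt0 R K s c n (rnorm s e + rnorm s f) c0).
- exact: lt_le_trans n0 (n0_le 1).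
- by move=> z z1; apply: le_trans (rnormD _ _ _) _; rewrite rnormZ z1 realpart1 mul1r.
- by move=> u v; rewrite -!tc; exact: ineq.
- by have := ge1 1; rewrite t1 !mulr1.
Qed.

Hypothesis X_dim : has_dim 3 [set: X].
Hypothesis X_good : forall y : X, y != 0 -> linear_nearest y.

(** A three-dimensional form of the theorem of Blaschke, Kakutani and James: the
    hypothesis makes the duality map [J] a correlation of the projective plane.
    In an Auerbach basis it is diagonal, so [J h] is proportional to
    [B _ h] for a Hermitian form [B], which the norm then has to come from. *)
Theorem inner_product_of_linear_nearest : inner_product_space s X.
Proof.
have [b [b_free b_all]] := X_dim.
have b_span v : exists c : 'I_3 -> K, v = \sum_i c i *: b i.
  by have : [set: X] v by []; rewrite b_all => -[c ->]; exists c.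
have [e1 [e2 [e3 [x1 [x2 [x3 [[l1 l2 l3] [e10 e20 e30] xE]]]]]]] :=
  auerbach_of_basis s b_free b_span.
move=> [[x11 x21 x31] [[x12 x22 x32] [x13 x23 x33]]] [d1 d2 d3].
pose pt (a b c : K) := a *: e1 + b *: e2 + c *: e3.
have x1pt a b' c : x1 (pt a b' c) = a.
  by rewrite !(scalar_formD l1) !(scalar_formZ l1) x11 x12 x13; ring.
have x2pt a b' c : x2 (pt a b' c) = b'.
  by rewrite !(scalar_formD l2) !(scalar_formZ l2) x21 x22 x23; ring.
have x3pt a b' c : x3 (pt a b' c) = c.
  by rewrite !(scalar_formD l3) !(scalar_formZ l3) x31 x32 x33; ring.
have Jpt h a b' c : J h (pt a b' c) = a * J h e1 + b' * J h e2 + c * J h e3.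
  have [Jlin _ _] := J_norming h.
  by rewrite !(scalar_formD Jlin) !(scalar_formZ Jlin).
have ptD a b' c a' b'' c' : pt (a + a') (b' + b'') (c + c') = pt a b' c + pt a' b'' c'.
  by rewrite /pt !scalerDl [RHS]addrACA; congr (_ + _); rewrite addrACA.
have ptZ k a b' c : pt (k * a) (k * b') (k * c) = k *: pt a b' c.
  by rewrite /pt !scalerDr !scalerA.
have JE e x (l : scalar x) (d : forall v, rabs s (x v) * rnorm s e <= rnorm s v) :
    e != 0 -> x e = 1 -> forall v, J e v = ofreal s (rnorm s e) * x v.
  move=> e0 xe v; rewrite -(J_uniq (phi := fun v => ofreal s (rnorm s e) * x v) e0)//.
  split=> [a u w|w|].
  - by rewrite l mulrDr mulrCA.
  - rewrite -(rabs_rnorm s) rabsM rabs_ofreal ger0_norm ?rnorm_ge0// mulrC; exact: d.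
  - by rewrite xe mulr1 ofreal_rnorm.
pose j e a b' c := J (pt a b' c) e.
have pt1 : pt 1 0 0 = e1 by rewrite /pt scale1r !scale0r !addr0.
have pt2 : pt 0 1 0 = e2 by rewrite /pt scale1r !scale0r addr0 add0r.
have pt3 : pt 0 0 1 = e3 by rewrite /pt scale1r !scale0r !add0r.
have perp y1 y2 y3 : exists2 psi : X -> K, scalar psi &
    forall h, y1 * J h e1 + y2 * J h e2 + y3 * J h e3 = 0 <-> psi h = 0.
  have [e|y0] := eqVneq (pt y1 y2 y3) 0.
    exists (fun=> 0) => [a u v|h]; first by rewrite mulr0 addr0.
    split=> // _; rewrite -Jpt e; have [Jlin _ _] := J_norming h; exact: scalar_form0.
  have [psi lin psiE] := perp_linear y0 (X_good y0).
  by exists psi => // h; rewrite -Jpt.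
have [t [b2 [b3 [[b20 b30 tD tM t1] rel]]]] :
  exists (t : K -> K) (b2 b3 : K),
  [/\ b2 != 0, b3 != 0, (forall x y, t (x + y) = t x + t y),
      (forall x y, t (x * y) = t x * t y) & t 1 = 1] /\
  forall a b c, [/\ t a * j e2 a b c = b2 * t b * j e1 a b c,
    t a * j e3 a b c = b3 * t c * j e1 a b c &
    b2 * t b * j e3 a b c = b3 * t c * j e2 a b c].
  apply: correlation_coordinates.
  - move=> y1 y2 y3 a b' c a' b'' c'; have [psi lin psiE] := perp y1 y2 y3.
    move=> /psiE h /psiE h'; apply/psiE.
    by rewrite ptD (scalar_formD lin) h h' addr0.
  - move=> y1 y2 y3 k a b' c; have [psi lin psiE] := perp y1 y2 y3.
    by move=> /psiE h; apply/psiE; rewrite ptZ (scalar_formZ lin) h mulr0.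
  - move=> a b' c; rewrite -Jpt; have [_ _ ->] := J_norming (pt a b' c).
    move=> /normr0_eq0 z.
    have := congr1 x1 z; rewrite x1pt (scalar_form0 l1) => ->.
    have := congr1 x2 z; rewrite x2pt (scalar_form0 l2) => ->.
    by have := congr1 x3 z; rewrite x3pt (scalar_form0 l3) => ->.
  - by rewrite /j pt1 (JE _ _ l1 d1)// x12 mulr0.
  - by rewrite /j pt1 (JE _ _ l1 d1)// x13 mulr0.
  - by rewrite /j pt2 (JE _ _ l2 d2)// x21 mulr0.
  - by rewrite /j pt2 (JE _ _ l2 d2)// x23 mulr0.
  - by rewrite /j pt3 (JE _ _ l3 d3)// x31 mulr0.
  - by rewrite /j pt3 (JE _ _ l3 d3)// x32 mulr0.
have [tc b2p] : t =1 conjK s /\ 0 < b2.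
  apply: (planar_conj (e := e1) (f := e2)) => // u.
  by have [] := rel 1 u 0; rewrite t1 mul1r /j /pt scale1r scale0r addr0.
have [_ b3p] : t =1 conjK s /\ 0 < b3.
  apply: (planar_conj (e := e1) (f := e3)) => // u.
  by have [_] := rel 1 0 u; rewrite t1 mul1r /j /pt scale1r scale0r addr0.
pose B g h := x1 g * conjK s (x1 h) + b2 * (x2 g * conjK s (x2 h)) + b3 * (x3 g * conjK s (x3 h)).
have BP a u v w : B (a *: u + v) w = a * B u w + B v w.
  by rewrite /B l1 l2 l3; ring.
have bc k : 0 < k -> conjK s k = k.
  by move=> k0; rewrite -[k](ofreal_realpart s) ?ltW// conjK_ofreal.
have Bh u v : B v u = conjK s (B u v).
  rewrite /B !(conjKD, conjKM) !conjKK (bc _ b2p) (bc _ b3p); ring.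
have Bp u : u != 0 -> 0 < B u u.
  move=> u0; rewrite /B !mulr_conjK lt0r.
  rewrite !addr_ge0 ?mulr_ge0 ?exprn_ge0 ?(ltW b2p) ?(ltW b3p)// andbT.
  apply: contra u0; rewrite !paddr_eq0 ?addr_ge0 ?mulr_ge0 ?exprn_ge0 ?(ltW b2p) ?(ltW b3p)//.
  rewrite !mulf_eq0 (negbTE b20) (negbTE b30) /= !orbb !normr_eq0.
  by move=> /andP[/andP[/eqP h1 /eqP h2] /eqP h3]; rewrite (xE u) h1 h2 h3 !scale0r !addr0.
have proj g h : rabs s (B g h) * rnorm s h <= realpart s (B h h) * rnorm s g.
  have [Jlin Jle Jn] := J_norming h.
  have [r12 r13 r23] := rel (x1 h) (x2 h) (x3 h).
  rewrite !tc /j /pt -xE in r12 r13 r23.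
  have Jg v : J h v = x1 v * J h e1 + x2 v * J h e2 + x3 v * J h e3.
    by rewrite {1}(xE v) Jpt.
  (* The difference of the two sides is a combination of the proportions r12,
     r13 and r23. *)
  have E : J h g * B h h = B g h * J h h.
    apply/eqP; rewrite -subr_eq0; apply/eqP; rewrite /B (Jg g) (Jg h).
    transitivity ((x2 g * x1 h - x1 g * x2 h) *
        (conjK s (x1 h) * J h e2 - b2 * conjK s (x2 h) * J h e1)
      + (x3 g * x1 h - x1 g * x3 h) *
        (conjK s (x1 h) * J h e3 - b3 * conjK s (x3 h) * J h e1)
      + (x3 g * x2 h - x2 g * x3 h) *
        (b2 * conjK s (x2 h) * J h e3 - b3 * conjK s (x3 h) * J h e2)); first by ring.
    by rewrite r12 r13 r23 !subrr !mulr0 !addr0.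
  have Bhh : rabs s (B h h) = realpart s (B h h).
    rewrite /rabs ger0_norm//; have [->|/Bp/ltW//] := eqVneq h 0.
    by rewrite /B (scalar_form0 l1) (scalar_form0 l2) (scalar_form0 l3) !mul0r !mulr0 !addr0.
  rewrite -Bhh; have := congr1 (rabs s) E; rewrite !rabsM Jn.
  have -> : rabs s `|h| = rnorm s h by rewrite /rabs normr_id.
  move=> <-; rewrite mulrC ler_wpM2l ?rabs_ge0//.
  by rewrite -(ofreal_le s) ofreal_rabs ofreal_rnorm.
have [k k0 kE] := norm_of_projection_le BP Bh Bp proj e10.
pose ip x y := ofreal s k * B x y.
have ipP a u v w : ip (a *: u + v) w = a * ip u w + ip v w by rewrite /ip BP; ring.
have ip_herm u v : ip v u = conjK s (ip u v) by rewrite /ip conjKM conjK_ofreal -Bh.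
have ip_pos u : u != 0 -> 0 < ip u u.
  by move=> u0; rewrite mulr_gt0 ?Bp// -(ofreal0 s) ofreal_lt.
have conjN1 : conjK s (-1) = -1 by rewrite -(ofreal1 s) -ofrealN conjK_ofreal.
have ipBl w : zmod_morphism (ip^~ w).
  by move=> u v; rewrite addrC -scaleN1r ipP mulN1r addrC.
have ipZl w : scalable_for *%R (ip^~ w).
  by move=> a u; rewrite -[a *: u]addr0 ipP -[X in _ + ip X w](subrr 0) ipBl subrr addr0.
have ipBr w : zmod_morphism (ip w).
  move=> u v; rewrite ip_herm ipBl conjKD -ip_herm; congr (_ + _).
  by rewrite -mulN1r conjKM -ip_herm conjN1 mulN1r.
have ipZr w : scalable_for (conjK s \; *%R) (ip w).
  by move=> a u /=; rewrite ip_herm ipZl conjKM -ip_herm.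
have ip_sym x y : ip x y = (-1) ^+ false * conjK s (ip y x) by rewrite expr0 mul1r.
pose D : {dot X for conjK s} := HB.pack ip
  (isBilinear.Build K X X K *%R (conjK s \; *%R) ip ipBl ipBr ipZl ipZr)
  (isHermitianSesquilinear.Build K X false (conjK s) ip ip_sym)
  (isDotProduct.Build K X ip ip_pos).
exists D => x; rewrite -[D x x]/(ip x x) -(ofreal_rnorm s) expr2 -ofrealM -expr2 kE ofrealM.
rewrite ofreal_realpart//; have [->|/Bp/ltW//] := eqVneq x 0.
by rewrite /B (scalar_form0 l1) (scalar_form0 l2) (scalar_form0 l3) !mul0r !mulr0 !addr0.
Qed.

End Perp.

(** * The quotient by a line *)

Section Line.
Variables (R : realType) (K : numFieldType) (s : RorC R K) (X : normedModType K).
Variable y : X.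
Hypothesis y0 : y != 0.

(** Outside the disc of radius [2 |x| / |y|] the distance exceeds [|x|], its value
    at [t = 0]; so a minimum over that compact disc is a global one. *)
Lemma nearest_exists (x : X) : exists t0 : K, forall t, `|x - t0 *: y| <= `|x - t *: y|.
Proof.
pose r := 2 * rnorm s x / rnorm s y; pose f t := rnorm s (x - t *: y).
have ny : 0 < rnorm s y by rewrite rnorm_gt0.
have cf : continuous f.
  move=> t; apply: (@continuous_comp K X R (fun t => x - t *: y) (@rnorm R K s X)).
    exact: (cvgB (cvg_cst x) (@cvgZr_tmp K X _ (nbhs t) _ id _ y (@cvg_id _ (nbhs t)))).
  exact: rnorm_continuous.
have [|t0 _ mt] := compact_EVT_min _ (compact_disc (s := s) (r := r)) (continuous_subspaceT cf).
  by exists 0; rewrite /= rabs_zero divr_ge0 ?mulr_ge0 ?rnorm_ge0.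
exists t0 => t; rewrite -(rnorm_le s) -/(f t) -/(f t0).
have [tr|rt] := leP (rabs s t) r; first by apply: mt; rewrite inE.
apply: (@le_trans _ _ (f 0)).
  by apply: mt; rewrite inE /= rabs_zero divr_ge0 ?mulr_ge0 ?rnorm_ge0.
rewrite /f scale0r subr0; move: rt; rewrite /r ltr_pdivrMr// => rt.
have : rabs s t * rnorm s y <= rnorm s x + rnorm s (x - t *: y).
  rewrite /rabs -rnormZ -(rnormN s (x - _)) opprB.
  by rewrite -{1}(subrK x (t *: y)) addrC rnormD.
lra.
Qed.

Definition line : {pred X} := fun x => `[< exists t, x = t *: y >].

Lemma lineP x : reflect (exists t, x = t *: y) (x \in line).
Proof. exact: asboolP. Qed.

Lemma line_submod : submod_closed line.
Proof.
split=> [|k u v /lineP[a ->] /lineP[b ->]]; apply/lineP; first by exists 0; rewrite scale0r.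
by exists (k * a + b); rewrite scalerDl scalerA.
Qed.

Lemma line_closed : closed [set` line].
Proof.
move=> x cx; have [t0 mt] := nearest_exists x.
have [e|xt] := eqVneq (x - t0 *: y) 0.
  by apply/lineP; exists t0; apply/eqP; rewrite -subr_eq0 e.
have [|z [/lineP[t ->]]] := cx (ball x `|x - t0 *: y|).
  by apply: nbhsx_ballx; rewrite normr_gt0.
rewrite -ball_normE /= => lt.
by have := le_lt_trans (mt t) lt; rewrite ltxx.
Qed.

Definition line_subspace : closedSubspace X := ClosedSubspace line_submod line_closed.

Lemma line_dim : has_dim 1 [set` line_subspace].
Proof.
exists (fun=> y); split=> [c|].
  rewrite big_ord1 => /eqP; rewrite scaler_eq0 (negbTE y0) orbF => /eqP h i.
  by rewrite (ord1 i).
apply/seteqP; split=> x /=.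
  by move=> /lineP[t ->]; exists (fun=> t); rewrite big_ord1.
by move=> [c ->]; apply/lineP; exists (c ord0); rewrite big_ord1.
Qed.

Local Notation W := (quotient_space s line_subspace).
Local Notation pi := (@quotient_pi R K s X line_subspace).

Lemma quotient_line_eq0 x : pi x = 0 <-> exists t, x = t *: y.
Proof.
rewrite -(quotient_pi0 s line_subspace); split.
  by move=> /quotient_piP; rewrite subr0 => /lineP.
by move=> h; apply/quotient_piP; rewrite subr0; apply/lineP.
Qed.

Lemma quotient_line_lift : exists sigma : W -> X,
  forall w, pi (sigma w) = w /\ `|sigma w| = `|w|.
Proof.
suff ex (w : W) : exists x, pi x = w /\ `|x| = `|w|.
  by exists (fun w => sval (cid (ex w))) => w; case: (cid _).
have [x0 <-] := quotient_pi_surj w; have [t0 mt] := nearest_exists x0.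
exists (x0 - t0 *: y).
have e : pi (x0 - t0 *: y) = pi x0.
  apply/quotient_piP; rewrite addrAC subrr add0r -scaleNr.
  by apply/lineP; exists (- t0).
split=> //; rewrite -(ofreal_rnorm s) -[RHS](ofreal_rnorm s); congr ofreal.
rewrite (@rnorm_quotient R K s X line_subspace).
apply/le_anti; rewrite -{2}e quotient_norm_le andbT.
apply/ler_addgt0Pr => d d0.
have [x px /ltW] := quotient_norm_adherent (pi x0) d0; apply: le_trans.
move/esym/quotient_piP: px => /lineP[t xt].
by rewrite rnorm_le; have -> : x = x0 - t *: y; [rewrite -xt subKr|exact: mt].
Qed.

End Line.

Section Birkhoff.
Variables (R : realType) (K : numFieldType) (s : RorC R K) (X : normedModType K).
Variables (n : nat) (b : 'I_n -> X).
Hypothesis b_free : forall c : 'I_n -> K, \sum_i c i *: b i = 0 -> forall i, c i = 0.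
Hypothesis b_span : forall v, exists c : 'I_n -> K, v = \sum_i c i *: b i.
Hypothesis X_smooth : norm_smooth X.

(** The coefficient vectors of the forms of norm at most 1. *)
Let ball_dual : set 'rV[K]_n :=
  [set c | forall u : 'I_n -> K, rabs s (\sum_i c 0 i * u i) <= rnorm s (\sum_i u i *: b i)].

Let form_cts (u : 'I_n -> K) : continuous (fun c : 'rV[K]_n => \sum_i c 0 i * u i).
Proof.
have E r : continuous (fun c : 'rV[K]_n => \sum_(i <- r) c 0 i * u i).
  elim: r => [|i r IHr].
    have -> : (fun c : 'rV[K]_n => \sum_(i <- [::]) c 0 i * u i) = fun=> 0.
      by apply/funext => c; rewrite big_nil.
    exact: cst_continuous.
  have -> : (fun c : 'rV[K]_n => \sum_(k <- i :: r) c 0 k * u k) =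
      fun c => c 0 i * u i + \sum_(k <- r) c 0 k * u k.
    by apply/funext => c; rewrite big_cons.
  move=> c; exact: (cvgD (cvgM (@coord_continuous K 1 n 0 i c) (cvg_cst (u i))) (IHr c)).
exact: E.
Qed.

Let ball_dual_compact : compact ball_dual.
Proof.
have cb := @rV_compact K n (fun i => [set k | rabs s k <= rnorm s (b i)])
  (fun i => compact_disc (s := s) (r := rnorm s (b i))).
apply: subclosed_compact cb _.
  rewrite (_ : ball_dual = \bigcap_(u in [set: 'I_n -> K])
      [set c : 'rV[K]_n | rabs s (\sum_i c 0 i * u i) <= rnorm s (\sum_i u i *: b i)]); last first.
    by apply/seteqP; split=> c /= h u; [move=> _; exact: h|exact: h u I].
  apply: closed_bigI => u _.
  apply: (@closed_comp _ R (fun c : 'rV[K]_n => rabs s (\sum_i c 0 i * u i))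
    [set x | x <= rnorm s (\sum_i u i *: b i)]); last exact: closed_le.
  move=> c _; apply: (@continuous_comp _ K R (fun c : 'rV[K]_n => \sum_i c 0 i * u i) (rabs s)).
    exact: form_cts.
  exact: rabs_continuous.
move=> c h i /=; have := h (fun j => (j == i)%:R).
rewrite (bigD1 i)//= eqxx mulr1 big1 ?addr0 => [|j /negbTE ->]; last by rewrite mulr0.
by rewrite (bigD1 i)//= eqxx scale1r big1 ?addr0 => [|j /negbTE ->]; last by rewrite scale0r.
Qed.

Let form_of_scalar phi : scalar phi -> forall u : 'I_n -> K,
  \sum_i (\row_i phi (b i)) 0 i * u i = phi (\sum_i u i *: b i).
Proof.
move=> lin u; rewrite scalar_form_sum//; apply: eq_bigr => i _.
by rewrite mxE scalar_formZ// mulrC.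
Qed.

(** If moving from [x] in the direction [- y] never shortens the vector, the
    functionals norming [x - t y] are nonpositive at [y], and so is their limit
    as [t] tends to 0, which norms [x]. *)
Lemma norming_le0 (x y : X) (phi : X -> K) : x != 0 ->
  (forall r, 0 < r -> rnorm s x <= rnorm s (x - ofreal s r *: y)) ->
  norming x phi -> realpart s (phi y) <= 0.
Proof.
move=> x0 hxy nphi; have [J [nJ [uJ _]]] := norm_smooth_dual X_smooth.
have [[ux xE] [uy yE]] := (b_span x, b_span y).
pose S := ball_dual `&` [set c | realpart s (\sum_i c 0 i * uy i) <= 0].
have re_cts u : continuous (fun c : 'rV[K]_n => realpart s (\sum_i c 0 i * u i)).
  move=> c; apply: (@continuous_comp _ K R (fun c : 'rV[K]_n => \sum_i c 0 i * u i) (realpart s)).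
    exact: form_cts.
  exact: realpart_continuous.
have cS : compact S.
  apply: compact_closedI; first exact: ball_dual_compact.
  apply: (@closed_comp _ R (fun c : 'rV[K]_n => realpart s (\sum_i c 0 i * uy i))
    [set x | x <= 0]); last exact: closed_le.
  by move=> c _; exact: re_cts.
have near r : 0 < r -> exists2 c, S c &
    rnorm s x - r * rnorm s y <= realpart s (\sum_i c 0 i * ux i).
  move=> r0; pose z := x - ofreal s r *: y; have [lin le zn] := nJ z.
  have [re_le re_eq] := norming_realpart s (nJ z).
  have zE : realpart s (J z x) - r * realpart s (J z y) = rnorm s z.
    rewrite -re_eq -realpartZ -realpartN -realpartD; congr realpart.
    by rewrite -(scalar_formZ lin) -(scalar_formB lin).
  exists (\row_i J z (b i)).
    split=> [u|/=]; first by rewrite form_of_scalar// rabs_rnorm.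
    rewrite form_of_scalar// -yE -(pmulr_rle0 _ r0).
    by have := hxy r r0; have := re_le x; lra.
  rewrite form_of_scalar// -xE; have := hxy r r0.
  have := re_le (- y); rewrite scalar_formN// realpartN rnormN.
  by rewrite -(ler_pM2l r0); lra.
have [c0 Sc0 _] := near 1 ltr01.
have [|c Sc mc] := compact_EVT_max _ cS (continuous_subspaceT (re_cts ux)).
  by exists c0.
rewrite inE in Sc; case: Sc => dc cy.
have ex v : exists u : 'I_n -> K, v = \sum_i u i *: b i by exact: b_span.
pose crd v := sval (cid (ex v)).
have crdE v : v = \sum_i crd v i *: b i by exact: (svalP (cid (ex v))).
have crd_uniq u u' : \sum_i u i *: b i = \sum_i u' i *: b i -> u =1 u'.
  move=> e i; apply/eqP; rewrite -subr_eq0; apply/eqP.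
  apply: (b_free (c := fun i => u i - u' i)).
  under eq_bigr => k _ do rewrite scalerBl.
  by rewrite sumrB e subrr.
pose psi v := \sum_i c 0 i * crd v i.
have psiE u : psi (\sum_i u i *: b i) = \sum_i c 0 i * u i.
  apply: eq_bigr => i _; congr (_ * _); apply: crd_uniq.
  by rewrite -crdE.
have npsi : norming x psi.
  apply: (norming_of_realpart (s := s)) => [a u v|v|].
  - rewrite {1}(crdE u) {1}(crdE v) scaler_sumr -big_split /=.
    under eq_bigr => i _ do rewrite scalerA -scalerDl.
    rewrite psiE /psi mulr_sumr -big_split /=; apply: eq_bigr => i _; ring.
  - apply: le_trans (realpart_le_rabs _ _) _.
    by rewrite {2}(crdE v); exact: dc.
  apply/ler_addgt0Pr => e e0.
  have d0 : 0 < e / (rnorm s y + 1) by rewrite divr_gt0// ltr_wpDl// rnorm_ge0.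
  have [c' Sc' hc'] := near _ d0.
  have := mc c'; rewrite inE => /(_ Sc'); rewrite -psiE -xE => h.
  have : e / (rnorm s y + 1) * rnorm s y <= e.
    rewrite mulrAC ler_pdivrMr ?ltr_wpDl ?rnorm_ge0// ler_wpM2l ?(ltW e0)//.
    by rewrite lerDl.
  lra.
by rewrite (uJ _ _ x0 nphi) -(uJ _ _ x0 npsi) yE psiE.
Qed.

(** Birkhoff orthogonality in a smooth space: applied to a unimodular multiple of
    [y] for which [phi] takes a nonnegative value, the previous inequality leaves
    only zero. *)
Lemma birkhoff_orthogonal (x y : X) (phi : X -> K) : x != 0 ->
  (forall t, `|x| <= `|x - t *: y|) -> norming x phi -> phi y = 0.
Proof.
move=> x0 hxy nphi; have [u u1 e] := rotate_to_norm (phi y).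
have [lin _ _] := nphi.
have := @norming_le0 x (u *: y) phi x0 _ nphi; rewrite scalar_formZ// e => h.
apply/eqP; rewrite -(rabs_eq0 s) eq_le rabs_ge0 andbT; apply: h => r r0.
by rewrite rnorm_le scalerA; exact: hxy.
Qed.

End Birkhoff.

(** Here [pi] is a quotient map with kernel the line of [y], and [sigma] picks a
    shortest representative in each coset. *)
Section NormQuotient.
Variables (R : realType) (K : numFieldType) (s : RorC R K) (X W : normedModType K).
Variables (pi : X -> W) (sigma : W -> X) (y : X).
Hypothesis pi_linear : forall k u v, pi (k *: u + v) = k *: pi u + pi v.
Hypothesis pi_le : forall x, `|pi x| <= `|x|.
Hypothesis pi_eq0 : forall x, pi x = 0 <-> exists t, x = t *: y.
Hypothesis sigmaK : cancel sigma pi.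
Hypothesis sigma_norm : forall w, `|sigma w| = `|w|.

Let piB u v : pi (u - v) = pi u - pi v.
Proof. by rewrite addrC -scaleN1r pi_linear scaleN1r addrC. Qed.

Lemma lift_birkhoff w t : `|sigma w| <= `|sigma w - t *: y|.
Proof.
rewrite sigma_norm; apply: le_trans (pi_le _); rewrite piB sigmaK.
by rewrite (pi_eq0 (t *: y)).2 ?subr0//; exists t.
Qed.

(** Composition with [pi] and with [sigma] exchanges the functionals norming [w]
    and those norming [sigma w], because the latter vanish on [y]. *)
Lemma norm_smooth_quotient : norm_smooth X ->
  (forall x phi, x != 0 -> (forall t, `|x| <= `|x - t *: y|) -> norming x phi -> phi y = 0) ->
  norm_smooth W.
Proof.
move=> smX birk w w0; have x0 : sigma w != 0.
  by rewrite -normr_eq0 sigma_norm normr_eq0.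
have [phi [nphi uphi]] := smX _ x0.
have phiy := birk _ _ x0 (lift_birkhoff w) nphi; have [lin le eq] := nphi.
have ker x : pi x = 0 -> phi x = 0.
  by move=> /pi_eq0[t ->]; rewrite scalar_formZ// phiy mulr0.
exists (fun v => phi (sigma v)); split.
  split=> [a u v|v|]; first last.
  - by rewrite eq sigma_norm.
  - by rewrite -(sigma_norm v).
  apply/eqP; rewrite -subr_eq0 -lin -(scalar_formB lin); apply/eqP/ker.
  by rewrite piB pi_linear !sigmaK subrr.
move=> psi [plin ple pe].
suff -> : phi = psi \o pi by apply/funext => v /=; rewrite sigmaK.
apply/esym/uphi; split=> [a u v|v|] /=.
- by rewrite pi_linear plin.
- exact: le_trans (ple _) (pi_le _).
- by rewrite sigmaK pe sigma_norm.
Qed.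

Lemma linear_nearest_of_lift : y != 0 ->
  (forall k u v, sigma (k *: u + v) = k *: sigma u + sigma v) -> linear_nearest y.
Proof.
move=> y0 lin; have ex x : exists t, x - sigma (pi x) = t *: y.
  by apply/pi_eq0; rewrite piB sigmaK subrr.
pose psi x := sval (cid (ex x)).
have psiE x : x - sigma (pi x) = psi x *: y by exact: (svalP (cid (ex x))).
have inj a b : a *: y = b *: y -> a = b.
  by move=> /eqP; rewrite -subr_eq0 -scalerBl scaler_eq0 (negbTE y0) orbF subr_eq0 => /eqP.
exists psi; split=> [a u v||x].
- apply: inj; rewrite scalerDl -scalerA -!psiE pi_linear lin opprD scalerBr.
  by rewrite addrACA.
- apply: inj; rewrite -psiE scale1r (pi_eq0 y).2; last by exists 1; rewrite scale1r.
  suff -> : sigma 0 = 0 by rewrite subr0.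
  by apply/eqP; rewrite -normr_eq0 sigma_norm normr0.
- by rewrite -psiE subKr sigma_norm.
Qed.

End NormQuotient.

(** * Smoothness of l_p sums *)

Section PowerInequalities.
Variables (R : realType) (p : R).
Hypothesis p1 : 1 < p.
Implicit Types a b x y e : R.

Let p_gt0 : 0 < p. Proof. exact: lt_trans p1. Qed.
Let pm1_gt0 : 0 < p - 1. Proof. by rewrite subr_gt0. Qed.

Lemma powR_pred a : 0 <= a -> a `^ (p - 1) * a = a `^ p.
Proof.
by move=> a0; rewrite mulrC mulr_powRB1.
Qed.

Lemma powR_young a b : 0 <= a -> 0 <= b ->
  a `^ (p - 1) * b <= (1 - p^-1) * a `^ p + p^-1 * b `^ p.
Proof.
move=> a0 b0; have pm0 : p - 1 != 0 by rewrite gt_eqF.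
have p0 : p != 0 by rewrite gt_eqF.
have q0 : 0 < p / (p - 1) by rewrite divr_gt0.
have := @conjugate_powR R (a `^ (p - 1)) b (p / (p - 1)) p (powR_ge0 _ _) b0 q0 p_gt0.
rewrite -powRrM (_ : (p - 1) * (p / (p - 1)) = p); last by field.
have e : (p / (p - 1))^-1 = 1 - p^-1.
  by field; apply/andP.
by rewrite e subrK => /(_ erefl); rewrite [b `^ p * _]mulrC [a `^ p * _]mulrC.
Qed.

(** Young's inequality, rearranged: convexity of the power in a form that needs
    no derivative. *)
Lemma powR_tangent x y : 0 <= x -> 0 <= y ->
  p * x `^ (p - 1) * (y - x) <= y `^ p - x `^ p.
Proof.
move=> x0 y0; have := powR_young x0 y0; have p0 : p != 0 by rewrite gt_eqF.
move=> /(ler_wpM2l (ltW p_gt0)).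
have -> : p * ((1 - p^-1) * x `^ p + p^-1 * y `^ p) = p * x `^ p - x `^ p + y `^ p.
  by field.
by rewrite -(powR_pred x0); lra.
Qed.

Lemma powR_right_near x e : 0 <= x -> 0 < e ->
  exists2 d, 0 < d & (x + d) `^ (p - 1) <= x `^ (p - 1) + e.
Proof.
move=> x0 e0; have X0 : 0 <= x `^ (p - 1) := powR_ge0 _ _.
pose y := (x `^ (p - 1) + e) `^ (p - 1)^-1.
have yE : y `^ (p - 1) = x `^ (p - 1) + e.
  by rewrite -powRrM mulVf ?powRr1 ?gt_eqF// addr_ge0// ltW.
exists (y - x); last by rewrite addrC subrK yE.
rewrite subr_gt0 ltNge; apply/negP => yx.
have : y `^ (p - 1) <= x `^ (p - 1) by apply: ge0_ler_powR; rewrite ?nnegrE ?powR_ge0// ltW.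
by rewrite yE; lra.
Qed.

Lemma powR_left_near e : 0 < e -> e < 1 ->
  exists t, [/\ 0 < t, t < 1 & (1 - t) `^ (p - 1) = 1 - e].
Proof.
move=> e0 e1; pose y := (1 - e) `^ (p - 1)^-1.
have yE : y `^ (p - 1) = 1 - e.
  by rewrite -powRrM mulVf ?powRr1 ?gt_eqF// subr_ge0 ltW.
have y0 : 0 < y by rewrite powR_gt0// subr_gt0.
exists (1 - y); split; last by rewrite opprB addrC subrK.
  rewrite subr_gt0 ltNge; apply/negP => y1.
  have : 1 `^ (p - 1) <= y `^ (p - 1) by apply: ge0_ler_powR; rewrite ?nnegrE ?powR_ge0// ltW.
  by rewrite yE powR1; lra.
by lra.
Qed.

End PowerInequalities.

(** The l_p sums enter through one summand at a time: [i] embeds a summand [V]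
    into the sum [E], [v0] is the component of [z] there, and [D] collects the
    other summands. *)
Section LpCoordinate.
Variables (R : realType) (K : numFieldType) (s : RorC R K) (p : R).
Hypothesis p1 : 1 < p.
Variables (E V : normedModType K) (i : V -> E) (z : E) (v0 : V) (D : R).
Hypothesis i_linear : forall k u v, i (k *: u + v) = k *: i u + i v.
Hypothesis norm_split : forall u, rnorm s (z + i u) `^ p = D + rnorm s (v0 + u) `^ p.

Local Notation n := (rnorm s).

Let i0 : i 0 = 0.
Proof.
by apply: additive_zero => u v; have := i_linear 1 u v; rewrite !scale1r.
Qed.

Let iZ k u : i (k *: u) = k *: i u.
Proof. by rewrite -[k *: u]addr0 i_linear i0 addr0. Qed.

Variable phi : E -> K.
Hypothesis nphi : norming z phi.

(* Tangent inequalities for the p-th power, at [z] in the sum and at the moved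
   vector in the summand, transfer the increment of the norm to the summand. *)
Let re_tangent u t : 0 < t ->
  n z `^ (p - 1) * (t * realpart s (phi (i u))) <=
  n (v0 + ofreal s t *: u) `^ (p - 1) * (n (v0 + ofreal s t *: u) - n v0).
Proof.
move=> t0; have [lin _ _] := nphi; have [re_le re_eq] := norming_realpart s nphi.
pose a := n (v0 + ofreal s t *: u); pose M := n (z + i (ofreal s t *: u)).
have h1 : t * realpart s (phi (i u)) <= M - n z.
  have := re_le (z + i (ofreal s t *: u)); rewrite -/M (scalar_formD lin) realpartD re_eq.
  by rewrite iZ (scalar_formZ lin) realpartZ; lra.
have h2 := powR_tangent p1 (rnorm_ge0 s z) (rnorm_ge0 s (z + i (ofreal s t *: u))).
have h3 := powR_tangent p1 (rnorm_ge0 s (v0 + ofreal s t *: u)) (rnorm_ge0 s v0).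
have e1 := norm_split (ofreal s t *: u); have := norm_split 0; rewrite i0 !addr0 => e0.
have pp : 0 < p by exact: lt_trans p1.
have h4 := ler_wpM2l (powR_ge0 (n z) (p - 1)) h1.
rewrite -(ler_pM2l pp); apply: le_trans (ler_wpM2l (ltW pp) h4) _.
rewrite -/a in h3 e1 *; rewrite -/M in h2 e1.
move: h2 h3; rewrite e0 e1; nra.
Qed.

(** The limit of the preceding inequality, divided by [t], as [t] tends to 0. *)
Lemma coordinate_form_le u :
  n z `^ (p - 1) * realpart s (phi (i u)) <= n v0 `^ (p - 1) * n u.
Proof.
apply/ler_addgt0Pr => e e_gt0.
have e'0 : 0 < e / (n u + 1) by rewrite divr_gt0// ltr_wpDl ?rnorm_ge0.
have [d d0 hd] := powR_right_near p1 (rnorm_ge0 s v0) e'0.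
pose t := d / (n u + 1); have t0 : 0 < t by rewrite divr_gt0// ltr_wpDl ?rnorm_ge0.
have tu : t * n u <= d.
  by rewrite mulrAC ler_pdivrMr ?ltr_wpDl ?rnorm_ge0// ler_wpM2l ?(ltW d0)// lerDl.
have a_le : n (v0 + ofreal s t *: u) <= n v0 + t * n u.
  by apply: le_trans (rnormD _ _ _) _; rewrite rnorm_real ger0_norm ?(ltW t0).
have pow_le : n (v0 + ofreal s t *: u) `^ (p - 1) <= n v0 `^ (p - 1) + e / (n u + 1).
  apply: le_trans hd; apply: ge0_ler_powR; rewrite ?nnegrE ?rnorm_ge0 ?subr_ge0 ?(ltW p1)//.
    by rewrite addr_ge0 ?rnorm_ge0 ?ltW.
  by apply: le_trans a_le _; rewrite lerD2l.
have h : n z `^ (p - 1) * realpart s (phi (i u)) <=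
    n (v0 + ofreal s t *: u) `^ (p - 1) * n u.
  rewrite -(ler_pM2l t0); have := re_tangent u t0; rewrite mulrCA => h.
  apply: le_trans h _; rewrite mulrCA ler_wpM2l ?powR_ge0//; lra.
apply: le_trans h _; apply: le_trans (ler_wpM2r (rnorm_ge0 s u) pow_le) _.
rewrite mulrDl lerD2l mulrAC ler_pdivrMr ?ltr_wpDl ?rnorm_ge0//.
by rewrite ler_wpM2l ?(ltW e_gt0)// lerDl.
Qed.

(** The same limit in the direction [- v0], where the norm of the summand
    decreases linearly. *)
Lemma coordinate_form_self : n v0 `^ p <= n z `^ (p - 1) * realpart s (phi (i v0)).
Proof.
have [lin _ _] := nphi.
have h e : 0 < e -> e < 1 -> (1 - e) * n v0 `^ p <= n z `^ (p - 1) * realpart s (phi (i v0)).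
  move=> e_gt0 e1; have [t [t0 t1 te]] := powR_left_near p1 e_gt0 e1.
  have := re_tangent (- v0) t0; rewrite scalerN.
  have -> : v0 - ofreal s t *: v0 = ofreal s (1 - t) *: v0.
    by rewrite ofrealD ofreal1 ofrealN scalerBl scale1r.
  rewrite rnorm_real ger0_norm ?subr_ge0 ?(ltW t1)// powRM ?subr_ge0 ?(ltW t1) ?rnorm_ge0// te.
  have -> : phi (i (- v0)) = - phi (i v0) by rewrite -scaleN1r iZ scaleN1r scalar_formN.
  rewrite realpartN -(powR_pred p1 (rnorm_ge0 s v0)) => hh.
  rewrite -(ler_pM2l t0); move: hh; lra.
apply/ler_addgt0Pr => e e_gt0.
have P0 : 0 <= n v0 `^ p := powR_ge0 _ _.
pose d := Num.min (1 / 2) (e / (n v0 `^ p + 1)).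
have d0 : 0 < d by rewrite lt_min divr_gt0//= divr_gt0// ltr_wpDl.
have d1 : d < 1 by rewrite gt_min; apply/orP; left; lra.
have de : d * n v0 `^ p <= e.
  have : d <= e / (n v0 `^ p + 1) by rewrite ge_min lexx orbT.
  rewrite ler_pdivlMr ?ltr_wpDl//; have := ltW d0; lra.
have := h d d0 d1; lra.
Qed.

End LpCoordinate.

(** The two preceding estimates say that [phi \o i], rescaled, norms [v0]; if
    [v0 = 0], then it vanishes. Either way it is determined by smoothness of
    [V]. *)
Lemma coordinate_form_uniq (R : realType) (K : numFieldType) (s : RorC R K) (p : R)
    (E V : normedModType K) (i : V -> E) (z : E) (v0 : V) (D : R) :
  1 < p -> (forall k u v, i (k *: u + v) = k *: i u + i v) ->
  (forall u, rnorm s (z + i u) `^ p = D + rnorm s (v0 + u) `^ p) ->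
  z != 0 -> norm_smooth V ->
  forall phi psi, norming z phi -> norming z psi -> forall u, phi (i u) = psi (i u).
Proof.
move=> p1 lin_i split_i z0 smV phi psi nphi npsi u.
have nz : 0 < rnorm s z `^ (p - 1) by rewrite powR_gt0// rnorm_gt0.
have [v00|v0n] := eqVneq v0 0.
  have zero f : norming z f -> f (i u) = 0.
    move=> nf; have [lin _ _] := nf; have [w w1 e] := rotate_to_norm (f (i u)).
    have := coordinate_form_le p1 lin_i split_i nf (w *: u).
    rewrite v00 rnorm0 powR0 ?gt_eqF ?subr_gt0// mul0r.
    have -> : i (w *: u) = w *: i u.
      have i0 : i 0 = 0.
        by apply: additive_zero => a b; have := lin_i 1 a b; rewrite !scale1r.
      by rewrite -[w *: u]addr0 lin_i i0 addr0.
    rewrite (scalar_formZ lin) e pmulr_rle0// -/(rabs s _) => h.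
    by apply/eqP; rewrite -(rabs_eq0 s) eq_le h rabs_ge0.
  by rewrite !zero.
have nv : 0 < rnorm s v0 `^ (p - 1) by rewrite powR_gt0// rnorm_gt0.
pose c := rnorm s z `^ (p - 1) / rnorm s v0 `^ (p - 1).
have c0 : 0 < c by rewrite divr_gt0.
have key f : norming z f -> norming v0 (fun u => ofreal s c * f (i u)).
  move=> nf; have [lin _ _] := nf; apply: (norming_of_realpart (s := s)).
  - by move=> k a b; rewrite lin_i (scalar_formD lin) (scalar_formZ lin); ring.
  - move=> v; rewrite realpartZ /c mulrAC ler_pdivrMr// [leRHS]mulrC.
    exact (coordinate_form_le p1 lin_i split_i nf v).
  rewrite realpartZ /c mulrAC ler_pdivlMr// mulrC powR_pred ?rnorm_ge0//.
  exact (coordinate_form_self p1 lin_i split_i nf).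
have [f [_ uf]] := smV _ v0n.
have := congr1 (fun g => g u) (etrans (uf _ (key _ nphi)) (esym (uf _ (key _ npsi)))).
by move=> /= /mulfI; apply; rewrite -(ofreal0 s) (inj_eq (@ofreal_inj _ _ s)) gt_eqF.
Qed.

Lemma seq_lim_uniq (R : realType) (u : nat -> R) (l l' : R) :
  u m @[m --> \oo] --> l -> u m @[m --> \oo] --> l' -> l = l'.
Proof. by move=> h h'; rewrite -(cvg_lim _ h)// -(cvg_lim _ h'). Qed.

Section LpSmooth.
Variables (R : realType) (K : numFieldType) (s : RorC R K) (p : R) (p1 : 1 < p).

Let p_gt0 : 0 < p. Proof. exact: lt_trans p1. Qed.
Let p_neq0 : p != 0. Proof. by rewrite gt_eqF. Qed.

Let powR_div (x y : R) : 0 <= x -> 0 < y -> (x / y) `^ p = x `^ p / y `^ p.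
Proof.
move=> x0 y0; apply: (canRL (mulfK _)); first by rewrite gt_eqF// powR_gt0.
by rewrite -powRM ?divr_ge0 ?(ltW y0)// divfK// gt_eqF.
Qed.

(* Young's inequality for the normalised numbers [a / N] and [b / M]. *)
Let hoelder_term (a b N M : R) : 0 <= a -> 0 <= b -> 0 < N -> 0 < M ->
  (a / N) `^ (p - 1) * b <=
  M * (1 - p^-1) / N `^ p * a `^ p + M * p^-1 / M `^ p * b `^ p.
Proof.
move=> a0 b0 N0 M0.
have := powR_young p1 (divr_ge0 a0 (ltW N0)) (divr_ge0 b0 (ltW M0)).
rewrite -(ler_pM2l M0) !powR_div//.
have -> : M * ((a / N) `^ (p - 1) * (b / M)) = (a / N) `^ (p - 1) * b.
  by rewrite mulrCA [b / M]mulrC mulVKf ?gt_eqF.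
by move=> h; apply: le_trans h _; rewrite le_eqVlt; apply/orP; left; apply/eqP; ring.
Qed.

Let hoelder_total (N M : R) : 0 < N -> 0 < M ->
  M * (1 - p^-1) / N `^ p * N `^ p + M * p^-1 / M `^ p * M `^ p = M.
Proof.
move=> N0 M0; rewrite !divfK ?gt_eqF ?powR_gt0//.
by rewrite -mulrDr subrK mulr1.
Qed.

Let dual_self (a N : R) : 0 <= a -> 0 < N ->
  (a / N) `^ (p - 1) * a = N / N `^ p * a `^ p.
Proof.
move=> a0 N0; have -> : (a / N) `^ (p - 1) * a = (a / N) `^ (p - 1) * (a / N) * N.
  by rewrite -mulrA divfK// gt_eqF.
rewrite powR_pred ?divr_ge0 ?(ltW N0)// powR_div//.
by rewrite mulrC [a `^ p / _]mulrC mulrA.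
Qed.

Let hoelder_pair (a a' b b' r r' N M : R) : 0 <= a -> 0 <= a' -> 0 <= b -> 0 <= b' ->
  0 < N -> 0 < M -> N `^ p = a `^ p + a' `^ p -> M `^ p = b `^ p + b' `^ p ->
  r <= b -> r' <= b' -> (a / N) `^ (p - 1) * r + (a' / N) `^ (p - 1) * r' <= M.
Proof.
move=> a0 a'0 b0 b'0 N0 M0 eN eM rb rb'.
rewrite -[leRHS](hoelder_total N0 M0) {2}eN {2}eM.
have h := hoelder_term a0 b0 N0 M0; have h' := hoelder_term a'0 b'0 N0 M0.
move: h h'; set A := _ / N `^ p; set B := _ / M `^ p => h h'.
rewrite (mulrDr A) (mulrDr B) addrACA.
apply: lerD.
  by apply: le_trans h; rewrite ler_wpM2l ?powR_ge0.
by apply: le_trans h'; rewrite ler_wpM2l ?powR_ge0.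
Qed.

Let dual_pair_self (a a' N : R) : 0 <= a -> 0 <= a' -> 0 < N -> N `^ p = a `^ p + a' `^ p ->
  (a / N) `^ (p - 1) * a + (a' / N) `^ (p - 1) * a' = N.
Proof.
move=> a0 a'0 N0 eN; rewrite !dual_self// -mulrDr -eN divfK//.
by rewrite gt_eqF// powR_gt0.
Qed.

Section Pair.
Variables U V : normedModType K.
Local Notation P := (lp_pair s p1 U V : normedModType K).

Lemma rnorm_lp_pairX (z : P) :
  rnorm s z `^ p = rnorm s z.1 `^ p + rnorm s z.2 `^ p.
Proof. by rewrite rnorm_lp_pair powRVK// addr_ge0 ?powR_ge0. Qed.

(** Uniqueness holds on each summand. Existence is the equality case of
    Hoelder's inequality: norm the two components and weight them by
    [(|z_i| / |z|)^(p - 1)]. *)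
Lemma norm_smooth_lp_pair : norm_smooth U -> norm_smooth V -> norm_smooth P.
Proof.
move=> smU smV z z0; pose N := rnorm s z; have N0 : 0 < N by rewrite /N rnorm_gt0.
have [J1 [nJ1 _]] := norm_smooth_dual smU; have [J2 [nJ2 _]] := norm_smooth_dual smV.
pose c1 := (rnorm s z.1 / N) `^ (p - 1); pose c2 := (rnorm s z.2 / N) `^ (p - 1).
have [[lin1 _ _] [lin2 _ _]] := (nJ1 z.1, nJ2 z.2).
have [le1 eq1] := norming_realpart s (nJ1 z.1).
have [le2 eq2] := norming_realpart s (nJ2 z.2).
have nphi : norming z (fun x : P => ofreal s c1 * J1 z.1 x.1 + ofreal s c2 * J2 z.2 x.2).
  apply: (norming_of_realpart (s := s)) => [a u v|y|] /=.
  - by rewrite lin1 lin2; ring.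
  - rewrite realpartD !realpartZ; have [->|x0] := eqVneq y 0.
      by rewrite /= (scalar_form0 lin1) (scalar_form0 lin2) realpart0 !mulr0 addr0 rnorm_ge0.
    have M0 : 0 < rnorm s y by rewrite rnorm_gt0.
    by apply: (hoelder_pair (b := rnorm s y.1) (b' := rnorm s y.2));
      rewrite ?rnorm_ge0 ?rnorm_lp_pairX.
  by rewrite realpartD !realpartZ eq1 eq2 dual_pair_self ?rnorm_ge0 ?rnorm_lp_pairX.
move: nphi; set phi := (fun _ => _) => nphi; exists phi; split=> // psi npsi.
apply/esym/funext => x; have [lphi _ _] := nphi; have [lpsi _ _] := npsi.
have xE : x = ((x.1, 0) : P) + ((0, x.2) : P) by case: x => a b; congr pair; rewrite ?addr0 ?add0r.
rewrite xE (scalar_formD lphi) (scalar_formD lpsi); congr (_ + _).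
  apply: (@coordinate_form_uniq R K s p P U (fun u => (u, 0)) z z.1 (rnorm s z.2 `^ p)) => //.
    by move=> k u v; rewrite -[RHS]/(k *: u + v, k *: (0 : V) + 0) scaler0 addr0.
  by move=> u; rewrite rnorm_lp_pairX /= addr0 addrC.
apply: (@coordinate_form_uniq R K s p P V (fun u => (0, u)) z z.2 (rnorm s z.1 `^ p)) => //.
  by move=> k u v; rewrite -[RHS]/(k *: (0 : U) + 0, k *: u + v) scaler0 addr0.
by move=> u; rewrite rnorm_lp_pairX /= addr0.
Qed.

End Pair.

Section Seq.
Variable V : normedModType K.
Local Notation L := (lp_seq s p1 V : normedModType K).
Local Notation n := (rnorm s).

Lemma lp_seqP (k : K) (x y : L) j : (k *: x + y) j = k *: x j + y j.
Proof. by []. Qed.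

Lemma rnorm_lp_seqX (x : L) :
  series (fun j => n (x j) `^ p) m @[m --> \oo] --> n x `^ p.
Proof.
rewrite rnorm_lp_seq lp_sum_normX//; last exact: lp_seq_summable.
exact: lp_seq_summable.
Qed.

Lemma cvg_series_change (u v : nat -> R) k (l : R) : (forall j, j != k -> u j = v j) ->
  series u m @[m --> \oo] --> l -> series v m @[m --> \oo] --> l + (v k - u k).
Proof.
move=> uv ul; have E : \forall m \near \oo, series u m + (v k - u k) = series v m.
  near=> m; have km : (k < m)%N by near: m; exists k.+1.
  rewrite /series /= !big_mkord (bigD1 (Ordinal km))//= [RHS](bigD1 (Ordinal km))//=.
  rewrite addrAC addrCA subrr addr0; congr (_ + _); apply: eq_bigr => i ik.
  by apply: uv; apply: contra ik => /eqP e; apply/eqP/val_inj.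
apply: cvg_trans (near_eq_cvg E) _.
exact: (cvgD ul (cvg_cst (v k - u k))).
Unshelve. all: by end_near.
Qed.

Let single_val k (u : V) : nat -> V := fun j => if j == k then u else 0.

Let single_valP k u : single_val k u \in lp_finite s p V.
Proof.
apply/asboolP.
have z : series (fun=> 0 : R) m @[m --> \oo] --> (0 : R).
  have -> : series (fun=> 0 : R) = fun=> 0.
    by apply/funext => m; rewrite /series /= big1.
  exact: cvg_cst.
have := @cvg_series_change _ (fun j => n (single_val k u j) `^ p) k _ _ z.
move=> h; apply: (cvgP _ (h _)) => j jk.
by rewrite /single_val (negbTE jk) rnorm0 powR0.
Qed.

Definition lp_single k u : L := LpSeq p1 (single_valP k u).

Lemma lp_singleE k u j : lp_single k u j = if j == k then u else 0.
Proof. by []. Qed.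

Lemma lp_seq_ext (x y : L) : (forall j, x j = y j) -> x = y.
Proof. by move=> h; apply/val_inj/funext. Qed.

Lemma lp_single_linear k a u v :
  lp_single k (a *: u + v) = a *: lp_single k u + lp_single k v.
Proof.
apply: lp_seq_ext => j; rewrite lp_seqP !lp_singleE.
by case: ifP => // _; rewrite scaler0 addr0.
Qed.

Lemma rnorm_lp_single (z : L) k u :
  n (z + lp_single k u) `^ p = (n z `^ p - n (z k) `^ p) + n (z k + u) `^ p.
Proof.
have h := @cvg_series_change (fun j => n (z j) `^ p)
  (fun j => n ((z + lp_single k u) j) `^ p) k _ _ (@rnorm_lp_seqX z).
have coord j : (z + lp_single k u) j = z j + lp_single k u j.
  by have := lp_seqP 1 z (lp_single k u) j; rewrite !scale1r.
have off j : j != k -> n (z j) `^ p = n ((z + lp_single k u) j) `^ p.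
  by move=> jk; rewrite coord lp_singleE (negbTE jk) addr0.
have e := seq_lim_uniq (@rnorm_lp_seqX (z + lp_single k u)) (h off).
have ek : (z + lp_single k u) k = z k + u by rewrite coord lp_singleE eqxx.
apply: (etrans e); rewrite ek; ring.
Qed.

Let tail_val m (x : L) : nat -> V := fun j => if (j < m)%N then 0 else x j.

Let tail_series m (x : L) :
  series (fun j => n (tail_val m x j) `^ p) i @[i --> \oo] -->
  n x `^ p - series (fun j => n (x j) `^ p) m.
Proof.
elim: m => [|m IHm].
  rewrite /series /= big_nil subr0; exact: rnorm_lp_seqX.
have h := @cvg_series_change _ (fun j => n (tail_val m.+1 x j) `^ p) m _ _ IHm.
rewrite /tail_val ltnn ltnSn rnorm0 powR0// in h.
rewrite /series /= big_nat_recr//= opprD addrA.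
rewrite sub0r in h; apply: h => j jm.
by rewrite /tail_val ltnS (leq_eqVlt j) (negbTE jm).
Qed.

Let tail_valP m x : tail_val m x \in lp_finite s p V.
Proof. by apply/asboolP/(cvgP _ (@tail_series m x)). Qed.

Let tail m x : L := LpSeq p1 (tail_valP m x).

Let rnorm_tail m x : n (tail m x) `^ p = n x `^ p - series (fun j => n (x j) `^ p) m.
Proof. exact: (seq_lim_uniq (@rnorm_lp_seqX (tail m x)) (@tail_series m x)). Qed.

(** Finitely supported sequences are dense: dropping the first [m] terms leaves
    the difference of the two forms unchanged, while the tails tend to 0. *)
Lemma lp_form_ext (phi psi : L -> K) (x : L) : scalar phi -> scalar psi ->
  (forall v, `|phi v| <= `|v|) -> (forall v, `|psi v| <= `|v|) ->
  (forall k u, phi (lp_single k u) = psi (lp_single k u)) -> phi x = psi x.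
Proof.
move=> lphi lpsi bphi bpsi e.
have D m : phi x - psi x = phi (tail m x) - psi (tail m x).
  elim: m => [|m ->].
    by congr (phi _ - psi _); apply: lp_seq_ext.
  have -> : tail m x = 1 *: lp_single m (x m) + tail m.+1 x.
    apply: lp_seq_ext => j; rewrite lp_seqP scale1r lp_singleE /= /tail_val ltnS.
    by case: ltngtP => [jm|jm|->]; rewrite ?addr0 ?add0r.
  by rewrite lphi lpsi e !mul1r opprD addrACA subrr add0r.
apply/eqP; rewrite -subr_eq0 -(rabs_eq0 s); set d := rabs s _.
have d0 : 0 <= d by exact: rabs_ge0.
have dm m : (d / 2) `^ p <= n x `^ p - series (fun j => n (x j) `^ p) m.
  rewrite -rnorm_tail; apply: ge0_ler_powR; rewrite ?nnegrE ?rnorm_ge0 ?(ltW p_gt0) ?divr_ge0//.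
  rewrite ler_pdivrMr// mulrDr mulr1 /d (D m); apply: le_trans (rabsD _ _ _) _.
  by rewrite rabsN lerD// rabs_rnorm.
have lim : n x `^ p - series (fun j => n (x j) `^ p) m @[m --> \oo] --> n x `^ p - n x `^ p.
  exact: (cvgB (cvg_cst _) (@rnorm_lp_seqX x)).
have : (d / 2) `^ p <= n x `^ p - n x `^ p.
  rewrite -(cvg_lim _ lim)//; apply: limr_ge; first exact: cvgP lim.
  by near=> m; exact: dm.
rewrite subrr => h.
have /powR_eq0_eq0/eqP : (d / 2) `^ p = 0 by apply/le_anti; rewrite h powR_ge0.
by rewrite mulf_eq0 invr_eq0 pnatr_eq0 orbF.
Unshelve. all: by end_near.
Qed.

(** The weighted sum of the forms norming the components of [z]. It is
    enough to sum the real parts, which determine the form; their series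
    converges absolutely by Young's inequality, applied termwise with the
    normalisation that makes the bounds add up to [|x|]. *)
Lemma lp_dual_form (z : L) (J : V -> V -> K) : (forall v, norming v (J v)) -> z != 0 ->
  exists phi : L -> K, norming z phi.
Proof.
move=> nJ z0; pose N := n z; have N0 : 0 < N by rewrite /N rnorm_gt0.
pose t (x : L) (j : nat) : R := (n (z j) / N) `^ (p - 1) * realpart s (J (z j) (x j)).
pose B (M : R) (c d : nat -> R) (j : nat) : R :=
  M * (1 - p^-1) / N `^ p * c j + M * p^-1 / M `^ p * d j.
have cvgB (x : L) (M : R) :
    series (B M (fun j => n (z j) `^ p) (fun j => n (x j) `^ p)) m @[m --> \oo] -->
    M * (1 - p^-1) / N `^ p * N `^ p + M * p^-1 / M `^ p * n x `^ p.
  have -> : series (B M (fun j => n (z j) `^ p) (fun j => n (x j) `^ p)) = fun m =>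
      M * (1 - p^-1) / N `^ p * series (fun j => n (z j) `^ p) m +
      M * p^-1 / M `^ p * series (fun j => n (x j) `^ p) m.
    by apply/funext => m; rewrite /series /= big_split /= -!mulr_sumr.
  exact: (cvgD (cvgM (cvg_cst _) (@rnorm_lp_seqX z)) (cvgM (cvg_cst _) (@rnorm_lp_seqX x))).
have tB (x : L) M j : 0 < M -> `|t x j| <= B M (fun j => n (z j) `^ p) (fun j => n (x j) `^ p) j.
  move=> M0; rewrite /t normrM ger0_norm ?powR_ge0//.
  apply: le_trans (hoelder_term (rnorm_ge0 s (z j)) (rnorm_ge0 s (x j)) N0 M0).
  rewrite ler_wpM2l ?powR_ge0//; apply: le_trans (normrabs_realpart _ _) _.
  by rewrite rabs_rnorm; have [_ le _] := nJ (z j); exact: le.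
have ct (x : L) : cvgn (series (t x)).
  apply: normed_cvg; apply: series_le_cvg (cvgP _ (cvgB x 1)) => j.
  - exact: normr_ge0.
  - exact: le_trans (normr_ge0 _) (tB x 1 j ltr01).
  - exact: tB x 1 j ltr01.
apply: (norming_exists_of_real_form (s := s)); exists (fun x : L => limn (series (t x))); split.
- move=> u v; rewrite -(lim_seriesD (ct u) (ct v)); congr (limn (series _)); apply/funext => j.
  have [lin _ _] := nJ (z j); have := lp_seqP 1 u v j; rewrite /t !scale1r => ->.
  by rewrite (scalar_formD lin) realpartD mulrDr.
- move=> r v; rewrite -[RHS](lim_seriesZ r (ct v)); congr (limn (series _)); apply/funext => j.
  have [lin _ _] := nJ (z j); have := lp_seqP (ofreal s r) v 0 j; rewrite /t !addr0 => ->.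
  by rewrite (scalar_formZ lin) realpartZ mulrCA.
- move=> x; have [->|x0] := eqVneq x 0.
    rewrite rnorm0 (_ : t 0 = fun=> 0).
      by rewrite (_ : series _ = fun=> 0) ?lim_cst//; apply/funext => m; rewrite /series /= big1.
    apply/funext => j; have [lin _ _] := nJ (z j).
    by rewrite /t (_ : (0 : L) j = 0)// (scalar_form0 lin) realpart0 mulr0.
  have M0 : 0 < n x by rewrite rnorm_gt0.
  rewrite -[leRHS](hoelder_total N0 M0) -(cvg_lim _ (cvgB x (n x)))//.
  apply: lim_series_le => //; first exact: cvgP (cvgB x (n x)).
  by move=> j; apply: le_trans (ler_norm _) (tB x _ j M0).
have tz : t z = fun j => N / N `^ p * n (z j) `^ p.
  apply/funext => j; rewrite /t; have [_ ->] := norming_realpart s (nJ (z j)).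
  by rewrite dual_self ?rnorm_ge0.
have lim : series (t z) m @[m --> \oo] --> N / N `^ p * n z `^ p.
  have -> : series (t z) = fun m => N / N `^ p * series (fun j => n (z j) `^ p) m.
    by rewrite tz; apply/funext => m; rewrite /series /= -mulr_sumr.
  exact: (cvgM (cvg_cst _) (@rnorm_lp_seqX z)).
by rewrite (cvg_lim _ lim)// divfK// gt_eqF// powR_gt0.
Qed.

Lemma norm_smooth_lp_seq : norm_smooth V -> norm_smooth L.
Proof.
move=> smV z z0; have [J [nJ _]] := norm_smooth_dual smV.
have [phi nphi] := lp_dual_form nJ z0; exists phi; split=> // psi npsi.
have [[lphi bphi _] [lpsi bpsi _]] := (nphi, npsi).
apply/funext => x; apply: lp_form_ext => // k u.
exact: (@coordinate_form_uniq R K s p L V (lp_single k) z (z k)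
  (n z `^ p - n (z k) `^ p) p1 (lp_single_linear k) (rnorm_lp_single z k) z0 smV
  psi phi npsi nphi u).
Qed.

End Seq.

End LpSmooth.

(** * A nonlinear map preserving the semi-inner product *)

Section LpShift.
Variables (R : realType) (K : numFieldType) (s : RorC R K) (p : R) (p1 : 1 < p).
Variable V : normedModType K.
Local Notation L := (lp_seq s p1 V : normedModType K).
Local Notation n := (rnorm s).

Let cons_val (a : V) (x : nat -> V) : nat -> V := fun j => if j is j'.+1 then x j' else a.

Let cons_series (a : V) (x : L) :
  series (fun j => n (cons_val a x j) `^ p) m @[m --> \oo] --> n a `^ p + n x `^ p.
Proof.
rewrite -cvg_shiftS.
have -> : (fun m => series (fun j => n (cons_val a x j) `^ p) m.+1) =
    fun m => n a `^ p + series (fun j => n (x j) `^ p) m.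
  by apply/funext => m; rewrite /series /= big_nat_recl.
exact: (cvgD (cvg_cst _) (@rnorm_lp_seqX R K s p p1 V x)).
Qed.

Let shift_series (x : L) :
  series (fun j => n (x j.+1) `^ p) m @[m --> \oo] --> n x `^ p - n (x 0%N) `^ p.
Proof.
have -> : series (fun j => n (x j.+1) `^ p) =
    fun m => series (fun j => n (x j) `^ p) m.+1 - n (x 0%N) `^ p.
  by apply/funext => m; rewrite /series /= big_nat_recl// addrAC subrr add0r.
apply: (cvgB _ (cvg_cst _)).
rewrite (cvg_shiftS (series (fun j => n (x j) `^ p))); exact: (@rnorm_lp_seqX R K s p p1 V x).
Qed.

Let cons_valP a (x : L) : cons_val a x \in lp_finite s p V.
Proof. by apply/asboolP/(cvgP _ (@cons_series a x)). Qed.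

Let shift_valP (x : L) : (fun j => x j.+1) \in lp_finite s p V.
Proof. by apply/asboolP/(cvgP _ (@shift_series x)). Qed.

Definition lp_cons a x : L := LpSeq p1 (cons_valP a x).
Definition lp_behead x : L := LpSeq p1 (shift_valP x).

Lemma rnorm_lp_cons a x : n (lp_cons a x) `^ p = n a `^ p + n x `^ p.
Proof. exact: (seq_lim_uniq (@rnorm_lp_seqX R K s p p1 V (lp_cons a x)) (@cons_series a x)). Qed.

Lemma rnorm_lp_behead x : n (lp_behead x) `^ p = n x `^ p - n (x 0%N) `^ p.
Proof. exact: (seq_lim_uniq (@rnorm_lp_seqX R K s p p1 V (lp_behead x)) (@shift_series x)). Qed.

Lemma lp_behead_linear k x y : lp_behead (k *: x + y) = k *: lp_behead x + lp_behead y.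
Proof. exact: lp_seq_ext. Qed.

Lemma lp_cons_linear k a b x y :
  lp_cons (k *: a + b) (k *: x + y) = k *: lp_cons a x + lp_cons b y.
Proof. by apply: lp_seq_ext => -[]. Qed.

Lemma lp_consK a x : lp_behead (lp_cons a x) = x.
Proof. exact: lp_seq_ext. Qed.

Lemma lp_behead_cons (x : L) : lp_cons (x 0%N) (lp_behead x) = x.
Proof. by apply: lp_seq_ext => -[]. Qed.

End LpShift.

(** If [r] is a linear contraction and [f] a norm preserving right inverse of
    [r], then for [phi] norming [z] the form [phi \o r] norms [f z]; hence [f]
    preserves the semi-inner product, linear or not. *)
Lemma not_SL_of_section (R : realType) (K : numFieldType) (s : RorC R K)
    (Z : normedModType K) (f r : Z -> Z) :
  norm_smooth Z -> (forall k u v, r (k *: u + v) = k *: r u + r v) ->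
  (forall z, `|r z| <= `|z|) -> (forall z, r (f z) = z) -> (forall z, `|f z| = `|z|) ->
  ~ linear f -> ~ SL s Z.
Proof.
move=> smZ lin_r r_le rf f_norm nlin sl; apply: nlin.
have [sip sipP sipE] := norm_smooth_sip s smZ.
have sip0 x : sip x 0 = 0.
  have [_ _ h _] := sipP; have := h x 0.
  by rewrite normr0 mulr0 normr_le0 => /eqP.
apply: (sl sip sipP) => x z; have [->|z0] := eqVneq z 0.
  have -> : f 0 = 0 by apply/eqP; rewrite -normr_eq0 f_norm normr0.
  by rewrite !sip0.
have [phi [nphi _]] := smZ z z0; have [lin le eq] := nphi.
have fz0 : f z != 0 by rewrite -normr_eq0 f_norm normr_eq0.
have nf : norming (f z) (fun v => phi (r v)).
  split=> [a u v|v|].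
  - by rewrite lin_r lin.
  - exact: le_trans (le _) (r_le _).
  - by rewrite rf eq f_norm.
by rewrite (sipE _ _ fz0 nf) (sipE _ _ z0 nphi) rf f_norm.
Qed.

(** The map [f] moves the sequence in [W] one step to the left and writes the lift
    of the term that falls off in front of the sequence in [X]. Its left inverse
    [r] moves back and projects by [pi]. *)
Section ShiftIntoLift.
Variables (R : realType) (K : numFieldType) (s : RorC R K) (p : R) (p1 : 1 < p).
Variables (X W : normedModType K) (pi : X -> W) (sigma : W -> X).
Hypothesis pi_linear : forall k u v, pi (k *: u + v) = k *: pi u + pi v.
Hypothesis pi_le : forall x, `|pi x| <= `|x|.
Hypothesis sigmaK : cancel sigma pi.
Hypothesis sigma_norm : forall w, `|sigma w| = `|w|.
Local Notation LW := (lp_seq s p1 W : normedModType K).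
Local Notation LX := (lp_seq s p1 X : normedModType K).
Local Notation Z := (lp_pair s p1 LW LX : normedModType K).

Let p_gt0 : 0 < p. Proof. exact: lt_trans p1. Qed.

Let eq_ler (a b : R) : a = b -> a <= b. Proof. by move=> ->. Qed.

Let powR_le_inv (a b : R) : 0 <= a -> 0 <= b -> a `^ p <= b `^ p -> a <= b.
Proof.
move=> a0 b0 h; rewrite leNgt; apply/negP => ba.
have := @gt0_ltr_powR R p p_gt0 b a; rewrite !nnegrE => /(_ b0 a0 ba).
by rewrite ltNge h.
Qed.

Let norm_le_powR (u v : Z) : rnorm s u `^ p <= rnorm s v `^ p -> `|u| <= `|v|.
Proof. by move=> h; rewrite -(rnorm_le s) powR_le_inv ?rnorm_ge0. Qed.

Let rnorm_sigma w : rnorm s (sigma w) = rnorm s w.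
Proof. by apply: (@ofreal_inj _ _ s); rewrite !ofreal_rnorm. Qed.

Let rnorm_pi x : rnorm s (pi x) <= rnorm s x.
Proof. by rewrite -(ofreal_le s) !ofreal_rnorm. Qed.

Let f (z : Z) : Z := (lp_behead z.1, lp_cons (sigma (z.1 0%N)) z.2).
Let r (z : Z) : Z := (lp_cons (pi (z.2 0%N)) z.1, lp_behead z.2).

Let f_norm z : `|f z| = `|z|.
Proof.
have e : rnorm s (f z) `^ p = rnorm s z `^ p.
  apply: (etrans (@rnorm_lp_pairX R K s p p1 LW LX (f z))).
  apply: (etrans _ (esym (@rnorm_lp_pairX R K s p p1 LW LX z))).
  apply: (etrans (congr2 +%R (@rnorm_lp_behead R K s p p1 W z.1)
    (@rnorm_lp_cons R K s p p1 X (sigma (z.1 0%N)) z.2))).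
  by rewrite rnorm_sigma addrA subrK.
by apply/le_anti/andP; split; apply: norm_le_powR; [exact: eq_ler e|exact: eq_ler (esym e)].
Qed.

Let r_le z : `|r z| <= `|z|.
Proof.
apply: norm_le_powR.
have aux (a b c d : R) : a <= d -> a + b + (c - d) <= b + c by lra.
have h : rnorm s (pi (z.2 0%N)) `^ p <= rnorm s (z.2 0%N) `^ p.
  by apply: ge0_ler_powR; rewrite ?nnegrE ?rnorm_ge0// ltW.
have e1 := @rnorm_lp_pairX R K s p p1 LW LX (r z).
have e2 := @rnorm_lp_pairX R K s p p1 LW LX z.
have e3 := @rnorm_lp_cons R K s p p1 W (pi (z.2 0%N)) z.1.
have e4 := @rnorm_lp_behead R K s p p1 X z.2.
apply: (@le_trans _ _ (rnorm s (r z).1 `^ p + rnorm s (r z).2 `^ p)).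
  exact: eq_ler e1.
apply: (@le_trans _ _ (rnorm s z.1 `^ p + rnorm s z.2 `^ p)); last first.
  exact: eq_ler (esym e2).
apply: (@le_trans _ _ ((rnorm s (pi (z.2 0%N)) `^ p + rnorm s z.1 `^ p) +
    (rnorm s z.2 `^ p - rnorm s (z.2 0%N) `^ p))).
  exact: eq_ler (congr2 +%R e3 e4).
exact: aux h.
Qed.

Let r_linear k u v : r (k *: u + v) = k *: r u + r v.
Proof.
rewrite -[RHS]/(k *: lp_cons (pi (u.2 0%N)) u.1 + lp_cons (pi (v.2 0%N)) v.1,
  k *: lp_behead u.2 + lp_behead v.2).
by rewrite -lp_cons_linear -lp_behead_linear -pi_linear.
Qed.

Let rf z : r (f z) = z.
Proof. by case: z => w x; rewrite /r /f /= sigmaK lp_behead_cons lp_consK. Qed.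

Lemma not_SL_of_nonlinear_lift : norm_smooth Z ->
  ~ (forall k u v, sigma (k *: u + v) = k *: sigma u + sigma v) -> ~ SL s Z.
Proof.
move=> smZ nlin; apply: (not_SL_of_section smZ r_linear r_le rf f_norm) => lin_f.
apply: nlin => k u v; pose e w : Z := (lp_cons w (0 : LW), 0).
have eP : e (k *: u + v) = k *: e u + e v.
  rewrite /e -[RHS]/(k *: lp_cons u (0 : LW) + lp_cons v (0 : LW), k *: (0 : LX) + 0).
  by rewrite -lp_cons_linear !scaler0 !addr0.
by have := congr1 (fun z : Z => z.2 0%N) (lin_f k (e u) (e v)); rewrite -eP.
Qed.

End ShiftIntoLift.

Theorem theorem1p1 (R : realType) (K : numFieldType) (s : RorC R K)
  (p : R) (p_gt1 : 1 < p) (X : normedModType K)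
  (X_dim : has_dim 3 [set: X]) (X_smooth : smooth s X)
  (X_sconvex : strictly_convex X) (X_not_ip : ~ inner_product_space s X) :
  exists Y : closedSubspace X,
    has_dim 1 [set` Y] /\
    let W : normedModType K := quotient_space s Y in
    let Z : normedModType K :=
      lp_pair s p_gt1 (lp_seq s p_gt1 W) (lp_seq s p_gt1 X) in
    smooth s Z /\ ~ SL s Z.
Proof.
have smX : norm_smooth X by exact: (smoothP s X).1.
have [y y0 ngood] : exists2 y : X, y != 0 & ~ linear_nearest y.
  apply: contrapT => h; apply: X_not_ip.
  have [J [nJ [uJ J0]]] := norm_smooth_dual smX.
  apply: (@inner_product_of_linear_nearest R K s X J nJ uJ J0 X_sconvex X_dim) => y y0.
  by apply: contrapT => ny; apply: h; exists y.
exists (line_subspace s y0); split; first exact: line_dim.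
move=> W Z.
have [sigma sigmaP] := quotient_line_lift s y0.
pose pi : X -> W := @quotient_pi R K s X (line_subspace s y0).
have pi_lin k u v : pi (k *: u + v) = k *: pi u + pi v.
  rewrite /pi quotient_piD; congr (_ + _).
  exact: (esym (@quotient_scale_pi R K s X (line_subspace s y0) k u)).
have pi_rle x : rnorm s (pi x) <= rnorm s x.
  rewrite (@rnorm_quotient R K s X (line_subspace s y0)); exact: quotient_norm_le.
have pi_le x : `|pi x| <= `|x|.
  by rewrite -(ofreal_rnorm s) -[leRHS](ofreal_rnorm s) ofreal_le.
have pi_eq0 x : pi x = 0 <-> exists t, x = t *: y := quotient_line_eq0 s y0 x.
have sigmaK : cancel sigma pi by move=> w; have [] := sigmaP w.
have sigma_norm w : `|sigma w| = `|w| by have [] := sigmaP w.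
have [b [b_free b_all]] := X_dim.
have b_span v : exists c : 'I_3 -> K, v = \sum_i c i *: b i.
  by have : [set: X] v by []; rewrite b_all => -[c ->]; exists c.
have smW : norm_smooth W.
  apply: (norm_smooth_quotient pi_lin pi_le pi_eq0 sigmaK sigma_norm smX) => x phi x0 hx nphi.
  exact: (@birkhoff_orthogonal R K s X 3 b b_free b_span smX x y phi x0 hx nphi).
have smZ : norm_smooth Z.
  by apply: norm_smooth_lp_pair; apply: norm_smooth_lp_seq.
split; first exact: (smoothP s Z).2.
apply: (@not_SL_of_nonlinear_lift R K s p p_gt1 X W pi sigma pi_lin pi_le sigmaK sigma_norm smZ).
move=> lin; apply: ngood.
exact: (linear_nearest_of_lift pi_lin pi_le pi_eq0 sigmaK sigma_norm y0 lin).
Qed.
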